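(* Let $\mathscr{P}$ be an irreducible subfactor planar algebra and let $p,q$ be nonzero projections in $\mathscr{P}_{2,\pm}$. Then $$\max\{tr_2(p),tr_2(q)\}\le\mathcal{S}(p*q)\le tr_2(p)\,tr_2(q).$$ Moreover, the following statements are equivalent: (1) $\mathcal{S}(p*q)=tr_2(p)$; (2) $\frac{\delta}{tr_2(q)}\,p*q$ is a projection; (3) $\mathcal{S}(p*(q*\overline{q})^{*(m)}*q^{*(j)})=tr_2(p)$ for some $m\ge0$, $j\in\{0,1\}$, $m+j>0$; (4) $\mathcal{S}(p*(q*\overline{q})^{*(m)}*q^{*(j)})=tr_2(p)$ for any $m\ge0$, $j\in\{0,1\}$, $m+j>0$; (5) there exists a biprojection $B$ in $\mathscr{P}_{2,\pm}$ such that $q$ is a right subshift of $B$ and $p=\mathcal{R}(x*B)$ for some positive $x\in\mathscr{P}_{2,\pm}$; (6) $\|p*q\|_t=\frac1\delta\|p\|_t\|q\|_1$ for some $1<t<\infty$; (7) $\|p*q\|_t=\frac1\delta\|p\|_t\|q\|_1$ for any $1\le t\le\infty$; (8) $B_1\le B_2$, where $B_1$ is the biprojection generated by $q*\overline{q}$ and $B_2$ is the spectral projection of $\overline{p}*p$ corresponding to $\frac{tr_2(p)}{\delta}$.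
   Context: A subfactor planar algebra $\mathscr{P}=\{\mathscr{P}_{n,\pm}\}_{n\ge0}$ is a shaded planar $*$-algebra (in the sense of Jones) over $\mathbb{C}$ with all $\mathscr{P}_{n,\pm}$ finite dimensional, $\dim\mathscr{P}_{0,\pm}=1$, spherical, with positive definite trace forms. $\delta$ is the value of a closed loop. It is irreducible if $\dim\mathscr{P}_{1,\pm}=1$. The 2-box spaces $\mathscr{P}_{2,+},\mathscr{P}_{2,-}$ are finite-dimensional $C^*$-algebras under vertical composition, with identity $1$ (two vertical strings) and involution $x\mapsto x^*$ (vertical reflection). $tr_2$ is the unnormalized Markov trace (closing up the diagram), $tr_2(1)=\delta^2$. The string Fourier transform $\mathfrak{F}:\mathscr{P}_{2,\pm}\to\mathscr{P}_{2,\mp}$ is the linear bijection given by the clockwise one-string ($90^\circ$) rotation. The contragredient is $\overline{x}=\mathfrak{F}^2(x)$. The coproduct (convolution) of $x,y\in\mathscr{P}_{2,\pm}$ is the element $x*y\in\mathscr{P}_{2,\pm}$ obtained by placing $x$ to the left of $y$ and joining the top right string of $x$ to the top left string of $y$ and likewise at the bottom; equivalently $x*y=\mathfrak{F}(\mathfrak{F}^{-1}(x)\mathfrak{F}^{-1}(y))$. $x^{*(k)}$ is the $k$-fold coproduct $x*\cdots*x$ for $k\ge1$, and $x^{*(0)}=e_1$, the Jones projection ($\frac1\delta$ times the cup-cap diagram). Norms: $\|x\|_t=tr_2(|x|^t)^{1/t}$ for $1\le t<\infty$, and $\|x\|_\infty$ is the operator norm. $\mathcal{R}(x)$ is the range projection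 of $x$ and $\mathcal{S}(x)=tr_2(\mathcal{R}(x))$. A projection $B\in\mathscr{P}_{2,\pm}$ is a biprojection if $\mathfrak{F}(B)$ is a multiple of a projection. The biprojection generated by $x$ is the smallest biprojection $B$ with $BxB=x$ (it exists). A projection $p$ is a right shift of a biprojection $B$ if $tr_2(p)=tr_2(B)$ and $B*p=\frac{tr_2(B)}{\delta}p$. A projection $q$ is a right subshift of $B$ if $q\le B_g$ for some right shift $B_g$ of $B$. One has $\|\overline{p}*p\|_\infty=tr_2(p)/\delta$, and $B_2$ (the spectral projection at this value) is a biprojection. *)

(* Defs.v *)
(* Shaded planar *-algebras in the sense of Jones, with planar tangles encoded
   combinatorially; subfactor planar algebras; the C*-algebras of 2-boxes.

   A color (n, s) stands for the n-box space P_{n,+} (s = false, the marked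
   interval lies in an unshaded region) or P_{n,-} (s = true, shaded). *)
From HB Require Import structures.
From mathcomp Require Import all_boot all_order all_algebra.
From mathcomp Require Import complex.
From mathcomp Require Import all_classical all_reals all_analysis.

Set Implicit Arguments.
Unset Strict Implicit.
Unset Printing Implicit Defensive.

Import Order.TTheory GRing.Theory Num.Theory.

Local Open Scope ring_scope.
Local Open Scope complex_scope.

(** * Shaded planar tangles *)

Definition color := (nat * bool)%type.

(* The discs of a tangle are [None] (the output disc) and [Some d] (the input
   discs). *)
Definition disc_color (D : Type) (col : D -> color) (c : color)
  (d : option D) : color := if d is Some d' then col d' else c.

(* A tangle up to isotopy is recorded by its strings (closed loops included),
   its regions, the shading of the regions, and their incidences.  A disc of
   color (n, s) has 2n boundary points, numbered 0, ..., 2n-1 clockwise (as seen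
   in the plane, for the output disc too) from the marked interval; interval i
   precedes point i and follows point i-1, so that intervals 0 and 2n are both
   the marked interval.
     side b e  is the region of shading b along the string e;
     pt d j    is the string ending at the point j of the disc d;
     iv d i    is the region at the interval i of the disc d. *)
Record tangle (D : finType) (col : D -> color) (c : color) := Tangle {
  str : finType;
  reg : finType;
  shade : reg -> bool;
  side : bool -> str -> reg;
  pt : forall d : option D, 'I_(disc_color col c d).1.*2 -> str;
  iv : forall d : option D, 'I_(disc_color col c d).1.*2.+1 -> reg
}.

Arguments shade {D col c} T r : rename.
Arguments side {D col c} T b e : rename.
Arguments pt {D col c} T d j : rename.
Arguments iv {D col c} T d i : rename.

Section Planarity.
Variables (D : finType) (col : D -> color) (c : color) (T : tangle col c).
Local Notation dcol := (disc_color col c).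

Definition before n (j : 'I_n) : 'I_n.+1 := widen_ord (leqnSn n) j.
Definition after n (j : 'I_n) : 'I_n.+1 := lift ord0 j.

(* The shading of the interval i of the disc d. *)
Definition iv_shade (d : option D) (i : nat) : bool := (dcol d).2 (+) odd i.

Definition compatible_incidence : Prop :=
  [/\ forall b e, shade T (side T b e) = b,
      forall d i, shade T (iv T d i) = iv_shade d i,
      forall d, iv T d ord0 = iv T d ord_max &
      forall d (j : 'I_(dcol d).1.*2),
        side T (iv_shade d j) (pt T d j) = iv T d (before j) /\
        side T (~~ iv_shade d j) (pt T d j) = iv T d (after j)].

Definition endpoint : finType := {d : option D & 'I_(dcol d).1.*2}.

(* Orient every string with its shaded region on a fixed hand: this tells
   whether it leaves its disc at x.  The output disc is seen from its
   other side. *)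
Definition outgoing (x : endpoint) : bool :=
  (tag x == None) (+) iv_shade (tag x) (tagged x).

Definition n_ends (e : str T) (b : bool) : nat :=
  #|[pred x : endpoint | (pt T (tag x) (tagged x) == e) && (outgoing x == b)]|.

(* Every string is a closed loop, or has one outgoing and one incoming end. *)
Definition strings_ok : Prop :=
  forall e, (n_ends e true = n_ends e false) /\ (n_ends e true <= 1)%N.

Definition adjacent_regions : rel (reg T) := fun r r' =>
  [exists e, exists b, (side T b e == r) && (side T (~~ b) e == r')].

(* The boundaries of the regions are made of disc intervals and sides of
   strings. *)
Definition bd_piece : finType :=
  ({d : option D & 'I_(dcol d).1.*2.+1} + str T * bool)%type.

Definition touches (u v : bd_piece) : bool :=
  match u, v with
  | inl x, inr (e, b) =>
      [exists j, [&& pt T (tag x) j == e, b == iv_shade (tag x) (tagged x) &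
                     (tagged x == before j) || (tagged x == after j)]]
  | inl x, inl y =>
      (* intervals 0 and 2n of a disc coincide *)
      [&& tag x == tag y, tagged x == 0 :> nat &
          tagged y == (dcol (tag y)).1.*2 :> nat]
  | _, _ => false
  end.

Definition n_region_bd : nat :=
  n_comp (fun u v => touches u v || touches v u) predT.

(* The strings with endpoints are half as many as the points. *)
Definition n_arcs : nat := (c.1 + \sum_(d : D) (col d).1)%N.

(* Collapse the discs, output disc included, to the vertices of a closed
   surface; a region with b boundary components has Euler characteristic 2 - b.
   The surface is a sphere iff it is connected of Euler characteristic 2. *)
Definition euler_sphere : Prop :=
  (#|D|.+1%:Z - n_arcs%:Z + 2 * #|reg T|%:Z - n_region_bd%:Z = 2)%R.

Definition planar : Prop :=
  [/\ compatible_incidence, strings_ok,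
      forall r r' : reg T, connect adjacent_regions r r' & euler_sphere].

End Planarity.

(** * The operations on tangles *)

(* Pushout of the families of maps a_d : X_d -> A and b_d : X_d -> B_d. *)
Definition is_pushout (D : Type) (X : D -> Type) (A : Type) (B : D -> Type)
    (C : Type) (a : forall d, X d -> A) (b : forall d, X d -> B d)
    (h : A -> C) (k : forall d, B d -> C) : Prop :=
  (forall d x, h (a d x) = k d (b d x)) /\
  forall (Y : Type) (h' : A -> Y) (k' : forall d, B d -> Y),
    (forall d x, h' (a d x) = k' d (b d x)) ->
    exists! g : C -> Y,
      (forall y, h' y = g (h y)) /\ (forall d y, k' d y = g (k d y)).

(* U is obtained by filling every input disc d of T with the tangle S d.  Its
   input discs are identified with those of the S d by the bijection f.  The
   strings (regions) of U are the connected components of the union of those of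
   T and of the S d, glued along the points (intervals) of the filled discs. *)
Definition is_gluing (D : finType) (col : D -> color) (c : color)
    (T : tangle col c)
    (E : D -> finType) (cols : forall d, E d -> color)
    (S : forall d, tangle (cols d) (col d))
    (F : finType) (f : F -> {d : D & E d})
    (U : tangle (fun u => cols (tag (f u)) (tagged (f u))) c) : Prop :=
  bijective f /\
  exists (sT : str T -> str U) (sS : forall d, str (S d) -> str U)
         (rT : reg T -> reg U) (rS : forall d, reg (S d) -> reg U),
  [/\ is_pushout (fun d => pt T (Some d))
                 (fun d => pt (S d) None) sT sS,
      is_pushout (fun d => iv T (Some d))
                 (fun d => iv (S d) None) rT rS,
      [/\ forall r, shade U (rT r) = shade T r,
          forall d r, shade U (rS d r) = shade (S d) r,
          forall b e, side U b (sT e) = rT (side T b e) &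
          forall d b e, side U b (sS d e) = rS d (side (S d) b e)],
      (forall j, pt U None j = sT (pt T None j)) /\
      (forall i, iv U None i = rT (iv T None i)) &
      (forall u j, pt U (Some u) j =
                   sS _ (pt (S _) (Some (tagged (f u))) j)) /\
      (forall u i, iv U (Some u) i =
                   rS _ (iv (S _) (Some (tagged (f u))) i))].

(* The mirror image, by a reflection preserving the marked intervals. *)
Definition reflect_tangle (D : finType) (col : D -> color) (c : color)
    (T : tangle col c) : tangle col c :=
  @Tangle D col c (str T) (reg T) (shade T) (side T)
    (fun d j => pt T d (rev_ord j))
    (fun d i => iv T d (rev_ord i)).

(* Two tangles without output points that are isotopic on the sphere: they may
   only differ by the region containing the output disc. *)
Definition sphere_isotopic (D : finType) (col : D -> color) (s s' : bool)
    (T : tangle col (0%N, s)) (T' : tangle col (0%N, s')) : Prop :=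
  exists (f : str T -> str T') (g : reg T -> reg T'),
  [/\ bijective f /\ bijective g,
      forall r, shade T' (g r) = shade T r,
      forall b e, side T' b (f e) = g (side T b e),
      forall d j, pt T' (Some d) j = f (pt T (Some d) j) &
      forall d i, iv T' (Some d) i = g (iv T (Some d) i)].

(* n parallel radial strings joining the points of the two discs; [inZp]
   identifies the intervals 0 and 2n. *)
Definition id_tangle (c : color) : tangle (fun _ : unit => c) c :=
  @Tangle unit (fun _ => c) c 'I_c.1.*2 'I_c.1.*2.-1.+1
    (fun r => c.2 (+) odd r)
    (fun b j => inZp (if b == c.2 (+) odd j then j : nat else j.+1))
    (fun d => if d is Some _ then id else id)
    (fun d => if d is Some _ then (fun i => inZp i) else (fun i => inZp i)).

Definition empty_tangle (s : bool) :
    tangle (fun d : void => match d return color with end) (0%N, s) :=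
  @Tangle void _ (0%N, s) void unit (fun _ => s)
    (fun _ e => match e with end)
    (fun d => match d with Some e => match e with end
                         | None => fun j => False_rect void (notF (ltn_ord j))
              end)
    (fun _ _ => tt).

(* The closure of the box [true] stacked with the box [false]: the point j of
   the former is joined to the point 2n-1-j of the latter. *)
Definition pairing_tangle (c : color) :
    tangle (fun _ : bool => c) (0%N, c.2) :=
  @Tangle bool (fun _ => c) (0%N, c.2) 'I_c.1.*2 'I_c.1.*2.-1.+1
    (fun r => c.2 (+) odd r)
    (fun b j => inZp (if b == c.2 (+) odd j then j : nat else j.+1))
    (fun d => match d with
              | Some b => fun j => if b then j else rev_ord j
              | None => fun j => False_rect _ (notF (ltn_ord j))
              end)
    (fun d => match d with
              | Some b => fun i => inZp (if b then i : nat else rev_ord i)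
              | None => fun _ => inZp 0
              end).

(** * Planar algebras *)

Section PlanarAlgebras.
Variable R : realType.

Record planar_star_algebra := PlanarStarAlgebra {
  box : color -> vectType R[i];
  act : forall (D : finType) (col : D -> color) (c : color),
    tangle col c -> (forall d, box (col d)) -> box c;
  star : forall c, box c -> box c;
  act_linear : forall (D : finType) (col : D -> color) (c : color)
      (T : tangle col c) (x : forall d, box (col d)) (d : D),
    planar T -> linear (fun z : box (col d) => act T (dfwith x d z));
  act_id : forall c (x : box c), act (id_tangle c) (fun _ => x) = x;
  act_gluing : forall (D : finType) (col : D -> color) (c : color)
      (T : tangle col c) (E : D -> finType) (cols : forall d, E d -> color)
      (S : forall d, tangle (cols d) (col d))
      (F : finType) (f : F -> {d : D & E d})
      (U : tangle (fun u => cols (tag (f u)) (tagged (f u))) c)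
      (x : forall u : {d : D & E d}, box (cols (tag u) (tagged u))),
    planar T -> (forall d, planar (S d)) -> planar U ->
    is_gluing T S U ->
    act U (fun u => x (f u)) =
    act T (fun d => act (S d) (fun e => x (existT _ d e)));
  star_semilinear : forall c (a : R[i]) (x y : box c),
    star (a *: x + y) = a^*%R *: star x + star y;
  starK : forall c (x : box c), star (star x) = x;
  act_star : forall (D : finType) (col : D -> color) (c : color)
      (T : tangle col c) (x : forall d, box (col d)),
    planar T ->
    act (reflect_tangle T) (fun d => star (x d)) = star (act T x)
}.

Variable A : planar_star_algebra.

Definition empty_box (s : bool) : box A (0%N, s) :=
  act (empty_tangle s)
    (fun d => match d return box A (match d return color with end) with end).

(* The identification of P_{0,+} and P_{0,-} with the complex numbers, the empty
   diagram being sent to 1. *)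
Definition scalar (s : bool) (v : box A (0%N, s)) : R[i] :=
  coord [tuple empty_box s] ord0 v.

Definition is_spherical : Prop :=
  forall (D : finType) (col : D -> color) (s s' : bool)
    (T : tangle col (0%N, s)) (T' : tangle col (0%N, s'))
    (x : forall d, box A (col d)),
  planar T -> planar T' -> sphere_isotopic T T' ->
  scalar (act T x) = scalar (act T' x).

Definition is_subfactor_planar_algebra : Prop :=
  [/\ forall s, \dim {:box A (0%N, s)} = 1%N,
      is_spherical &
      forall c (x : box A c), x != 0 ->
        0 < scalar (act (pairing_tangle c)
                      (fun b : bool => if b then star x else x))].

Definition is_irreducible : Prop := forall s, \dim {:box A (1%N, s)} = 1%N.

End PlanarAlgebras.

(** * 2-boxes *)

(* A tangle with 2-boxes as inputs, given by tables.  The strings are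
   0, ..., m and the regions 0, ..., n; [sh] lists the regions of shading
   [~~ s] as [true], the i-th entry of [sd] gives the sides of the string i of
   shading [s] and [~~ s], and [ps], [rs] list the strings and the regions around
   each disc. *)
Definition table_tangle (D : finType) (c : color) (s : bool) (m n : nat)
    (sh : seq bool) (sd : seq (nat * nat)) (ps rs : option D -> seq nat) :
    tangle (fun _ : D => (2%N, s)) c :=
  @Tangle D (fun _ => (2%N, s)) c 'I_m.+1 'I_n.+1
    (fun r => s (+) nth false sh r)
    (fun b e => let p := nth (0%N, 0%N) sd e in
                inZp (if b == s then p.1 else p.2))
    (fun d j => inZp (nth 0%N (ps d) j))
    (fun d i => inZp (nth 0%N (rs d) i)).

Definition loop_tangle (s : bool) :=
  @table_tangle void (0%N, s) s 0 1 [:: false; true] [:: (0, 1)]%N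
    (fun _ => [::]) (fun _ => [:: 0]%N).

Definition unit_tangle (s : bool) :=
  @table_tangle void (2%N, s) s 1 2 [:: false; true; false]
    [:: (0, 1); (2, 1)]%N
    (fun _ => [:: 0; 1; 1; 0]%N) (fun _ => [:: 0; 1; 2; 1; 0]%N).

Definition cupcap_tangle (s : bool) :=
  @table_tangle void (2%N, s) s 1 2 [:: false; true; true]
    [:: (0, 1); (0, 2)]%N
    (fun _ => [:: 0; 0; 1; 1]%N) (fun _ => [:: 0; 1; 0; 2; 0]%N).

(* [true] above [false] *)
Definition mult_tangle (s : bool) :=
  @table_tangle bool (2%N, s) s 5 4 [:: false; true; false; true; true]
    [:: (0, 1); (2, 1); (2, 3); (0, 3); (2, 4); (0, 4)]%N
    (fun d => match d with
              | None => [:: 0; 1; 4; 5]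
              | Some true => [:: 0; 1; 2; 3]
              | Some false => [:: 3; 2; 4; 5]
              end%N)
    (fun d => match d with
              | None => [:: 0; 1; 2; 4; 0]
              | Some true => [:: 0; 1; 2; 3; 0]
              | Some false => [:: 0; 3; 2; 4; 0]
              end%N).

Definition trace_tangle (s : bool) :=
  @table_tangle unit (0%N, s) s 1 2 [:: false; true; false]
    [:: (0, 1); (2, 1)]%N
    (fun d => if d is Some _ then [:: 0; 1; 1; 0] else [::])%N
    (fun d => if d is Some _ then [:: 0; 1; 2; 1; 0] else [:: 0])%N.

(* The box is turned clockwise by 90 degrees: its point j comes at the place of
   the point j + 1. *)
Definition rotation_tangle (s : bool) :=
  @table_tangle unit (2%N, ~~ s) s 3 3 [:: false; true; false; true]
    [:: (0, 1); (2, 1); (2, 3); (0, 3)]%N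
    (fun d => if d is Some _ then [:: 0; 1; 2; 3] else [:: 3; 0; 1; 2])%N
    (fun d => if d is Some _ then [:: 0; 1; 2; 3; 0] else [:: 3; 0; 1; 2; 3])%N.

(* [true] to the left of [false] *)
Definition coprod_tangle (s : bool) :=
  @table_tangle bool (2%N, s) s 5 4 [:: false; true; false; false; true]
    [:: (0, 1); (2, 1); (3, 1); (3, 4); (2, 4); (0, 4)]%N
    (fun d => match d with
              | None => [:: 0; 2; 3; 5]
              | Some true => [:: 0; 1; 4; 5]
              | Some false => [:: 1; 2; 3; 4]
              end%N)
    (fun d => match d with
              | None => [:: 0; 1; 3; 4; 0]
              | Some true => [:: 0; 1; 2; 4; 0]
              | Some false => [:: 2; 1; 3; 4; 2]
              end%N).

Section TwoBoxes.
Variables (R : realType) (A : planar_star_algebra R).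
Local Notation C := R[i].
Local Notation P s := (box A (2%N, s)).

Definition no_input (s : bool) (d : void) : P s := match d with end.

(* The value of a closed loop. *)
Definition delta : C := scalar (act (loop_tangle false) (@no_input false)).

Definition one2 (s : bool) : P s := act (unit_tangle s) (@no_input s).

Definition jones_proj (s : bool) : P s :=
  delta^-1 *: act (cupcap_tangle s) (@no_input s).

Definition tr2 (s : bool) (x : P s) : C :=
  scalar (act (trace_tangle s) (fun _ => x)).

Definition fourier (s : bool) (x : P s) : P (~~ s) :=
  act (rotation_tangle s) (fun _ => x).

(* The square of the Fourier transform; the case analysis makes the types
   P (~~ ~~ s) and P s agree. *)
Definition contragredient (s : bool) : P s -> P s :=
  if s return P s -> P s
  then fun x => fourier (fourier x) else fun x => fourier (fourier x).

Definition coprod (s : bool) (x y : P s) : P s :=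
  act (coprod_tangle s) (fun b : bool => if b then x else y).

(* The product x y is y on top of x, so that the coproduct of x and y is
   F (F^-1 x F^-1 y) for the clockwise rotation F. *)
Definition mul2 (s : bool) (x y : P s) : P s :=
  act (mult_tangle s) (fun b : bool => if b then y else x).

Local Notation "x ∘ y" := (mul2 x y) (at level 40, left associativity).

Definition coprod_pow (s : bool) (x : P s) (k : nat) : P s :=
  if k is k'.+1 then iter k' (fun z => coprod z x) x else jones_proj s.

(** The C*-algebra structure *)

Definition is_proj (s : bool) (p : P s) : Prop := star p = p /\ p ∘ p = p.

Definition is_positive (s : bool) (x : P s) : Prop :=
  exists z : P s, x = star z ∘ z.

Definition le2 (s : bool) (x y : P s) : Prop := is_positive (y - x).

(* Functional calculus: the element sum_i f(l_i) e_i if x = sum_i l_i e_i for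
   mutually orthogonal projections e_i of sum 1 (and 0 if x is not normal). *)
Definition fun_calc (s : bool) (f : C -> C) (x : P s) : P s :=
  xget 0 [set y : P s | exists (n : nat) (l : 'I_n -> C) (e : 'I_n -> P s),
    [/\ forall i, is_proj (e i),
        forall i j, i != j -> e i ∘ e j = 0,
        \sum_i e i = one2 s,
        x = \sum_i l i *: e i &
        y = \sum_i f (l i) *: e i]].

Definition spectral_proj (s : bool) (x : P s) (l : C) : P s :=
  fun_calc (fun z => (z == l)%:R) x.

Definition abs2 (s : bool) (x : P s) : P s :=
  fun_calc (fun z => (Num.sqrt (complex.Re z))%:C) (star x ∘ x).

Definition abs_pow (s : bool) (x : P s) (t : R) : P s :=
  fun_calc (fun z => (complex.Re z `^ t)%:C) (abs2 x).

(* The norm of the left multiplication by x on the Hilbert space P s with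
   inner product (y, z) |-> tr2 (z^* y). *)
Definition op_norm (s : bool) (x : P s) : R :=
  sup [set Num.sqrt (complex.Re (tr2 (star (x ∘ y) ∘ (x ∘ y))))
      | y in [set y : P s | complex.Re (tr2 (star y ∘ y)) <= 1]].

(* Only used for 1 <= t <= +oo. *)
Definition lnorm (s : bool) (t : \bar R) (x : P s) : R :=
  match t with
  | t'%:E => complex.Re (tr2 (abs_pow x t')) `^ t'^-1
  | +oo%E => op_norm x
  | -oo%E => 0
  end.

Definition range_proj (s : bool) (x : P s) : P s :=
  xget 0 [set r : P s | [/\ is_proj r, r ∘ x = x &
    forall e : P s, is_proj e -> e ∘ x = x -> le2 r e]].

Definition supp_size (s : bool) (x : P s) : C := tr2 (range_proj x).

(** Biprojections *)

Definition is_biproj (s : bool) (B : P s) : Prop :=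
  is_proj B /\
  exists (a : C) (Q : P (~~ s)), is_proj Q /\ fourier B = a *: Q.

Definition gen_biproj (s : bool) (x : P s) : P s :=
  xget 0 [set B : P s | [/\ is_biproj B, B ∘ x ∘ B = x &
    forall B' : P s, is_biproj B' -> B' ∘ x ∘ B' = x -> le2 B B']].

Definition is_right_shift (s : bool) (B p : P s) : Prop :=
  [/\ is_proj p, tr2 p = tr2 B & coprod B p = (tr2 B / delta) *: p].

Definition is_right_subshift (s : bool) (B q : P s) : Prop :=
  is_proj q /\ exists Bg : P s, is_right_shift B Bg /\ le2 q Bg.

End TwoBoxes.

Arguments delta {R} A.
Arguments fun_calc {R A s} f x.
Notation "x ⋆ y" := (coprod x y) (at level 40, left associativity).

(* Main.v *)
Require Import Defs.
From HB Require Import structures.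
From mathcomp Require Import all_boot all_order all_algebra.
From mathcomp Require Import complex zify ring.
From mathcomp Require Import all_classical all_reals all_analysis.

Set Implicit Arguments.
Unset Strict Implicit.
Unset Printing Implicit Defensive.

Import Order.TTheory GRing.Theory Num.Theory.

(** The proof has a diagrammatic half and an operator half.

    A concrete tangle has finitely many strings and regions, so planarity,
    gluing and isotopy can be tested by computation.  Tangles are written as
    tables of natural numbers ([tcode]); [planarP] and [glueP] turn boolean
    tests on tables into [planar] and [is_gluing], and [rep_node] computes the
    table of a composite tangle.  Strings and regions are numbered in the order
    in which they are met along the inputs, in order that isotopic composites get
    the same table: two diagrammatic expressions agree as soon as their tables do
    ([rep_eq]), and two closed ones as soon as the tables agree up to the region
    at infinity ([rep_scalar]).  This yields the usual rules for the product,
    the coproduct, the star and the rotation, in particular the reciprocity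
    tr((x ⋆ y) z) = tr(x (z ⋆ y')) = tr(y (x' ⋆ z)), where the prime stands for
    the contragredient.  Irreducibility is used once, in [delta_and_unit]: a
    2-box capped on its left is a multiple of a string, hence 1 ⋆ y is the
    scalar tr(y)/δ.  Positivity of the form on n-boxes is used for n = 1
    (δ > 0), n = 2 (the trace is faithful, so that spectral theory is available),
    n = 3 (coproducts of positive elements are positive, [pos_coprod]) and n = 4
    (the upper bound on the support, [supp_size_le]).

    For a positive y ≠ 0 let Φ_y(x) = (δ / tr y) (x ⋆ y), which is [nconv y x].
    It is positive, unital and trace preserving, and its adjoint for the trace is
    Φ_y'.  Hence z = Φ_q(p) satisfies 0 <= z <= 1 and tr z = tr p, and z <= R(z)
    gives tr p <= S(p ⋆ q), with equality iff z = R(z), iff z is a projection.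
    The other conditions are ways to say that z is a projection:

    - tr(z^t) <= tr(z) for t > 1, with equality iff z is a projection; this
      handles the norms ([proj_of_powR]);
    - if Φ_w(z) is a projection f, then a = Φ_w'(f) satisfies
      tr a = tr z = tr(a z), which forces a = z = z^2 ([pos_rigid]); this handles
      the iterated coproducts;
    - if z is a projection, then Φ_q' Φ_q fixes p by the same kind of rigidity
      ([proj_rigid]), i.e. p ⋆ y is a multiple of p for y = q ⋆ q'.

    Call y absorbed by p when p ⋆ y = (tr y / δ) p.  As
    tr(p (p ⋆ y)) = tr(y (p' ⋆ p)) and p' ⋆ p <= tr(p)/δ, a positive y is
    absorbed iff it lives under the spectral projection B_2 of p' ⋆ p at
    tr(p)/δ ([stabP]).  So B_2 is stable under coproducts and contragredients.
    This stability characterizes biprojections ([biprojP]); in particular they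
    are closed under meets, which provides generated biprojections
    ([gen_biprojP]), and B_1 <= B_2 means that q ⋆ q' is absorbed by p.  When it
    is, B_2 and its right shift Φ_q(B_2) witness the condition on right
    subshifts; conversely a right shift g of B satisfies g ⋆ g' <= const B, so
    that q ⋆ q' lives under B, which is absorbed by p = R(x ⋆ B). *)

Local Open Scope nat_scope.

(** * Finite types enumerated by lists of keys *)

Section Listed.

(** Computations take place on lists of keys (numbers, or pairs of numbers);
    this is the dictionary with the finite types of the definitions. *)
Definition listed (X : finType) (K : eqType) (key : X -> K) (l : seq K) :=
  injective key /\ perm_eq [seq key x | x <- enum X] l.

Variables (X : finType) (K : eqType) (key : X -> K) (l : seq K).
Hypothesis hl : listed key l.

Lemma listed_inj : injective key. Proof. by case: hl. Qed.

Lemma listed_mem x : key x \in l.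
Proof. by case: hl => _ /perm_mem <-; apply: map_f; rewrite mem_enum. Qed.

Lemma listed_ex k : k \in l -> exists x, key x = k.
Proof. by case: hl => _ /perm_mem <- /mapP[x _ ->]; exists x. Qed.

Lemma listed_card : #|X| = size l.
Proof. by case: hl => _ /perm_size <-; rewrite size_map cardE. Qed.

Lemma listed_uniq : uniq l.
Proof.
by case: hl => hi /perm_uniq <-; rewrite map_inj_uniq ?enum_uniq.
Qed.

Lemma listed_sum (F : K -> nat) : \sum_x F (key x) = sumn [seq F k | k <- l].
Proof.
case: hl => _ hp; rewrite -big_enum /= sumnE big_map -(perm_big _ hp) /=.
by rewrite big_map.
Qed.

Lemma listed_count (Q : pred K) : #|[pred x | Q (key x)]| = count Q l.
Proof.
case: hl => _ /permP <-; rewrite count_map cardE size_filter.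
by rewrite -enumT; apply: eq_count.
Qed.

Lemma listed_all (Q : pred K) : all Q l -> forall x, Q (key x).
Proof. by move=> /allP h x; apply/h/listed_mem. Qed.

End Listed.

Lemma listedP (X : finType) (K : eqType) (key : X -> K) (l : seq K) :
  injective key -> uniq l -> (forall x, key x \in l) ->
  (forall k, k \in l -> exists x, key x = k) -> listed key l.
Proof.
move=> hi hu h1 h2; split=> //; apply: uniq_perm => //.
  by rewrite map_inj_uniq ?enum_uniq.
move=> k; apply/mapP/idP => [[x _ ->] //|/h2[x <-]]; exists x => //.
by rewrite mem_enum.
Qed.

Lemma listed_ord n : listed (@nat_of_ord n) (iota 0 n).
Proof.
split; first exact: val_inj.
by rewrite (_ : map _ _ = iota 0 n) //; exact: val_enum_ord.
Qed.

Lemma listed_sig (I : finType) (X : I -> finType) (K1 K2 : eqType)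
    (k1 : I -> K1) (k2 : forall i, X i -> K2) (l1 : seq K1) (l2 : K1 -> seq K2) :
  listed k1 l1 -> (forall i, listed (@k2 i) (l2 (k1 i))) ->
  listed (fun x : {i : I & X i} => (k1 (tag x), k2 _ (tagged x)))
         [seq (a, b) | a <- l1, b <- l2 a].
Proof.
move=> h1 h2; apply: listedP.
- case=> i x [j y] /= [/(listed_inj h1) eij]; case: j / eij y => y.
  by move/(listed_inj (h2 i)) => ->.
- apply: allpairs_uniq_dep; first exact: listed_uniq h1.
    by move=> a /(listed_ex h1)[i <-]; exact: listed_uniq (h2 i).
  by move=> [a b] [a' b'] _ _ /= [-> ->].
- case=> i x; apply/allpairsPdep; exists (k1 i), (k2 i x); split=> //.
    exact: listed_mem h1 _.
  exact: listed_mem (h2 i) _.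
- move=> _ /allpairsPdep[a [b [/(listed_ex h1)[i <-] hb ->]]].
  by have [x <-] := listed_ex (h2 i) hb; exists (existT _ i x).
Qed.

Lemma listed_sum_type (X Y : finType) (K : eqType) (a : X -> K) (b : Y -> K)
    (la lb : seq K) :
  listed a la -> listed b lb -> (forall x y, a x != b y) ->
  listed (fun z : X + Y => match z with inl x => a x | inr y => b y end)
    (la ++ lb).
Proof.
move=> ha hb hab; apply: listedP.
- case=> [x|y] [x'|y'] h.
  + by congr inl; apply: (listed_inj ha).
  + by move: (hab x y'); rewrite h eqxx.
  + by move: (hab x' y); rewrite h eqxx.
  + by congr inr; apply: (listed_inj hb).
- rewrite cat_uniq (listed_uniq ha) (listed_uniq hb) andbT /=.
  apply/hasPn => k /(listed_ex hb)[y <-]; apply/negP => /(listed_ex ha)[x].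
  by apply/eqP; exact: hab.
- case=> [x|y]; rewrite mem_cat.
  + by rewrite (listed_mem ha).
  + by rewrite (listed_mem hb) orbT.
- move=> k; rewrite mem_cat => /orP[/(listed_ex ha)[x <-]|/(listed_ex hb)[y <-]].
    by exists (inl x).
  by exists (inr y).
Qed.

Lemma listed_prod (X Y : finType) (K1 K2 : eqType) (a : X -> K1) (b : Y -> K2)
    (la : seq K1) (lb : seq K2) :
  listed a la -> listed b lb ->
  listed (fun z : X * Y => (a z.1, b z.2)) [seq (u, v) | u <- la, v <- lb].
Proof.
move=> ha hb; apply: listedP.
- by move=> [x y] [x' y'] /= [/(listed_inj ha)-> /(listed_inj hb)->].
- apply: allpairs_uniq; [exact: listed_uniq ha|exact: listed_uniq hb|].
  by move=> [u v] [u' v'] _ _ /= [-> ->].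
- by move=> [x y]; apply: allpairs_f; [apply: listed_mem ha _|apply: listed_mem hb _].
- move=> _ /allpairsP[[u v] /= [/(listed_ex ha)[x <-] /(listed_ex hb)[y <-] ->]].
  by exists (x, y).
Qed.

Lemma listed_bool : listed (fun b : bool => b) [:: true; false].
Proof. by apply: listedP => // [[]|k _]; [| |exists k]. Qed.

Lemma listed_option (X : finType) (e : X -> nat) n : listed e (iota 0 n) ->
  listed (fun d : option X => if d is Some x then (e x).+1 else 0) (iota 0 n.+1).
Proof.
move=> he; apply: listedP.
- by move=> [x|] [y|] //= [/(listed_inj he)->].
- exact: iota_uniq.
- case=> [x|] //; rewrite mem_iota /=; have := listed_mem he x.
  by rewrite mem_iota.
- case=> [|i]; first by exists None.
  rewrite mem_iota /= add0n ltnS => hi.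
  have [|x hx] := listed_ex he (k := i); first by rewrite mem_iota.
  by exists (Some x); rewrite hx.
Qed.

(** * Connected components by merging labels *)

Section Components.
Variable K : eqType.

(** Labellings of the nodes are association lists.  Each node starts with its
    own label, and each edge replaces the label of one of its ends by that of the
    other throughout the list. *)
Fixpoint lookup (L : seq (K * nat)) (x : K) : nat :=
  if L is (y, l) :: L' then if x == y then l else lookup L' x else 0.

Definition merge (L : seq (K * nat)) (e : K * K) :=
  let a := lookup L e.1 in let b := lookup L e.2 in
  if a == b then L else [seq (z.1, if z.2 == b then a else z.2) | z <- L].

Definition comps (nodes : seq K) (edges : seq (K * K)) : seq (K * nat) :=
  foldl merge (zip nodes (iota 0 (size nodes))) edges.

Lemma lookup_map (f : nat -> nat) L x : x \in unzip1 L ->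
  lookup [seq (z.1, f z.2) | z <- L] x = f (lookup L x).
Proof.
elim: L => //= -[y l] L IH /=; rewrite inE; case: eqP => //= _; exact: IH.
Qed.

Lemma lookup_merge L e x : x \in unzip1 L -> lookup (merge L e) x =
  if lookup L x == lookup L e.2 then lookup L e.1 else lookup L x.
Proof.
move=> hx; rewrite /merge; case: eqP => [->|_]; first by case: eqP => // ->.
by rewrite (lookup_map (fun l => if l == lookup L e.2 then lookup L e.1 else l)).
Qed.

Lemma unzip1_merge L e : unzip1 (merge L e) = unzip1 L.
Proof. by rewrite /merge; case: ifP => // _; rewrite /unzip1 -map_comp. Qed.

Lemma unzip1_comps nodes edges : unzip1 (comps nodes edges) = nodes.
Proof.
elim/last_ind: edges => [|s e IH].
  by rewrite /comps /= unzip1_zip // size_iota.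
by rewrite /comps foldl_rcons unzip1_merge.
Qed.

Lemma lookup_zip nodes m x y : x \in nodes -> y \in nodes ->
  lookup (zip nodes (iota m (size nodes))) x =
  lookup (zip nodes (iota m (size nodes))) y -> x = y.
Proof.
have lb l : forall n z, z \in l -> n <= lookup (zip l (iota n (size l))) z.
  elim: l => //= u l IH n z; rewrite inE; case: eqP => //= _ hz.
  exact: ltnW (IH n.+1 z hz).
elim: nodes m => //= u l IH m; rewrite !inE.
case: (eqVneq x u) => [->|_] /=; case: (eqVneq y u) => [->|_] //=.
- by move=> _ /(lb _ m.+1) h e; rewrite -e ltnn in h.
- by move=> /(lb _ m.+1) h _ e; rewrite e ltnn in h.
- exact: IH.
Qed.

Variables (X : finType) (key : X -> K) (nodes : seq K) (edges : seq (K * K)).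
Variable e : rel X.
Hypothesis hl : listed key nodes.
Hypothesis e_sym : connect_sym e.
Hypothesis e_edges : forall x y, e x y ->
  ((key x, key y) \in edges) || ((key y, key x) \in edges).
Hypothesis edges_e : forall u v, (u, v) \in edges ->
  exists x y, [/\ u = key x, v = key y & connect e x y].

Lemma comps_sound (s : seq (K * K)) : {subset s <= edges} ->
  forall x y, lookup (comps nodes s) (key x) = lookup (comps nodes s) (key y) ->
  connect e x y.
Proof.
elim/last_ind: s => [|s [u v] IH] hs x y.
  rewrite /comps /= => /lookup_zip h.
  by rewrite (listed_inj hl (h (listed_mem hl x) (listed_mem hl y))).
have {}IH : forall x y, lookup (comps nodes s) (key x) =
    lookup (comps nodes s) (key y) -> connect e x y.
  by apply: IH => z hz; apply: hs; rewrite mem_rcons inE hz orbT.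
have mem z : key z \in unzip1 (comps nodes s).
  by rewrite unzip1_comps (listed_mem hl).
have [|a [b [-> -> cab]]] := edges_e (u := u) (v := v).
  by apply: hs; rewrite mem_rcons mem_head.
rewrite /comps foldl_rcons -/(comps nodes s) !lookup_merge //=.
case: eqP => hx; case: eqP => hy h.
- by apply: IH; rewrite hx.
- rewrite e_sym; apply: connect_trans (IH _ _ (esym h)) (connect_trans cab _).
  exact: IH (esym hx).
- apply: connect_trans (IH _ _ h) (connect_trans cab _).
  exact: IH (esym hy).
- exact: IH.
Qed.

Lemma comps_edge (s : seq (K * K)) a b :
  a \in nodes -> b \in nodes -> (a, b) \in s ->
  lookup (comps nodes s) a = lookup (comps nodes s) b.
Proof.
move=> ha hb; elim/last_ind: s => [//|s [u v] IH].
rewrite mem_rcons inE /comps foldl_rcons -/(comps nodes s).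
rewrite !lookup_merge ?unzip1_comps //= => /orP[/eqP[-> ->]|/IH ->//].
by rewrite eqxx; case: eqP.
Qed.

(** Both implications are kept by a merge: nodes with equal labels are connected,
    since the labels of two connected nodes are identified; and an edge that has
    been processed keeps equal labels at its ends, since labels change
    uniformly. *)
Lemma compsP x y :
  (lookup (comps nodes edges) (key x) == lookup (comps nodes edges) (key y))
  = connect e x y.
Proof.
apply/eqP/idP; first exact: comps_sound.
case/connectP => p; elim: p x => [x _ ->//|z p IH x] /= /andP[xz pz] yl.
rewrite -(IH z pz yl); have m u := listed_mem hl u.
by case/orP: (e_edges xz) => /comps_edge -> //.
Qed.

End Components.

(** The roots of the components are a system of representatives for the
    labels. *)
Lemma n_comp_labels (X : finType) (e : rel X) (f : X -> nat) :
  connect_sym e -> (forall x y, (f x == f y) = connect e x y) ->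
  n_comp e predT = size (undup [seq f x | x <- enum X]).
Proof.
move=> he hf; rewrite /n_comp_mem unlock.
set r := enum _; rewrite -(size_map f r); apply/perm_size/uniq_perm.
- rewrite map_inj_in_uniq ?enum_uniq // => x y; rewrite !mem_enum /=.
  rewrite !inE !andbT => /eqP hx /eqP hy /eqP; rewrite hf => hxy.
  by move/(fingraph.rootP he): hxy; rewrite hx hy.
- exact: undup_uniq.
move=> n; rewrite mem_undup; apply/mapP/mapP => -[x hx ->].
  by exists x; rewrite ?mem_enum.
exists (fingraph.root e x); last by apply/eqP; rewrite hf connect_root.
by rewrite mem_enum !inE andbT; apply: roots_root.
Qed.

(** * Tables of tangles *)

(** Strings and regions are numbered; [ksd] lists the regions on the shaded and
    on the unshaded side of the strings.  In [kpt] and [kiv] the disc 0 is the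
    output disc, so the input disc d has index d + 1. *)
Record tcode := TCode {
  kcol : color;
  kin : seq color;
  kstr : nat;
  kreg : nat;
  ksh : seq bool;
  ksd : seq (nat * nat);
  kpt : seq (seq nat);
  kiv : seq (seq nat) }.

Definition lnth (l : seq (seq nat)) (d j : nat) := nth 0 (nth [::] l d) j.
Definition kdisc k d := nth (0, false) (kcol k :: kin k) d.
Definition npt k d := (kdisc k d).1.*2.
Definition ndisc k := (size (kin k)).+1.
Definition kside k (b : bool) e :=
  let p := nth (0, 0) (ksd k) e in if b then p.1 else p.2.
Definition kivsh k d i := (kdisc k d).2 (+) odd i.

Definition eO (D : Type) (eD : D -> nat) (d : option D) :=
  if d is Some x then (eD x).+1 else 0.

(** [eD] is kept outside of the record: the order of the inputs is the only part
    of the numbering that matters for evaluation. *)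
Record encoding (D : finType) (col : D -> color) (c : color)
    (T : tangle col c) (k : tcode) (eD : D -> nat) := Encoding {
  en_s : str T -> nat;
  en_r : reg T -> nat;
  en_col : kcol k = c;
  en_D : listed eD (iota 0 (size (kin k)));
  en_in : forall d, nth (0, false) (kin k) (eD d) = col d;
  en_S : listed en_s (iota 0 (kstr k));
  en_R : listed en_r (iota 0 (kreg k));
  en_sh : forall r, shade T r = nth false (ksh k) (en_r r);
  en_sd : forall b e, en_r (side T b e) = kside k b (en_s e);
  en_pt : forall d j, en_s (pt T d j) = lnth (kpt k) (eO eD d) j;
  en_iv : forall d i, en_r (iv T d i) = lnth (kiv k) (eO eD d) i }.

(** * Deciding planarity *)

Definition incidence_check k :=
  all (fun e => nth false (ksh k) (kside k true e) &&
                ~~ nth false (ksh k) (kside k false e)) (iota 0 (kstr k)) &&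
  all (fun d => [&&
    all (fun i => nth false (ksh k) (lnth (kiv k) d i) == kivsh k d i)
        (iota 0 (npt k d).+1),
    lnth (kiv k) d 0 == lnth (kiv k) d (npt k d) &
    all (fun j => (kside k (kivsh k d j) (lnth (kpt k) d j)
                     == lnth (kiv k) d j) &&
                  (kside k (~~ kivsh k d j) (lnth (kpt k) d j)
                     == lnth (kiv k) d j.+1)) (iota 0 (npt k d))])
    (iota 0 (ndisc k)).

Definition kends k := [seq (d, j) | d <- iota 0 (ndisc k), j <- iota 0 (npt k d)].

Definition kout k (x : nat * nat) := (x.1 == 0) (+) kivsh k x.1 x.2.

Definition string_check k :=
  all (fun e =>
    let n b := count (fun x => (lnth (kpt k) x.1 x.2 == e) && (kout k x == b))
                     (kends k) in
    (n true == n false) && (n true <= 1)) (iota 0 (kstr k)).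

Definition connected_check k :=
  let L := comps (iota 0 (kreg k))
             [seq (kside k true e, kside k false e) | e <- iota 0 (kstr k)] in
  all (fun r => lookup L r == lookup L 0) (iota 0 (kreg k)).

(** A boundary piece becomes a pair of numbers: sides of strings have first
    component 0 or 1, intervals of the disc d have first component d + 2. *)
Definition bd_pieces k : seq (nat * nat) :=
  [seq (x.1.+2, x.2) | x <- [seq (d, i) | d <- iota 0 (ndisc k),
                                          i <- iota 0 (npt k d).+1]] ++
  [seq (nat_of_bool x.2, x.1) | x <- [seq (e, b) | e <- iota 0 (kstr k),
                                          b <- [:: true; false]]].

(** The point j of a disc separates the intervals j and j + 1, which touch the
    string ending there on its two sides.  Listing the contacts in this way makes
    the test linear in the number of points. *)
Definition bd_edges k : seq ((nat * nat) * (nat * nat)) :=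
  flatten [seq ((d.+2, 0), (d.+2, npt k d)) ::
    flatten [seq [:: ((d.+2, j), (nat_of_bool (kivsh k d j), lnth (kpt k) d j));
            ((d.+2, j.+1), (nat_of_bool (kivsh k d j.+1), lnth (kpt k) d j))]
      | j <- iota 0 (npt k d)] | d <- iota 0 (ndisc k)].

Definition euler_check k :=
  let L := comps (bd_pieces k) (bd_edges k) in
  (size (kin k)).+1 + (kreg k).*2 ==
  2 + ((kcol k).1 + sumn [seq x.1 | x <- kin k]) +
  size (undup [seq lookup L x | x <- bd_pieces k]).

Definition planar_check k :=
  [&& incidence_check k, string_check k, connected_check k & euler_check k].

Lemma listed_map (X : finType) (K K' : eqType) (g : K -> K') (key : X -> K) l :
  injective g -> listed key l -> listed (fun x => g (key x)) (map g l).
Proof.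
move=> hg hl; apply: listedP.
- by move=> x y /hg /(listed_inj hl).
- by rewrite map_inj_uniq // (listed_uniq hl).
- by move=> x; rewrite map_f // (listed_mem hl).
- by move=> _ /mapP[y /(listed_ex hl)[x <-] ->]; exists x.
Qed.

Section Encoded.
Variables (D : finType) (col : D -> color) (c : color) (T : tangle col c).
Variables (k : tcode) (eD : D -> nat) (en : encoding T k eD).
Local Notation dcol := (disc_color col c).

Lemma en_disc d : kdisc k (eO eD d) = dcol d.
Proof. by case: d => [d|] /=; [rewrite -(en_in en) | rewrite -(en_col en)]. Qed.

Lemma en_npt d : npt k (eO eD d) = (dcol d).1.*2.
Proof. by rewrite /npt en_disc. Qed.

Lemma en_ivsh d i : kivsh k (eO eD d) i = iv_shade col c d i.
Proof. by rewrite /kivsh en_disc. Qed.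

Lemma en_discs : listed (eO eD) (iota 0 (ndisc k)).
Proof. exact: listed_option (en_D en). Qed.

Lemma en_pts d : listed (@nat_of_ord (dcol d).1.*2) (iota 0 (npt k (eO eD d))).
Proof. by rewrite en_npt; exact: listed_ord. Qed.

Lemma en_ivs d :
  listed (@nat_of_ord (dcol d).1.*2.+1) (iota 0 (npt k (eO eD d)).+1).
Proof. by rewrite en_npt; exact: listed_ord. Qed.

Lemma en_disc_lt d : eO eD d \in iota 0 (ndisc k).
Proof. exact: (listed_mem en_discs). Qed.

Lemma incidenceP : incidence_check k -> compatible_incidence T.
Proof.
case/andP=> /allP hs /allP hd; split.
- move=> b e; rewrite (en_sh en) (en_sd en).
  have /andP[h1 h2] := hs _ (listed_mem (en_S en) e).
  by case: b; [rewrite h1 | rewrite (negbTE h2)].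
- move=> d i; rewrite (en_sh en) (en_iv en) -en_ivsh.
  have /and3P[/allP h _ _] := hd _ (en_disc_lt d).
  by apply/eqP/h; exact: (listed_mem (en_ivs d)).
- move=> d; apply: (listed_inj (en_R en)); rewrite !(en_iv en) /=.
  by have /and3P[_ /eqP h _] := hd _ (en_disc_lt d); rewrite -en_npt.
- move=> d j; have /and3P[_ _ /allP h] := hd _ (en_disc_lt d).
  have /andP[/eqP h1 /eqP h2] := h _ (listed_mem (en_pts d) j).
  split; apply: (listed_inj (en_R en)).
    by rewrite (en_sd en) (en_pt en) (en_iv en) -en_ivsh h1.
  by rewrite (en_sd en) (en_pt en) (en_iv en) -en_ivsh h2.
Qed.

Lemma en_n_ends e b : n_ends e b =
  count (fun x => (lnth (kpt k) x.1 x.2 == en_s en e) && (kout k x == b))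
        (kends k).
Proof.
have hl := listed_sig (l2 := fun d => iota 0 (npt k d)) en_discs en_pts.
rewrite /kends -(listed_count hl); apply: eq_card => -[d j] /=.
rewrite !inE /= -(en_pt en) (inj_eq (listed_inj (en_S en))).
by rewrite /outgoing /kout /= en_ivsh; case: d j.
Qed.

Lemma stringP : string_check k -> strings_ok T.
Proof.
move=> /allP h e; have /andP[h1 h2] := h _ (listed_mem (en_S en) e).
by rewrite !en_n_ends; split=> //; apply/eqP.
Qed.

Lemma connectedP : connected_check k ->
  forall r r', connect (@adjacent_regions _ _ _ T) r r'.
Proof.
have sym : symmetric (@adjacent_regions _ _ _ T).
  move=> r r'; apply/existsP/existsP => -[e /existsP[b /andP[h1 h2]]];
  by exists e; apply/existsP; exists (~~ b); rewrite negbK h1 h2.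
move=> /(listed_all (en_R en)) h r r'.
rewrite -(compsP (edges := [seq (kside k true e, kside k false e)
           | e <- iota 0 (kstr k)]) (en_R en) (sym_connect_sym sym)).
- by rewrite (eqP (h r)) (eqP (h r')).
- move=> x y /existsP[e /existsP[b /andP[/eqP <- /eqP <-]]].
  rewrite !(en_sd en).
  by case: b; rewrite ?[_ && _]orbC (map_f _ (listed_mem (en_S en) e)) ?orbT.
- move=> u v /mapP[n /(listed_ex (en_S en))[e <-] [-> ->]].
  exists (side T true e), (side T false e); rewrite !(en_sd en); split=> //.
  apply/connect1/existsP; exists e; apply/existsP; exists true.
  by rewrite !eqxx.
Qed.

Definition piece_key (x : bd_piece T) : nat * nat :=
  match x with
  | inl u => ((eO eD (tag u)).+2, nat_of_ord (tagged u))
  | inr v => (nat_of_bool v.2, en_s en v.1)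
  end.

Lemma piece_listed : listed piece_key (bd_pieces k).
Proof.
have h1 := listed_sig (l2 := fun d => iota 0 (npt k d).+1) en_discs en_ivs.
have h2 := listed_prod (en_S en) listed_bool.
have g1 : injective (fun x : nat * nat => (x.1.+2, x.2)).
  by move=> [a b] [a' b'] /= [-> ->].
have g2 : injective (fun x : nat * bool => (nat_of_bool x.2, x.1)).
  by move=> [a [] ] [a' []] //= [->].
have := listed_sum_type (listed_map g1 h1) (listed_map g2 h2).
case.
  by case=> d i; case=> e []; apply/eqP.
move=> hi hp; split; last by [].
by move=> x y h; apply: hi; move: x y h => [x|x] [y|y].
Qed.

Lemma piece_edge (d : option D) (j : 'I_(dcol d).1.*2) (i : 'I_(dcol d).1.*2.+1) :
  (i == before j) || (i == after j) ->
  (((eO eD d).+2, nat_of_ord i),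
   (nat_of_bool (iv_shade col c d i), en_s en (pt T d j))) \in bd_edges k.
Proof.
move=> hi; apply/flatten_mapP; exists (eO eD d); first exact: en_disc_lt.
rewrite inE; apply/orP; right; apply/flatten_mapP.
exists (j : nat); first exact: (listed_mem (en_pts d)).
rewrite !inE (en_pt en) !en_ivsh.
case/orP: hi => /eqP ->; rewrite /before /after ?lift0 /= ?eqxx //.
by rewrite orbT.
Qed.

Lemma touches_edge x y : @touches _ _ _ T x y ->
  (piece_key x, piece_key y) \in bd_edges k.
Proof.
case: x => [[d i]|//]; case: y => [[d' i']|[e b]] /=.
  case/and3P=> /eqP /= dd'; case: d' / dd' i' => i' /eqP i0 /eqP i2.
  rewrite /piece_key /= i0 i2 -en_npt.
  by apply/flatten_mapP; exists (eO eD d); [exact: en_disc_lt | exact: mem_head].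
by case/existsP=> j /and3P[/eqP <- /eqP -> hi]; exact: piece_edge.
Qed.

Lemma edge_touches u v : (u, v) \in bd_edges k ->
  exists x y, [/\ u = piece_key x, v = piece_key y & touches x y].
Proof.
case/flatten_mapP=> _ /(listed_ex en_discs)[d <-].
rewrite inE => /orP[/eqP[-> ->]|].
  exists (inl (existT _ d ord0)), (inl (existT _ d ord_max)).
  by rewrite /piece_key /= en_npt; split; rewrite ?eqxx.
case/flatten_mapP=> _ /(listed_ex (en_pts d))[j <-].
rewrite !inE => /orP[]/eqP[-> ->].
  exists (inl (existT _ d (before j))), (inr (pt T d j, iv_shade col c d j)).
  rewrite /piece_key /= en_ivsh (en_pt en); split=> //.
  by apply/existsP; exists j; rewrite !eqxx.
exists (inl (existT _ d (after j))), (inr (pt T d j, iv_shade col c d j.+1)).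
rewrite /piece_key /= en_ivsh (en_pt en) /bump leq0n; split=> //.
by apply/existsP; exists j; rewrite !eqxx orbT.
Qed.

Lemma eulerP : euler_check k -> @euler_sphere _ _ _ T.
Proof.
move=> h; rewrite /euler_sphere.
have hb : n_region_bd T =
    size (undup [seq lookup (comps (bd_pieces k) (bd_edges k)) x
                | x <- bd_pieces k]).
  set L := comps _ _.
  pose e (u v : bd_piece T) := touches u v || touches v u.
  have es : connect_sym e.
    by apply: sym_connect_sym => u v; rewrite /e orbC.
  rewrite /n_region_bd (n_comp_labels (f := lookup L \o piece_key) es).
    apply/perm_size/perm_undup => n; case: piece_listed => _ hp.
    by rewrite -(perm_mem (perm_map (lookup L) hp)) -map_comp.
  move=> x y; apply: (compsP piece_listed es) => {x y}.
    by move=> x y /orP[]/touches_edge ->; rewrite ?orbT.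
  move=> u v /edge_touches[x [y [-> -> t]]]; exists x, y; split=> //.
  by apply: connect1; rewrite /e t.
rewrite hb (listed_card (en_D en)) (listed_card (en_R en)) !size_iota.
rewrite /n_arcs.
have -> : (\sum_d (col d).1 = sumn [seq x.1 | x <- kin k])%N.
  under eq_bigr => d _ do rewrite -(en_in en).
  rewrite (listed_sum (en_D en) (fun i => (nth (0, false) (kin k) i).1)).
  by rewrite (map_comp fst) map_nth_iota0 // take_size.
move: h; rewrite /euler_check (en_col en) => /eqP.
move: (size (undup _)) (sumn _) => a b h.
lia.
Qed.

Lemma planarP : planar_check k -> planar T.
Proof.
case/and4P=> h1 h2 h3 h4; split.
- exact: incidenceP.
- exact: stringP.
- exact: connectedP.
- exact: eulerP.
Qed.

End Encoded.

(** * Deciding gluing *)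

Definition node_type (D : finType) (A : finType) (B : D -> finType)
  (o : option D) : finType := if o is Some d then B d else A.

Section Pushout.
Variables (D : finType) (X : D -> finType) (A : finType) (B : D -> finType).
Variables (C : finType) (a : forall d, X d -> A) (b : forall d, X d -> B d).

Definition node := {o : option D & node_type A B o}.
Definition nodeA (x : A) : node := existT (node_type A B) None x.
Definition nodeB d (x : B d) : node := existT (node_type A B) (Some d) x.

Definition glued : rel node := fun u v =>
  [exists d, [exists z : X d, (u == nodeA (a z)) && (v == nodeB (b z))]].

(** The universal property of a set-theoretic pushout amounts to the connectedness
    of the fibres: a compatible family of maps is constant along gluings, hence
    on fibres, and therefore factors. *)
Lemma glued_pushout (phi : node -> C) :
  (forall y, exists x, phi x = y) ->
  (forall u v, glued u v -> phi u = phi v) ->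
  (forall u v, phi u = phi v -> connect (fun x y => glued x y || glued y x) u v) ->
  is_pushout a b (fun x => phi (nodeA x)) (fun d x => phi (@nodeB d x)).
Proof.
move=> surj comm conn; split.
  move=> d x; apply: comm; apply/existsP; exists d; apply/existsP; exists x.
  by rewrite !eqxx.
move=> Y h' k' hk.
(* all the maps to be factored, as a single map on the disjoint union *)
pose psi (u : node) : Y := match u with
  existT o x => match o as o return node_type A B o -> Y with
                | Some d => k' d | None => h' end x end.
have psi_glued u v : glued u v -> psi u = psi v.
  case/existsP=> d /existsP[z /andP[/eqP -> /eqP ->]]; exact: hk.
have psi_conn u v : connect (fun x y => glued x y || glued y x) u v ->
    psi u = psi v.
  case/connectP=> p; elim: p u => [u _ ->//|w p IH u] /= /andP[uw pw] vl.
  rewrite -(IH w pw vl).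
  by case/orP: uw => /psi_glued.
have [r hr] := choice surj.
have psi_r u : psi u = psi (r (phi u)) by apply/psi_conn/conn; rewrite hr.
exists (psi \o r); split.
  by split=> [y|d y] /=; rewrite -psi_r.
move=> g [gA gB]; apply: funext => y /=; rewrite -[in RHS](hr y).
by case: (r y) => -[d|] x /=; [rewrite -gB | rewrite -gA].
Qed.

End Pushout.

Definition knodes (num : tcode -> nat) (kT : tcode) (ks : seq tcode) :=
  [seq (o, i) | o <- iota 0 (ndisc kT),
                i <- iota 0 (num (nth kT (kT :: ks) o))].

Definition kglued (npts : tcode -> nat -> nat) (inc : tcode -> seq (seq nat))
    (kT : tcode) (ks : seq tcode) :=
  flatten [seq [seq ((0, lnth (inc kT) d.+1 j),
                     (d.+1, lnth (inc (nth kT ks d)) 0 j))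
               | j <- iota 0 (npts kT d.+1)] | d <- iota 0 (size (kin kT))].

(** The list [reps] assigns a component of the gluing graph to each class;
    comparing every node with the component of its image tests in one pass that
    the fibres of [phi] are connected. *)
Definition pushout_check (nodes : seq (nat * nat))
    (edges : seq ((nat * nat) * (nat * nat)))
    (phi : seq ((nat * nat) * nat)) (m : nat) :=
  let L := comps nodes edges in
  let reps := [seq nth 0 [seq lookup L x | x <- unzip1 phi]
                     (index i (unzip2 phi)) | i <- iota 0 m] in
  [&& unzip1 phi == nodes,
      all (fun z => z.2 < m) phi,
      all (fun i => i \in unzip2 phi) (iota 0 m),
      all (fun e => lookup phi e.1 == lookup phi e.2) edges &
      all (fun z => lookup L z.1 == nth 0 reps z.2) phi].

Lemma lookup_in (K : eqType) (phi : seq (K * nat)) x :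
  x \in unzip1 phi -> (x, lookup phi x) \in phi.
Proof.
elim: phi => //= -[y l] phi IH /=; rewrite inE; case: eqP => /= [-> _|_ /IH h].
  exact: mem_head.
by rewrite inE h orbT.
Qed.

Lemma mem_lookup (K : eqType) (phi : seq (K * nat)) z :
  uniq (unzip1 phi) -> z \in phi -> lookup phi z.1 = z.2.
Proof.
elim: phi => //= -[y l] phi IH /= /andP[ny u]; rewrite inE.
case/orP=> [/eqP->/=|hz]; first by rewrite eqxx.
rewrite ifN ?IH //; apply: contraNneq ny => <-; exact: map_f.
Qed.

Lemma listed_choice (Z : Type) (X : finType) (K : eqType) (key : X -> K) l
    (f : Z -> K) : listed key l -> (forall z, f z \in l) ->
  exists g : Z -> X, forall z, key (g z) = f z.
Proof.
move=> hl hf; have h z : exists x, key x = f z by apply: (listed_ex hl).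
by have [g hg] := choice h; exists g.
Qed.

Section PushoutCheck.
Variables (D : finType) (X : D -> finType) (A : finType) (B : D -> finType).
Variables (C : finType) (a : forall d, X d -> A) (b : forall d, X d -> B d).
Variables (kA : A -> nat) (kB : forall d, B d -> nat) (kC : C -> nat).
Variables (eD : D -> nat) (nodes : seq (nat * nat)).
Variables (edges : seq ((nat * nat) * (nat * nat))).
Variables (phi : seq ((nat * nat) * nat)) (m : nat).

Definition node_key (x : node A B) : nat * nat :=
  (eO eD (tag x), match tag x as o return node_type A B o -> nat with
                  | Some d => @kB d | None => kA end (tagged x)).

Hypothesis hN : listed node_key nodes.
Hypothesis hC : listed kC (iota 0 m).
Hypothesis hE : forall u v, (u, v) \in edges <->
  exists d (z : X d), u = (0, kA (a z)) /\ v = ((eD d).+1, kB (b z)).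

Lemma pushout_checkP : pushout_check nodes edges phi m ->
  exists g : node A B -> C,
  [/\ forall x, kC (g x) = lookup phi (node_key x) &
      is_pushout a b (fun x => g (nodeA B x)) (fun d x => g (@nodeB _ A B d x))].
Proof.
case/and5P=> /eqP hn /allP hm /allP hs /allP he /allP hr.
have hmem x : (node_key x, lookup phi (node_key x)) \in phi.
  by apply: lookup_in; rewrite hn (listed_mem hN).
have [|g hg] := listed_choice (f := fun x => lookup phi (node_key x)) hC.
  by move=> x; rewrite mem_iota /= add0n (hm _ (hmem x)).
exists g; split=> //; apply: (@glued_pushout _ X).
- move=> y; have := hs _ (listed_mem hC y).
  case/mapP=> -[u n] hu hy.
  have /(listed_ex hN)[x hx] : u \in nodes.
    by rewrite -hn; apply: (map_f fst hu).
  exists x; apply: (listed_inj hC); rewrite hg hx hy.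
  by rewrite (mem_lookup _ hu) // hn (listed_uniq hN).
- move=> u v /existsP[d /existsP[z /andP[/eqP-> /eqP->]]].
  apply: (listed_inj hC); rewrite !hg; apply/eqP.
  have := he (node_key (nodeA B (a z)), node_key (nodeB A (b z))).
  by apply; apply/hE; exists d, z.
- move=> u v /(congr1 kC); rewrite !hg => huv.
  rewrite -(compsP (edges := edges) hN).
  + by rewrite (eqP (hr _ (hmem u))) (eqP (hr _ (hmem v))) /= huv.
  + by apply: sym_connect_sym => x y; rewrite orbC.
  + move=> x y /orP[]/existsP[d /existsP[z /andP[/eqP-> /eqP->]]].
      by apply/orP; left; apply/hE; exists d, z.
    by apply/orP; right; apply/hE; exists d, z.
  + move=> x y /hE[d [z [-> ->]]].
    exists (nodeA B (a z)), (nodeB A (b z)); split=> //.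
    apply/connect1/orP; left; apply/existsP; exists d; apply/existsP; exists z.
    by rewrite !eqxx.
Qed.

End PushoutCheck.

(** Nothing is assumed about the way in which the composite table [kU] and the
    maps [phiS], [phiR] were found: the test verifies them a posteriori. *)
Definition glue_check (kT : tcode) (ks : seq tcode) (kU : tcode)
    (fl : seq (nat * nat)) (phiS phiR : seq ((nat * nat) * nat)) :=
  let kk o := nth kT (kT :: ks) o in
  let kd d := nth kT ks d in
  [&& perm_eq fl [seq (d, e) | d <- iota 0 (size (kin kT)),
                               e <- iota 0 (size (kin (kd d)))] &&
      (size fl == size (kin kU)),
      pushout_check (knodes kstr kT ks) (kglued npt kpt kT ks) phiS (kstr kU),
      pushout_check (knodes kreg kT ks)
                    (kglued (fun k d => (npt k d).+1) kiv kT ks) phiR (kreg kU),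
      all (fun z => nth false (ksh kU) z.2 ==
                    nth false (ksh (kk z.1.1)) z.1.2) phiR &
      all (fun z => all (fun b =>
             kside kU b z.2 == lookup phiR (z.1.1, kside (kk z.1.1) b z.1.2))
             [:: true; false]) phiS] &&
  [&& all (fun j => lnth (kpt kU) 0 j == lookup phiS (0, lnth (kpt kT) 0 j))
          (iota 0 (npt kT 0)),
      all (fun i => lnth (kiv kU) 0 i == lookup phiR (0, lnth (kiv kT) 0 i))
          (iota 0 (npt kT 0).+1) &
      all (fun u => let d := (nth (0, 0) fl u).1 in
                    let e := (nth (0, 0) fl u).2 in
        all (fun j => lnth (kpt kU) u.+1 j ==
                      lookup phiS (d.+1, lnth (kpt (kd d)) e.+1 j))
            (iota 0 (npt (kd d) e.+1)) &&
        all (fun i => lnth (kiv kU) u.+1 i ==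
                      lookup phiR (d.+1, lnth (kiv (kd d)) e.+1 i))
            (iota 0 (npt (kd d) e.+1).+1)) (iota 0 (size fl))].

Section Glue.
Variables (D : finType) (col : D -> color) (c : color) (T : tangle col c).
Variables (E : D -> finType) (cols : forall d, E d -> color).
Variables (S : forall d, tangle (@cols d) (col d)).
Variables (F : finType) (f : F -> {d : D & E d}).
Variable U : tangle (fun u => cols (tagged (f u))) c.
Variables (kT : tcode) (ks : seq tcode) (kU : tcode).
Variables (eD : D -> nat) (eE : forall d, E d -> nat) (eF : F -> nat).
Hypothesis encT : encoding T kT eD.
Hypothesis encS : forall d, encoding (S d) (nth kT ks (eD d)) (@eE d).
Hypothesis encU : encoding U kU eF.
Variables (fl : seq (nat * nat)) (phiS phiR : seq ((nat * nat) * nat)).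
Hypothesis hf : forall u,
  (eD (tag (f u)), eE (tagged (f u))) = nth (0, 0) fl (eF u).

Lemma nodes_listed (num : tcode -> nat) (A : finType) (B : D -> finType)
    (kA : A -> nat) (kB : forall d, B d -> nat) :
  listed kA (iota 0 (num kT)) ->
  (forall d, listed (@kB d) (iota 0 (num (nth kT ks (eD d))))) ->
  listed (node_key kA kB eD) (knodes num kT ks).
Proof.
move=> hA hB.
pose k2 (o : option D) := match o as o return node_type A B o -> nat with
                  | Some d => @kB d | None => kA end.
apply: (listed_sig (k2 := k2)
          (l2 := fun o => iota 0 (num (nth kT (kT :: ks) o))) (en_discs encT)).
by case.
Qed.

Lemma kglued_mem (npts : tcode -> nat -> nat) (inc : tcode -> seq (seq nat))
    (N : D -> nat) (A : finType) (B : D -> finType)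
    (a : forall d, 'I_(N d) -> A) (b : forall d, 'I_(N d) -> B d)
    (kA : A -> nat) (kB : forall d, B d -> nat) :
  (forall d, npts kT (eD d).+1 = N d) ->
  (forall d (z : 'I_(N d)), kA (a d z) = lnth (inc kT) (eD d).+1 z) ->
  (forall d (z : 'I_(N d)), kB d (b d z) = lnth (inc (nth kT ks (eD d))) 0 z) ->
  forall u v, (u, v) \in kglued npts inc kT ks <->
  exists d (z : 'I_(N d)), u = (0, kA (a d z)) /\ v = ((eD d).+1, kB d (b d z)).
Proof.
move=> hn ha hb u v; split.
  case/flatten_mapP=> _ /(listed_ex (en_D encT))[d <-] /mapP[j].
  rewrite hn => /(listed_ex (listed_ord _))[z <-] [-> ->].
  by exists d, z; rewrite ha hb.
case=> d [z [-> ->]]; apply/flatten_mapP; exists (eD d).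
  exact: listed_mem (en_D encT) _.
apply/mapP; exists (z : nat); last by rewrite ha hb.
by rewrite hn (listed_mem (listed_ord _)).
Qed.

Lemma glue_bijective : perm_eq fl [seq (d, e) | d <- iota 0 (size (kin kT)),
     e <- iota 0 (size (kin (nth kT ks d)))] ->
  size fl = size (kin kU) -> bijective f.
Proof.
move=> hp hs.
have hl := listed_sig (l2 := fun d => iota 0 (size (kin (nth kT ks d))))
             (en_D encT) (fun d => en_D (encS d)).
have hlt u : eF u < size fl.
  by have := listed_mem (en_D encU) u; rewrite mem_iota /= add0n hs.
have ufl : uniq fl by rewrite (perm_uniq hp) (listed_uniq hl).
have finj : injective f.
  move=> u v huv; apply: (listed_inj (en_D encU)).
  by apply/eqP; rewrite -(nth_uniq (0, 0) (hlt u) (hlt v) ufl) -!hf huv.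
have fsurj x : exists u, f u = x.
  have := listed_mem hl x; rewrite -(perm_mem hp) => /(nthP (0, 0))[i hi hx].
  have [|u hu] := listed_ex (en_D encU) (k := i); first by rewrite mem_iota /= add0n -hs.
  by exists u; apply: (listed_inj hl); rewrite /= hf hu hx.
have [g hg] := choice fsurj.
by exists g => // u; apply: finj; rewrite hg.
Qed.

Lemma glueP : glue_check kT ks kU fl phiS phiR -> is_gluing T S U.
Proof.
case/andP=> /and5P[/andP[hp /eqP hs] hpS hpR /allP hsh /allP hsd]
            /and3P[/allP h0 /allP h0' /allP hu].
split; first exact: glue_bijective.
have nS := nodes_listed (num := kstr) (en_S encT) (fun d => en_S (encS d)).
have nR := nodes_listed (num := kreg) (en_R encT) (fun d => en_R (encS d)).
have eS := kglued_mem (npts := npt) (inc := kpt)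
  (a := fun d => pt T (Some d)) (b := fun d => pt (S d) None)
  (kA := en_s encT) (kB := fun d => en_s (encS d))
  (fun d => en_npt encT (Some d)) (fun d => en_pt encT (d := Some d))
  (fun d => en_pt (encS d) (d := None)).
have eR := kglued_mem (npts := fun k d => (npt k d).+1) (inc := kiv)
  (a := fun d => iv T (Some d)) (b := fun d => iv (S d) None)
  (kA := en_r encT) (kB := fun d => en_r (encS d))
  (fun d => congr1 succn (en_npt encT (Some d)))
  (fun d => en_iv encT (d := Some d))
  (fun d => en_iv (encS d) (d := None)).
have [gS [hgS pS]] := pushout_checkP nS (en_S encU) eS hpS.
have [gR [hgR pR]] := pushout_checkP nR (en_R encU) eR hpR.
have mS x : (node_key (en_s encT) (fun d => en_s (encS d)) eD x, en_s encU (gS x))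
            \in phiS.
  rewrite hgS; apply: lookup_in; case/and5P: hpS => /eqP -> _ _ _ _.
  exact: listed_mem nS x.
have mR x : (node_key (en_r encT) (fun d => en_r (encS d)) eD x, en_r encU (gR x))
            \in phiR.
  rewrite hgR; apply: lookup_in; case/and5P: hpR => /eqP -> _ _ _ _.
  exact: listed_mem nR x.
exists (fun x => gS (nodeA _ x)), (fun d x => gS (nodeB _ x)),
       (fun x => gR (nodeA _ x)), (fun d x => gR (nodeB _ x)); split=> //.
- split.
  + by move=> r; rewrite (en_sh encU) (en_sh encT) (eqP (hsh _ (mR _))).
  + by move=> d r; rewrite (en_sh encU) (en_sh (encS d)) (eqP (hsh _ (mR _))).
  + move=> b e; apply: (listed_inj (en_R encU)).
    rewrite (en_sd encU) hgR /node_key /= (en_sd encT).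
    by have /allP/(_ b) := hsd _ (mS (nodeA _ e)); case: b => /(_ isT)/eqP.
  + move=> d b e; apply: (listed_inj (en_R encU)).
    rewrite (en_sd encU) hgR /node_key /= (en_sd (encS d)).
    by have /allP/(_ b) := hsd _ (mS (nodeB _ e)); case: b => /(_ isT)/eqP.
- split.
  + move=> j; apply: (listed_inj (en_S encU)).
    rewrite hgS (en_pt encU) /node_key /= (en_pt encT) /=.
    by apply/eqP/h0; exact: listed_mem (en_pts encT None) j.
  + move=> i; apply: (listed_inj (en_R encU)).
    rewrite hgR (en_iv encU) /node_key /= (en_iv encT) /=.
    by apply/eqP/h0'; exact: listed_mem (en_ivs encT None) i.
- have hlt u : eF u \in iota 0 (size fl).
    by rewrite hs; exact: listed_mem (en_D encU) u.
  split.
  + move=> u j; apply: (listed_inj (en_S encU)).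
    have /andP[/allP h _] := hu _ (hlt u).
    rewrite hgS (en_pt encU) /node_key /= (en_pt (encS _)) /=.
    apply/eqP; move: h; rewrite -hf /=; apply.
    exact: listed_mem (en_pts (encS _) (Some (tagged (f u)))) j.
  + move=> u i; apply: (listed_inj (en_R encU)).
    have /andP[_ /allP h] := hu _ (hlt u).
    rewrite hgR (en_iv encU) /node_key /= (en_iv (encS _)) /=.
    apply/eqP; move: h; rewrite -hf /=; apply.
    exact: listed_mem (en_ivs (encS _) (Some (tagged (f u)))) i.
Qed.

End Glue.

(** * Tables of the basic tangles *)

Definition wf_check k :=
  all (fun d => all (fun j => lnth (kpt k) d j < kstr k) (iota 0 (npt k d)) &&
                all (fun i => lnth (kiv k) d i < kreg k) (iota 0 (npt k d).+1))
      (iota 0 (ndisc k)) &&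
  all (fun e => (kside k true e < kreg k) && (kside k false e < kreg k))
      (iota 0 (kstr k)).

Lemma decode_tangle (D : finType) (col : D -> color) (k : tcode) (eD : D -> nat) :
  listed eD (iota 0 (size (kin k))) ->
  (forall d, nth (0, false) (kin k) (eD d) = col d) -> wf_check k ->
  exists T : tangle col (kcol k), inhabited (encoding T k eD).
Proof.
move=> hD hin /andP[/allP h1 /allP h2].
have hd (d : option D) : eO eD d \in iota 0 (ndisc k).
  exact: listed_mem (listed_option hD) d.
have hdisc d : kdisc k (eO eD d) = disc_color col (kcol k) d.
  by case: d => [d|] //=; rewrite -hin.
have hp (d : option D) (j : 'I_(disc_color col (kcol k) d).1.*2) :
    lnth (kpt k) (eO eD d) j < kstr k.
  have /andP[/allP h _] := h1 _ (hd d); apply: h.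
  by rewrite /npt hdisc (listed_mem (listed_ord _)).
have hi (d : option D) (j : 'I_(disc_color col (kcol k) d).1.*2.+1) :
    lnth (kiv k) (eO eD d) j < kreg k.
  have /andP[_ /allP h] := h1 _ (hd d); apply: h.
  by rewrite /npt hdisc (listed_mem (listed_ord _)).
have hs (b : bool) (e : 'I_(kstr k)) : kside k b e < kreg k.
  have /andP[] := h2 _ (listed_mem (listed_ord _) e).
  by case: b.
pose T := @Tangle D col (kcol k) 'I_(kstr k) 'I_(kreg k)
  (fun r => nth false (ksh k) r) (fun b e => Ordinal (hs b e))
  (fun d j => Ordinal (hp d j)) (fun d i => Ordinal (hi d i)).
exists T; constructor.
apply: (@Encoding _ _ _ T k eD (fun i : 'I_(kstr k) => nat_of_ord i)
          (fun i : 'I_(kreg k) => nat_of_ord i)) => //; exact: listed_ord.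
Qed.

Definition table (T : Type) (f : nat -> T) n := [seq f i | i <- iota 0 n].

Lemma nth_table (T : Type) (x0 : T) f n i : i < n -> nth x0 (table f n) i = f i.
Proof. by move=> hi; rewrite (nth_map 0) ?size_iota // nth_iota. Qed.

Definition rot_side (c : color) (b : bool) (j : nat) :=
  (if b == c.2 (+) odd j then j else j.+1) %% c.1.*2.-1.+1.

(** The reductions modulo the number of regions identify the two copies of the
    marked interval, as [inZp] does. *)
Definition id_code (c : color) :=
  let m := c.1.*2.-1.+1 in
  TCode c [:: c] c.1.*2 m (table (fun r => c.2 (+) odd r) m)
    (table (fun j => (rot_side c true j, rot_side c false j)) c.1.*2)
    [:: iota 0 c.1.*2; iota 0 c.1.*2]
    [:: table (fun i => i %% m) c.1.*2.+1; table (fun i => i %% m) c.1.*2.+1].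

Lemma listed_unit : listed (fun _ : unit => 0) (iota 0 1).
Proof. by apply: listedP => // [[] []//|k]; rewrite inE => /eqP ->; exists tt. Qed.

Lemma id_encoding c : encoding (id_tangle c) (id_code c) (fun _ => 0).
Proof.
apply: (@Encoding _ _ _ (id_tangle c) (id_code c) _
          (fun i : 'I_c.1.*2 => nat_of_ord i)
          (fun i : 'I_c.1.*2.-1.+1 => nat_of_ord i)) => //.
- exact: listed_unit.
- exact: listed_ord.
- exact: listed_ord.
- by move=> r; rewrite /= nth_table.
- by move=> b e; rewrite /kside /= nth_table //; case: b.
- by case=> [d|] j; rewrite /lnth /= nth_iota.
- by case=> [d|] j; rewrite /lnth /= nth_table.
Qed.

Definition pair_code (c : color) :=
  let m := c.1.*2.-1.+1 in
  TCode (0, c.2) [:: c; c] c.1.*2 m (table (fun r => c.2 (+) odd r) m)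
    (table (fun j => (rot_side c true j, rot_side c false j)) c.1.*2)
    [:: [::]; iota 0 c.1.*2; table (fun j => c.1.*2 - j.+1) c.1.*2]
    [:: [:: 0]; table (fun i => i %% m) c.1.*2.+1;
        table (fun i => (c.1.*2 - i) %% m) c.1.*2.+1].

Definition bool_key (b : bool) := if b then 0 else 1.

Lemma listed_bool_key : listed bool_key (iota 0 2).
Proof.
apply: listedP => [[] []|//|[]|k] //.
by rewrite !inE => /orP[]/eqP ->; [exists true|exists false].
Qed.

Lemma pair_encoding c : encoding (pairing_tangle c) (pair_code c) bool_key.
Proof.
apply: (@Encoding _ _ _ (pairing_tangle c) (pair_code c) _
          (fun i : 'I_c.1.*2 => nat_of_ord i)
          (fun i : 'I_c.1.*2.-1.+1 => nat_of_ord i)) => //.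
- exact: listed_bool_key.
- by case.
- exact: listed_ord.
- exact: listed_ord.
- by move=> r; rewrite /= nth_table.
- by move=> b e; rewrite /kside /= nth_table //; case: b.
- case=> [[]|] j; rewrite /lnth /=.
  + by rewrite nth_iota.
  + by rewrite nth_table.
  + by case: j.
- case=> [[]|] j; rewrite /lnth /=.
  + by rewrite nth_table.
  + by rewrite nth_table // subSS.
  + by rewrite mod0n; case: j => -[].
Qed.

Definition tab_code (D : Type) (ds : seq D) (c : color) (s : bool) (m n : nat)
    (sh : seq bool) (sd : seq (nat * nat)) (ps rs : option D -> seq nat) :=
  let k := TCode c (nseq (size ds) (2, s)) m.+1 n.+1
    (table (fun r => s (+) nth false sh r) n.+1)
    (table (fun e => let p := nth (0, 0) sd e in
       ((if true == s then p.1 else p.2) %% n.+1,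
        (if false == s then p.1 else p.2) %% n.+1)) m.+1) in
  let ds' := None :: [seq Some d | d <- ds] in
  let np d := (if d is Some _ then 4 else c.1.*2) in
  k [seq table (fun j => nth 0 (ps d) j %% m.+1) (np d) | d <- ds']
    [seq table (fun j => nth 0 (rs d) j %% n.+1) (np d).+1 | d <- ds'].

Lemma tab_encoding (D : finType) (ds : seq D) (eD : D -> nat) c s m n sh sd ps rs :
  listed eD (iota 0 (size ds)) -> (forall d x0, nth x0 ds (eD d) = d) ->
  encoding (@table_tangle D c s m n sh sd ps rs)
    (@tab_code D ds c s m n sh sd ps rs) eD.
Proof.
move=> hD hds.
have hlt d : eD d < size ds by have := listed_mem hD d; rewrite mem_iota.
have hnth T (x0 : T) f d :
    nth x0 [seq f d' | d' <- None :: [seq Some d0 | d0 <- ds]] (eO eD d) = f d.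
  case: d => [d|] //=; rewrite -map_comp (nth_map d) //=.
  by rewrite hds.
apply: (@Encoding _ _ _ (@table_tangle D c s m n sh sd ps rs)
          (@tab_code D ds c s m n sh sd ps rs) _
          (fun i : 'I_m.+1 => nat_of_ord i)
          (fun i : 'I_n.+1 => nat_of_ord i)) => //.
- by rewrite /= size_nseq.
- by move=> d; rewrite /= nth_nseq hlt.
- exact: listed_ord.
- exact: listed_ord.
- by move=> r; rewrite /= nth_table.
- by move=> b e; rewrite /kside /= nth_table //; case: b.
- move=> d j; rewrite /lnth hnth nth_table //; last by case: d j.
- move=> d j; rewrite /lnth hnth nth_table //; last by case: d j.
Qed.

Definition refl_code k :=
  TCode (kcol k) (kin k) (kstr k) (kreg k) (ksh k) (ksd k)
    (table (fun d => table (fun j => lnth (kpt k) d (npt k d - j.+1)) (npt k d))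
       (ndisc k))
    (table (fun d => table (fun i => lnth (kiv k) d (npt k d - i)) (npt k d).+1)
       (ndisc k)).

Lemma refl_encoding (D : finType) (col : D -> color) c (T : tangle col c) k eD :
  encoding T k eD -> encoding (reflect_tangle T) (refl_code k) eD.
Proof.
move=> en.
have hd d : eO eD d < ndisc k by have := en_disc_lt en d; rewrite mem_iota.
apply: (@Encoding _ _ _ (reflect_tangle T) (refl_code k) _ (en_s en) (en_r en)).
- exact: en_col en.
- exact: en_D en.
- exact: en_in en.
- exact: en_S en.
- exact: en_R en.
- exact: en_sh en.
- exact: en_sd en.
- move=> d j; rewrite (en_pt en) /lnth nth_table // nth_table //=.
    by rewrite (en_npt en).
  by rewrite (en_npt en).
- move=> d j; rewrite (en_iv en) /lnth nth_table // nth_table //=.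
    by rewrite (en_npt en) subSS.
  by rewrite (en_npt en).
Qed.

Definition tcode_data k :=
  (kcol k, kin k, kstr k, kreg k, (ksh k, ksd k, kpt k, kiv k)).

Lemma tcode_data_inj : injective tcode_data.
Proof.
by move=> [? ? ? ? ? ? ? ?] [? ? ? ? ? ? ? ?] [-> -> -> -> -> -> -> ->].
Qed.

Definition by_var (nss : seq (seq nat)) (x : nat * nat) := lnth nss x.1 x.2.

Definition first_occs (l : seq nat) := rev (undup (rev l)).

(** * Tables of composite tangles *)

Record glue_data := GlueData {
  g_code : tcode;
  g_vars : seq nat;
  g_in : seq (nat * nat);
  g_str : seq ((nat * nat) * nat);
  g_reg : seq ((nat * nat) * nat) }.

(** The inputs are sorted by the variables that they carry, and strings and
    regions are numbered in the order of their first occurrence along the inputs,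
    the output disc coming last.  The result serves as a normal form: it should
    not depend on the way in which the tangle was cut into pieces, nor, without
    output points, on the region that contains the output disc.  Soundness does
    not rest on this, as [node_check] verifies the composite. *)
Definition glue_codes (kT : tcode) (ks : seq tcode) (nss : seq (seq nat)) : glue_data :=
  let kk o := nth kT (kT :: ks) o in
  let fl := sort (fun x y => by_var nss x <= by_var nss y)
    [seq (d, e) | d <- iota 0 (size (kin kT)),
                  e <- iota 0 (size (kin (nth kT ks d)))] in
  let nS := knodes kstr kT ks in
  let nR := knodes kreg kT ks in
  let LS := comps nS (kglued npt kpt kT ks) in
  let LR := comps nR (kglued (fun k d => (npt k d).+1) kiv kT ks) in
  let od := (0, 0) :: [seq (x.1.+1, x.2.+1) | x <- fl] in
  let discs := rcons [seq (x.1.+1, x.2.+1) | x <- fl] (0, 0) in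
  let ptl x := [seq lookup LS (x.1, lnth (kpt (kk x.1)) x.2 j)
                | j <- iota 0 (npt (kk x.1) x.2)] in
  let ivl x := [seq lookup LR (x.1, lnth (kiv (kk x.1)) x.2 i)
                | i <- iota 0 (npt (kk x.1) x.2).+1] in
  let oS := first_occs (flatten [seq ptl x | x <- discs] ++ unzip2 LS) in
  let firstS l := nth (0, 0) nS (index l (unzip2 LS)) in
  let firstR l := nth (0, 0) nR (index l (unzip2 LR)) in
  let sdl l := let x := firstS l in
    (lookup LR (x.1, kside (kk x.1) true x.2),
     lookup LR (x.1, kside (kk x.1) false x.2)) in
  let oR := first_occs (flatten [seq ivl x | x <- behead od] ++
              flatten [seq let p := sdl l in [:: p.1; p.2] | l <- oS] ++
              unzip2 LR) in
  let inS l := index l oS in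
  let inR l := index l oR in
  GlueData
    (TCode (kcol kT) [seq nth (0, false) (kin (nth kT ks x.1)) x.2 | x <- fl]
       (size oS) (size oR)
       [seq let x := firstR l in nth false (ksh (kk x.1)) x.2 | l <- oR]
       [seq let p := sdl l in (inR p.1, inR p.2) | l <- oS]
       [seq map inS (ptl x) | x <- od]
       [seq map inR (ivl x) | x <- od])
    [seq by_var nss x | x <- fl] fl
    [seq (z.1, inS z.2) | z <- LS] [seq (z.1, inR z.2) | z <- LR].

Definition node_check (s : bool) kT ks nss :=
  let G := glue_codes kT ks nss in
  [&& glue_check kT ks (g_code G) (g_in G) (g_str G) (g_reg G),
      wf_check (g_code G), planar_check (g_code G),
      kin (g_code G) == nseq (size (g_vars G)) (2, s) &
      g_vars G == [seq by_var nss x | x <- g_in G]].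

(** * Elements represented by tables *)

Section Evaluation.
Variables (R : realType) (A : planar_star_algebra R) (s : bool).
Local Notation P := (box A (2, s)).
Implicit Types (env : nat -> P) (k : tcode) (ns : seq nat).

(** The variables are listed by their indices in an environment, so that equality
    of two lists of variables is decided by computation. *)
Definition rep env k ns (c : color) (v : box A c) : Prop :=
  size ns = size (kin k) /\
  exists (T : tangle (fun _ : 'I_(size (kin k)) => (2, s)) c)
         (en : encoding T k (fun i : 'I_(size (kin k)) => nat_of_ord i)),
    planar T /\ v = act T (fun i => env (nth 0 ns i)).

Lemma rep_node env (D : finType) (col : D -> color) c (T : tangle col c)
    kT (eD : D -> nat) (enT : encoding T kT eD) (v : forall d, box A (col d))
    (ks : seq tcode) (nss : seq (seq nat)) :
  planar T ->
  (forall d, rep env (nth kT ks (eD d)) (nth [::] nss (eD d)) (v d)) ->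
  node_check s kT ks nss ->
  rep env (g_code (glue_codes kT ks nss)) (g_vars (glue_codes kT ks nss)) (act T v).
Proof.
set G := glue_codes kT ks nss; rewrite /node_check -/G.
move=> hT hv /and5P[hglue hwf hpl /eqP hkin /eqP hvars].
have hsz : size (kin (g_code G)) = size (g_vars G) by rewrite hkin size_nseq.
have hfl : size (g_in G) = size (kin (g_code G)).
  by rewrite hsz hvars size_map.
split; first by rewrite hsz.
pose m := size (kin (g_code G)).
pose N d := size (kin (nth kT ks (eD d))).
(* choose the tangles that represent the inputs *)
pose S d := projT1 (cid (hv d).2).
have enS d : encoding (S d) (nth kT ks (eD d)) (fun i : 'I_(N d) => nat_of_ord i).
  by have [h _] := cid (projT2 (cid (hv d).2)).
have plS d : planar (S d) by have [? []] := projT2 (cid (hv d).2).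
have actS d : v d = act (S d) (fun i => env (nth 0 (nth [::] nss (eD d)) i)).
  by have [? []] := projT2 (cid (hv d).2).
have hl := listed_sig (l2 := fun d => iota 0 (size (kin (nth kT ks d))))
             (en_D enT) (fun d => en_D (enS d)).
have hperm : perm_eq (g_in G) [seq (d, e) | d <- iota 0 (size (kin kT)),
                               e <- iota 0 (size (kin (nth kT ks d)))].
  by case/andP: hglue => /and5P[/andP[]].
have [|f hf] := listed_choice (f := fun i : 'I_m => nth (0, 0) (g_in G) i) hl.
  by move=> i; rewrite -(perm_mem hperm) mem_nth // hfl.
have hcol : kcol (g_code G) = c by rewrite -(en_col enT).
have [||U [enU]] := @decode_tangle 'I_m (fun _ => (2, s)) (g_code G)
    (fun i => nat_of_ord i) _ _ hwf.
- exact: listed_ord.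
- by move=> d; rewrite hkin nth_nseq -hsz ltn_ord.
case: c / hcol T hT enT S enS plS actS hl hf => T hT enT S enS plS actS hl hf.
exists U, enU; have hU := planarP enU hpl; split=> //.
have := @act_gluing R A D col _ T (fun d => 'I_(N d)) (fun d _ => (2, s)) S 'I_m f U
  (fun u => env (nth 0 (nth [::] nss (eD (tag u))) (tagged u))) hT plS hU.
have hTSU := @glueP D col _ T (fun d => 'I_(N d)) (fun d _ => (2, s)) S 'I_m f U
    kT ks _ eD (fun d i => nat_of_ord i) (fun i => nat_of_ord i)
    enT enS enU _ _ _ hf hglue.
move=> /(_ hTSU).
have -> : v = fun d => act (S d)
   (fun e => env (nth 0 (nth [::] nss (eD d)) e)).
  by apply: functional_extensionality_dep => d; rewrite actS.
move=> <-; congr act; apply: funext => i; congr env.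
by rewrite hvars (nth_map (0, 0)) ?hfl // -hf.
Qed.

Definition id_check k :=
  let fl := [seq (0, i) | i <- iota 0 (size (kin k))] in
  let phi n m inc := [seq ((0, i), lnth (inc k) 0 i) | i <- iota 0 n] ++
               [seq ((1, i), i) | i <- iota 0 m] in
  glue_check (id_code (kcol k)) [:: k] k fl
     (phi (kcol k).1.*2 (kstr k) kpt) (phi (kcol k).1.*2.-1.+1 (kreg k) kiv) &&
  planar_check (id_code (kcol k)).

(** Filling the identity tangle with a tangle gives any tangle of the same table:
    this is invariance under isotopy. *)
Lemma rep_uniq env k ns c (v w : box A c) :
  rep env k ns v -> rep env k ns w -> id_check k -> v = w.
Proof.
move=> [hs [T [enT [hT ->]]]] [_ [U [enU [hU ->]]]].
case/andP; rewrite (en_col enT) => hg hid.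
have hidp : planar (id_tangle c) := planarP (id_encoding c) hid.
pose m := size (kin k).
pose f (i : 'I_m) : {d : unit & 'I_m} := existT _ tt i.
have hf (u : 'I_m) : (0, nat_of_ord u) = nth (0, 0) [seq (0, i) | i <- iota 0 m] u.
  by rewrite (nth_map 0) ?nth_iota ?size_iota.
have hTU := @glueP unit (fun _ => c) c (id_tangle c) (fun _ => 'I_m)
  (fun _ _ => (2, s)) (fun _ => T) 'I_m f U (id_code c) [:: k] k (fun _ => 0)
  (fun _ i => nat_of_ord i) (fun i => nat_of_ord i) (id_encoding c)
  (fun _ => enT) enU _ _ _ hf hg.
have := @act_gluing R A unit (fun _ => c) c (id_tangle c) (fun _ => 'I_m)
  (fun _ _ => (2, s)) (fun _ => T) 'I_m f U (fun u => env (nth 0 ns (tagged u)))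
  hidp (fun _ => hT) hU hTU.
by move=> /= ->; rewrite act_id.
Qed.

Definition eq_check k ns k' ns' :=
  [&& tcode_data k == tcode_data k', ns == ns' & id_check k].

Lemma rep_eq env k ns k' ns' c (v w : box A c) :
  rep env k ns v -> rep env k' ns' w -> eq_check k ns k' ns' -> v = w.
Proof.
move=> hv hw /and3P[/eqP/tcode_data_inj hk /eqP hn hi].
by apply: rep_uniq hv _ hi; rewrite hk hn.
Qed.

Lemma rep_env env env' k ns ns' c (v : box A c) :
  map env ns = map env' ns' -> rep env k ns v -> rep env' k ns' v.
Proof.
move=> he [hs [T [enT [hT ->]]]].
have hs' : size ns' = size ns by rewrite -(size_map env') -he size_map.
split; first by rewrite hs'.
exists T, enT; split=> //; congr act; apply: funext => i.
have hi : i < size ns by rewrite hs.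
by rewrite -(nth_map 0 0%R) // -[RHS](nth_map 0 0%R) ?hs' // he.
Qed.

Lemma rep_var env i (v : P) : v = env i -> rep env (id_code (2, s)) [:: i] v.
Proof.
move=> ->; split=> //.
have /andP[hw hp] : wf_check (id_code (2, s)) && planar_check (id_code (2, s)).
  by case: (s); vm_compute.
have hg : glue_check (id_code (2, s)) [:: id_code (2, s)] (id_code (2, s))
    [:: (0, 0)]
    ([seq ((0, i), i) | i <- iota 0 4] ++ [seq ((1, i), i) | i <- iota 0 4])
    ([seq ((0, i), i) | i <- iota 0 4] ++ [seq ((1, i), i) | i <- iota 0 4]).
  by case: (s); vm_compute.
have [|T [enT]] := @decode_tangle 'I_1 (fun _ => (2, s)) (id_code (2, s))
    (fun i => nat_of_ord i) (listed_ord 1) _ hw.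
  by case=> -[].
exists T, enT; split; first exact: planarP enT hp.
have hidp : planar (id_tangle (2, s)) := planarP (id_encoding (2, s)) hp.
pose f (i : 'I_1) : {d : unit & unit} := existT _ tt tt.
have hf (u : 'I_1) : (0, 0) = nth (0, 0) [:: (0, 0)] u by case: u => -[].
have hTU := @glueP unit (fun _ => (2, s)) (2, s) (id_tangle (2, s)) (fun _ => unit)
  (fun _ _ => (2, s)) (fun _ => id_tangle (2, s)) 'I_1 f T (id_code (2, s))
  [:: id_code (2, s)] (id_code (2, s)) (fun _ => 0)
  (fun _ _ => 0) (fun i => nat_of_ord i) (id_encoding _)
  (fun _ => id_encoding _) enT _ _ _ hf hg.
have := @act_gluing R A unit (fun _ => (2, s)) _ (id_tangle (2, s))
  (fun _ => unit) (fun _ _ => (2, s)) (fun _ => id_tangle (2, s)) 'I_1 f T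
  (fun u => env i) hidp (fun _ => hidp) (planarP enT hp) hTU.
rewrite act_id act_id => <-.
by congr act; apply: funext; case=> -[].
Qed.

End Evaluation.

(** * Tables of the operations on 2-boxes *)

Definition void_key (d : void) : nat := match d with end.

Lemma listed_void : listed void_key (iota 0 0).
Proof. by apply: listedP => // -[]. Qed.

Definition loop_code t := @tab_code void [::] (0, t) t 0 1 [:: false; true]
  [:: (0, 1)] (fun _ => [::]) (fun _ => [:: 0]).
Definition unit_code t := @tab_code void [::] (2, t) t 1 2 [:: false; true; false]
  [:: (0, 1); (2, 1)] (fun _ => [:: 0; 1; 1; 0]) (fun _ => [:: 0; 1; 2; 1; 0]).
Definition cupcap_code t := @tab_code void [::] (2, t) t 1 2
  [:: false; true; true] [:: (0, 1); (0, 2)]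
    (fun _ => [:: 0; 0; 1; 1]) (fun _ => [:: 0; 1; 0; 2; 0]).
Definition mult_code t := tab_code [:: true; false] (2, t) t 5 4
    [:: false; true; false; true; true]
    [:: (0, 1); (2, 1); (2, 3); (0, 3); (2, 4); (0, 4)]%N
    (fun d => match d with
              | None => [:: 0; 1; 4; 5]
              | Some true => [:: 0; 1; 2; 3]
              | Some false => [:: 3; 2; 4; 5]
              end%N)
    (fun d => match d with
              | None => [:: 0; 1; 2; 4; 0]
              | Some true => [:: 0; 1; 2; 3; 0]
              | Some false => [:: 0; 3; 2; 4; 0]
              end%N).
Definition trace_code t := tab_code [:: tt] (0, t) t 1 2 [:: false; true; false]
    [:: (0, 1); (2, 1)]%N
    (fun d => if d is Some _ then [:: 0; 1; 1; 0] else [::])%N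
    (fun d => if d is Some _ then [:: 0; 1; 2; 1; 0] else [:: 0])%N.
Definition rotation_code t := tab_code [:: tt] (2, ~~ t) t 3 3
    [:: false; true; false; true]
    [:: (0, 1); (2, 1); (2, 3); (0, 3)]%N
    (fun d => if d is Some _ then [:: 0; 1; 2; 3] else [:: 3; 0; 1; 2])%N
    (fun d => if d is Some _ then [:: 0; 1; 2; 3; 0] else [:: 3; 0; 1; 2; 3])%N.
Definition coprod_code t := tab_code [:: true; false] (2, t) t 5 4
    [:: false; true; false; false; true]
    [:: (0, 1); (2, 1); (3, 1); (3, 4); (2, 4); (0, 4)]%N
    (fun d => match d with
              | None => [:: 0; 2; 3; 5]
              | Some true => [:: 0; 1; 4; 5]
              | Some false => [:: 1; 2; 3; 4]
              end%N)
    (fun d => match d with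
              | None => [:: 0; 1; 3; 4; 0]
              | Some true => [:: 0; 1; 2; 4; 0]
              | Some false => [:: 2; 1; 3; 4; 2]
              end%N).

Lemma loop_encoding t : encoding (loop_tangle t) (loop_code t) void_key.
Proof. by apply: tab_encoding; [exact: listed_void|case]. Qed.
Lemma unit_encoding t : encoding (unit_tangle t) (unit_code t) void_key.
Proof. by apply: tab_encoding; [exact: listed_void|case]. Qed.
Lemma cupcap_encoding t : encoding (cupcap_tangle t) (cupcap_code t) void_key.
Proof. by apply: tab_encoding; [exact: listed_void|case]. Qed.
Lemma mult_encoding t : encoding (mult_tangle t) (mult_code t) bool_key.
Proof. by apply: tab_encoding; [exact: listed_bool_key|case]. Qed.
Lemma trace_encoding t : encoding (trace_tangle t) (trace_code t) (fun _ => 0).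
Proof. by apply: tab_encoding; [exact: listed_unit|case]. Qed.
Lemma rotation_encoding t :
  encoding (rotation_tangle t) (rotation_code t) (fun _ => 0).
Proof. by apply: tab_encoding; [exact: listed_unit|case]. Qed.
Lemma coprod_encoding t : encoding (coprod_tangle t) (coprod_code t) bool_key.
Proof. by apply: tab_encoding; [exact: listed_bool_key|case]. Qed.

Lemma loop_planar t : planar (loop_tangle t).
Proof. by apply: (planarP (loop_encoding t)); case: t; vm_compute. Qed.
Lemma unit_planar t : planar (unit_tangle t).
Proof. by apply: (planarP (unit_encoding t)); case: t; vm_compute. Qed.
Lemma cupcap_planar t : planar (cupcap_tangle t).
Proof. by apply: (planarP (cupcap_encoding t)); case: t; vm_compute. Qed.
Lemma mult_planar t : planar (mult_tangle t).
Proof. by apply: (planarP (mult_encoding t)); case: t; vm_compute. Qed.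
Lemma trace_planar t : planar (trace_tangle t).
Proof. by apply: (planarP (trace_encoding t)); case: t; vm_compute. Qed.
Lemma rotation_planar t : planar (rotation_tangle t).
Proof. by apply: (planarP (rotation_encoding t)); case: t; vm_compute. Qed.
Lemma coprod_planar t : planar (coprod_tangle t).
Proof. by apply: (planarP (coprod_encoding t)); case: t; vm_compute. Qed.

Section Operations.
Variables (R : realType) (A : planar_star_algebra R) (s : bool).
Local Notation P := (box A (2, s)).
Implicit Types (env : nat -> P) (k : tcode) (ns : seq nat) (t : bool).
Local Notation out kT ks nss := (g_code (glue_codes kT ks nss)) (only parsing).
Local Notation vars kT ks nss := (g_vars (glue_codes kT ks nss)) (only parsing).

Lemma rep_mul env t (x y : box A (2, t)) k1 n1 k2 n2 :
  rep env k1 n1 x -> rep env k2 n2 y ->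
  node_check s (mult_code t) [:: k2; k1] [:: n2; n1] ->
  rep env (out (mult_code t) [:: k2; k1] [:: n2; n1])
    (vars (mult_code t) [:: k2; k1] [:: n2; n1]) (mul2 x y).
Proof.
move=> h1 h2 hc; apply: (rep_node (mult_encoding t)) hc; first exact: mult_planar.
by case.
Qed.

Lemma rep_coprod env t (x y : box A (2, t)) k1 n1 k2 n2 :
  rep env k1 n1 x -> rep env k2 n2 y ->
  node_check s (coprod_code t) [:: k1; k2] [:: n1; n2] ->
  rep env (out (coprod_code t) [:: k1; k2] [:: n1; n2])
    (vars (coprod_code t) [:: k1; k2] [:: n1; n2]) (coprod x y).
Proof.
move=> h1 h2 hc; apply: (rep_node (coprod_encoding t)) hc; first exact: coprod_planar.
by case.
Qed.

Lemma rep_fourier env t (x : box A (2, t)) k n : rep env k n x ->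
  node_check s (rotation_code t) [:: k] [:: n] ->
  rep env (out (rotation_code t) [:: k] [:: n])
    (vars (rotation_code t) [:: k] [:: n]) (fourier x).
Proof.
move=> h hc; apply: (rep_node (rotation_encoding t)) hc; first exact: rotation_planar.
by case.
Qed.

Lemma rep_trace env t (x : box A (2, t)) k n : rep env k n x ->
  node_check s (trace_code t) [:: k] [:: n] ->
  rep env (out (trace_code t) [:: k] [:: n])
    (vars (trace_code t) [:: k] [:: n]) (act (trace_tangle t) (fun _ => x)).
Proof.
move=> h hc; apply: (rep_node (trace_encoding t)) hc; first exact: trace_planar.
by case.
Qed.

Lemma rep_one env t : node_check s (unit_code t) [::] [::] ->
  rep env (out (unit_code t) [::] [::]) (vars (unit_code t) [::] [::])
    (one2 A t).
Proof.
by apply: (rep_node (unit_encoding t)); [exact: unit_planar|case].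
Qed.

Lemma rep_cupcap env t : node_check s (cupcap_code t) [::] [::] ->
  rep env (out (cupcap_code t) [::] [::]) (vars (cupcap_code t) [::] [::])
    (act (cupcap_tangle t) (@no_input _ A t)).
Proof.
by apply: (rep_node (cupcap_encoding t)); [exact: cupcap_planar|case].
Qed.

Lemma rep_loop env t : node_check s (loop_code t) [::] [::] ->
  rep env (out (loop_code t) [::] [::]) (vars (loop_code t) [::] [::])
    (act (loop_tangle t) (@no_input _ A t)).
Proof.
by apply: (rep_node (loop_encoding t)); [exact: loop_planar|case].
Qed.

Lemma rep_pairing env (c : color) (x y : box A c) k1 n1 k2 n2 :
  rep env k1 n1 x -> rep env k2 n2 y ->
  planar_check (pair_code c) && node_check s (pair_code c) [:: k1; k2] [:: n1; n2] ->
  rep env (out (pair_code c) [:: k1; k2] [:: n1; n2])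
    (vars (pair_code c) [:: k1; k2] [:: n1; n2])
    (act (pairing_tangle c) (fun b : bool => if b then x else y)).
Proof.
move=> h1 h2 /andP[hp hc]; apply: (rep_node (pair_encoding c)) hc.
  exact: planarP (pair_encoding c) hp.
by case.
Qed.

(** Reflection reverses the order of the points, so the reflected table is put
    back in normal form by inserting it in the identity tangle. *)
Lemma rep_star env env' k ns ns' c (v : box A c) :
  rep env k ns v -> [seq star (env i) | i <- ns] = map env' ns' ->
  [&& planar_check (refl_code k), planar_check (id_code (kcol k)) &
      node_check s (id_code (kcol k)) [:: refl_code k] [:: ns']] ->
  rep env' (out (id_code (kcol k)) [:: refl_code k] [:: ns'])
    (vars (id_code (kcol k)) [:: refl_code k] [:: ns']) (star v).
Proof.
move=> [hs [T [enT [hT ->]]]] he /and3P[hr hi hn].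
rewrite -act_star // -[act _ _]act_id.
move: hi hn; rewrite (en_col enT) => hi hn.
apply: (rep_node (id_encoding c)) hn; first exact: planarP (id_encoding c) hi.
case=> /=; apply: (@rep_env _ _ _ (fun i => star (env i)) env' _ ns) => //.
split; first exact: hs.
exists (reflect_tangle T), (refl_encoding enT); split; last by [].
exact: planarP (refl_encoding enT) hr.
Qed.

Lemma rep_star_same env env' k ns c (v : box A c) :
  rep env k ns v -> [seq star (env i) | i <- ns] = map env' ns ->
  [&& planar_check (refl_code k), planar_check (id_code (kcol k)) &
      node_check s (id_code (kcol k)) [:: refl_code k] [:: ns]] ->
  rep env' (out (id_code (kcol k)) [:: refl_code k] [:: ns])
    (vars (id_code (kcol k)) [:: refl_code k] [:: ns]) (star v).
Proof. exact: rep_star. Qed.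

Lemma rep_exists env k ns :
  [&& wf_check k, planar_check k, kin k == nseq (size ns) (2, s) &
      size ns == size (kin k)] ->
  exists v : box A (kcol k), rep env k ns v.
Proof.
move=> /and4P[hw hp /eqP hk /eqP hs].
have [||T [enT]] := @decode_tangle 'I_(size (kin k)) (fun _ => (2, s)) k
    (fun i => nat_of_ord i) _ _ hw.
- exact: listed_ord.
- by move=> d; rewrite (congr1 (fun l => nth (0, false) l d) hk) nth_nseq ifT // hs.
exists (act T (fun i => env (nth 0 ns i))); split=> //.
by exists T, enT; split=> //; exact: planarP enT hp.
Qed.

Definition sph_check k k' :=
  let data k := (kin k, kstr k, kreg k, (ksh k, ksd k, behead (kpt k),
                 behead (kiv k))) in
  data k == data k'.

(** Normal forms of closed diagrams that differ by the output disc only are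
    isotopic on the sphere. *)
Lemma rep_spherical env k k' ns t t' (v : box A (0, t)) (v' : box A (0, t')) :
  is_spherical A -> rep env k ns v -> rep env k' ns v' -> sph_check k k' ->
  Defs.scalar v = Defs.scalar v'.
Proof.
move=> hsph [hs [T [enT [hT ->]]]] [_ [T' [enT' [hT' ->]]]].
case: k k' hs T enT hT T' enT' hT' =>
  [c i st r sh sd p v0] [c' i' st' r' sh' sd' p' v0'] hs T enT hT T' enT' hT'.
move=> /eqP[? ? ? ? ? hp hv]; subst i' st' r' sh' sd'.
apply: hsph => //.
have [|f hf] := listed_choice (f := en_s enT) (en_S enT').
  exact: listed_mem (en_S enT).
have [|f' hf'] := listed_choice (f := en_s enT') (en_S enT).
  exact: listed_mem (en_S enT').
have [|g hg] := listed_choice (f := en_r enT) (en_R enT').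
  exact: listed_mem (en_R enT).
have [|g' hg'] := listed_choice (f := en_r enT') (en_R enT).
  exact: listed_mem (en_R enT').
have iS := listed_inj (en_S enT); have iS' := listed_inj (en_S enT').
have iR := listed_inj (en_R enT); have iR' := listed_inj (en_R enT').
exists f, g; split.
- split; [exists f' => x|exists g' => x].
  + by apply: iS; rewrite hf' hf.
  + by apply: iS'; rewrite hf hf'.
  + by apply: iR; rewrite hg' hg.
  + by apply: iR'; rewrite hg hg'.
- by move=> x; rewrite (en_sh enT') (en_sh enT) hg.
- by move=> b e; apply: iR'; rewrite hg (en_sd enT') (en_sd enT) hf.
- move=> d j; apply: iS'; rewrite hf (en_pt enT') (en_pt enT) /lnth /=.
  by rewrite -!nth_behead hp.
- move=> d j; apply: iR'; rewrite hg (en_iv enT') (en_iv enT) /lnth /=.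
  by rewrite -!nth_behead hv.
Qed.

Lemma rep_scalar env k k' ns ns' t t' (v : box A (0, t)) (v' : box A (0, t')) :
  is_spherical A -> rep env k ns v -> rep env k' ns' v' ->
  sph_check k k' && (ns == ns') -> Defs.scalar v = Defs.scalar v'.
Proof.
by move=> hsph h h' /andP[hk /eqP e]; apply: (rep_spherical hsph h _ hk); rewrite e.
Qed.

End Operations.

(** An environment lists distinct variables, so that the index of a leaf is found
    by conversion. *)
Ltac rep_leaf :=
  first [exact: (@rep_var _ _ _ _ 0 _ (erefl _)) | exact: (@rep_var _ _ _ _ 1 _ (erefl _))
       | exact: (@rep_var _ _ _ _ 2 _ (erefl _)) | exact: (@rep_var _ _ _ _ 3 _ (erefl _))
       | exact: (@rep_var _ _ _ _ 4 _ (erefl _)) | exact: (@rep_var _ _ _ _ 5 _ (erefl _))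
       | exact: (@rep_var _ _ _ _ 6 _ (erefl _)) | exact: (@rep_var _ _ _ _ 7 _ (erefl _))
       | exact: (@rep_var _ _ _ _ 8 _ (erefl _)) | exact: (@rep_var _ _ _ _ 9 _ (erefl _))].

Ltac vm_check := vm_compute; reflexivity.

Ltac rep_tac :=
  lazymatch goal with
  | |- rep _ _ _ (@mul2 _ _ ?t _ _) => eapply (@rep_mul _ _ _ _ t); [rep_tac | rep_tac | vm_check]
  | |- rep _ _ _ (@coprod _ _ ?t _ _) => eapply (@rep_coprod _ _ _ _ t); [rep_tac | rep_tac | vm_check]
  | |- rep _ _ _ (@fourier _ _ ?t _) => eapply (@rep_fourier _ _ _ _ t); [rep_tac | vm_check]
  | |- rep _ _ _ (act (trace_tangle ?t) _) => eapply (@rep_trace _ _ _ _ t); [rep_tac | vm_check]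
  | |- rep _ _ _ (contragredient _) =>
      cbv beta iota delta [contragredient]; rep_tac
  | |- rep _ _ _ (one2 _ ?t) => eapply (@rep_one _ _ _ _ t); vm_check
  | |- rep _ _ _ (act (cupcap_tangle ?t) _) => eapply (@rep_cupcap _ _ _ _ t); vm_check
  | |- rep _ _ _ (act (loop_tangle ?t) _) => eapply (@rep_loop _ _ _ _ t); vm_check
  | |- rep _ _ _ (act (pairing_tangle ?c) _) =>
      eapply (@rep_pairing _ _ _ _ c); [rep_tac | rep_tac | vm_check]
  | |- _ => first [rep_leaf | eassumption]
  end.

Ltac tangle_eq e := eapply (@rep_eq _ _ _ e); [rep_tac | rep_tac | vm_check].

Ltac tangle_sph hs e :=
  rewrite /tr2; eapply (@rep_scalar _ _ _ e); [exact: hs | rep_tac | rep_tac | vm_check].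
Ltac rep_star_tac e := eapply (@rep_star_same _ _ _ e); [rep_tac | reflexivity | vm_check].
Ltac star_eq e' e :=
  eapply (@rep_eq _ _ _ e'); [rep_star_tac e | rep_tac | vm_check].

Local Open Scope ring_scope.
Local Open Scope complex_scope.

(** * Isotopies between 2-box expressions *)

Section Isotopies.
Variables (R : realType) (A : planar_star_algebra R) (s : bool).
Local Notation P := (box A (2%N, s)).
Local Notation "x ∘ y" := (mul2 x y) (at level 40, left associativity).
Local Notation cupcap t := (act (cupcap_tangle t) (@no_input R A t)).

Lemma mul2A (x y z : P) : x ∘ (y ∘ z) = x ∘ y ∘ z.
Proof. case: s x y z => x y z; tangle_eq (nth 0%R [:: x; y; z]). Qed.

Lemma mul1_2 (x : P) : one2 A s ∘ x = x.
Proof. case: s x => x; tangle_eq (nth 0%R [:: x]). Qed.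

Lemma mul2_1 (x : P) : x ∘ one2 A s = x.
Proof. case: s x => x; tangle_eq (nth 0%R [:: x]). Qed.

Lemma star_mul2 (x y : P) : star (x ∘ y) = star y ∘ star x.
Proof.
case: s x y => x y; star_eq (nth 0 [:: star x; star y]) (nth 0 [:: x; y]).
Qed.

Lemma star_one2 : star (one2 A s) = one2 A s.
Proof.
pose e t (_ : nat) : box A (2%N, t) := 0.
by case: s; [star_eq (e true) (e true) | star_eq (e false) (e false)].
Qed.

Lemma coprodA (x y z : P) : x ⋆ (y ⋆ z) = x ⋆ y ⋆ z.
Proof. case: s x y z => x y z; tangle_eq (nth 0%R [:: x; y; z]). Qed.

Lemma star_coprod (x y : P) : star (x ⋆ y) = star x ⋆ star y.
Proof.
case: s x y => x y; star_eq (nth 0 [:: star x; star y]) (nth 0 [:: x; y]).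
Qed.

Lemma coprod_cupcap (x : P) : x ⋆ cupcap s = x.
Proof. case: s x => x; tangle_eq (nth 0%R [:: x]). Qed.

Lemma contragredientK (x : P) : contragredient (contragredient x) = x.
Proof. case: s x => x; tangle_eq (nth 0%R [:: x]). Qed.

Lemma contragredient_mul2 (x y : P) :
  contragredient (x ∘ y) = contragredient y ∘ contragredient x.
Proof. case: s x y => x y; tangle_eq (nth 0%R [:: x; y]). Qed.

Lemma contragredient_coprod (x y : P) :
  contragredient (x ⋆ y) = contragredient y ⋆ contragredient x.
Proof. case: s x y => x y; tangle_eq (nth 0%R [:: x; y]). Qed.

Lemma star_contragredient (x : P) :
  star (contragredient x) = contragredient (star x).
Proof.
case: s x => x; star_eq (nth 0 [:: star x]) (nth 0 [:: x]).
Qed.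

Lemma star_fourier (x : P) : star (fourier x) = fourier (contragredient (star x)).
Proof.
case: s x => x; star_eq (nth 0 [:: star x]) (nth 0 [:: x]).
Qed.

(** The rotation exchanges product and coproduct; this is what relates
    biprojections to coproducts. *)
Lemma fourier_coprod (x y : P) : fourier (x ⋆ y) = fourier y ∘ fourier x.
Proof. case: s x y => x y; tangle_eq (nth 0%R [:: x; y]). Qed.

Hypothesis hsph : is_spherical A.

Lemma tr2C (x y : P) : tr2 (x ∘ y) = tr2 (y ∘ x).
Proof. case: s x y => x y; tangle_sph hsph (nth 0%R [:: x; y]). Qed.

Lemma tr2_contragredient (x : P) : tr2 (contragredient x) = tr2 x.
Proof. case: s x => x; tangle_sph hsph (nth 0%R [:: x]). Qed.

(** Frobenius reciprocity: y is moved to the other side of the trace by a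
    rotation of 180 degrees; [tr2_coprodr] does the same with x. *)
Lemma tr2_coprodl (x y z : P) :
  tr2 ((x ⋆ y) ∘ z) = tr2 (x ∘ (z ⋆ contragredient y)).
Proof. case: s x y z => x y z; tangle_sph hsph (nth 0%R [:: x; y; z]). Qed.

Lemma tr2_coprodr (x y z : P) :
  tr2 ((x ⋆ y) ∘ z) = tr2 (y ∘ (contragredient x ⋆ z)).
Proof. case: s x y z => x y z; tangle_sph hsph (nth 0%R [:: x; y; z]). Qed.

Lemma pairing_tr2 (x y : P) :
  Defs.scalar (act (pairing_tangle (2%N, s)) (fun b : bool => if b then x else y))
  = tr2 (x ∘ y).
Proof. case: s x y => x y; tangle_sph hsph (nth 0%R [:: x; y]). Qed.

End Isotopies.

(** * Linearity and inner products *)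

Lemma dfwith_true (T : bool -> Type) (f : forall b, T b) (z : T true) :
  dfwith f true z = fun b => if b return T b then z else f false.
Proof.
by apply: functional_extensionality_dep => -[]; [rewrite dfwithin|rewrite dfwithout].
Qed.

Lemma dfwith_false (T : bool -> Type) (f : forall b, T b) (z : T false) :
  dfwith f false z = fun b => if b return T b then f true else z.
Proof.
by apply: functional_extensionality_dep => -[]; [rewrite dfwithout|rewrite dfwithin].
Qed.

Lemma dfwith_unit (T : unit -> Type) (f : forall d, T d) (z : T tt) :
  dfwith f tt z = fun d => match d return T d with tt => z end.
Proof. by apply: functional_extensionality_dep => -[]; rewrite dfwithin. Qed.

Section Linearity.
Variables (R : realType) (A : planar_star_algebra R).
Local Notation C := R[i].

Lemma act_linear_unit (col : unit -> color) c (T : tangle col c) :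
  planar T -> linear (fun z : box A (col tt) =>
    act T (fun d => match d return box A (col d) with tt => z end)).
Proof.
move=> hT a x y; have := @act_linear R A _ _ _ T (fun=> 0) tt hT a x y.
by rewrite !dfwith_unit.
Qed.

Lemma act_linear_true (col : bool -> color) c (T : tangle col c)
    (y : box A (col false)) : planar T ->
  linear (fun z : box A (col true) =>
    act T (fun b => if b return box A (col b) then z else y)).
Proof.
move=> hT a u v; have := @act_linear R A _ _ _ T
  (fun b => if b return box A (col b) then 0 else y) true hT a u v.
by rewrite !dfwith_true.
Qed.

Lemma act_linear_false (col : bool -> color) c (T : tangle col c)
    (x : box A (col true)) : planar T ->
  linear (fun z : box A (col false) =>
    act T (fun b => if b return box A (col b) then x else z)).
Proof.
move=> hT a u v; have := @act_linear R A _ _ _ T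
  (fun b => if b return box A (col b) then x else 0) false hT a u v.
by rewrite !dfwith_false.
Qed.

Lemma linear_morphisms (U V : lmodType C) (f : U -> V) : linear f ->
  [/\ {morph f : x y / x + y}, {morph f : x y / x - y},
      {morph f : x / - x}, forall a, {morph f : x / a *: x} & f 0 = 0].
Proof.
move=> hf; have f0 : f 0 = 0.
  by have := hf (-1) 0 0; rewrite scaler0 add0r scaleN1r addNr.
have fD x y : f (x + y) = f x + f y by rewrite -[x in LHS]scale1r hf scale1r.
have fZ a x : f (a *: x) = a *: f x by rewrite -[_ *: x in LHS]addr0 hf f0 addr0.
have fN x : f (- x) = - f x by rewrite -scaleN1r fZ scaleN1r.
by split=> // x y; rewrite fD fN.
Qed.

Lemma scalar_linear s : linear (@Defs.scalar R A s : _ -> C^o).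
Proof. by move=> a x y; rewrite /Defs.scalar linearP. Qed.

Lemma starD c : {morph @star R A c : x y / x + y}.
Proof.
by move=> x y; have := star_semilinear 1 x y; rewrite rmorph1 !scale1r.
Qed.

Lemma star0 c : @star R A c 0 = 0.
Proof. by apply: (addrI (star 0)); rewrite -starD !addr0. Qed.

Lemma starZ c a (x : box A c) : star (a *: x) = a^*%R *: star x.
Proof. by have := star_semilinear a x 0; rewrite star0 !addr0. Qed.

Lemma starN c : {morph @star R A c : x / - x}.
Proof. by move=> x; rewrite -scaleN1r starZ rmorphN1 scaleN1r. Qed.

Lemma starB c : {morph @star R A c : x y / x - y}.
Proof. by move=> x y; rewrite starD starN. Qed.

Definition ip c (x y : box A c) : C :=
  Defs.scalar (act (pairing_tangle c) (fun b : bool => if b then star x else y)).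

Lemma pair_planar_check c : planar_check (pair_code c) -> planar (pairing_tangle c).
Proof. exact: planarP (pair_encoding c). Qed.

(** The form is only expanded on differences, to bound it by positivity. *)
Lemma ipB c (x y : box A c) : planar_check (pair_code c) ->
  ip (x - y) (x - y) = ip x x - ip x y - ip y x + ip y y.
Proof.
move=> /pair_planar_check hp; rewrite /ip starB.
have [_ sB _ _ _] := linear_morphisms (@scalar_linear c.2).
have [_ h1 _ _ _] := linear_morphisms (act_linear_true (x - y) hp).
have [_ h2 _ _ _] := linear_morphisms (act_linear_false (star x) hp).
have [_ h3 _ _ _] := linear_morphisms (act_linear_false (star y) hp).
by rewrite /= in h1 h2 h3; rewrite h1 h2 h3 !sB opprB addrA addrAC -addrA.
Qed.

Lemma ip_ge0 c (x : box A c) : is_subfactor_planar_algebra A ->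
  planar_check (pair_code c) -> 0 <= ip x x.
Proof.
move=> [_ _ hpos] /pair_planar_check hp.
have [->|/hpos /ltW//] := eqVneq x 0.
have [_ _ _ _ s0] := linear_morphisms (@scalar_linear c.2).
have [_ _ _ _ h1] := linear_morphisms (act_linear_false (star 0 : box A c) hp).
by rewrite /= in h1; rewrite /ip h1 s0.
Qed.

End Linearity.

(** * Closed diagrams as scalars *)

Definition empty_code t := TCode (0%N, t) [::] 0 1 [:: t] [::] [:: [::]] [:: [:: 0%N]].

Lemma empty_encoding t : encoding (empty_tangle t) (empty_code t) void_key.
Proof.
apply: (@Encoding _ _ _ (empty_tangle t) (empty_code t) _
          void_key (fun _ : unit => 0%N)) => //.
- exact: listed_void.
- exact: listed_void.
- exact: listed_unit.
- by case=> [[]|] [].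
- by case=> [[]|] [[]].
Qed.

Lemma empty_planar t : planar (empty_tangle t).
Proof. by apply: (planarP (empty_encoding t)); case: t; vm_compute. Qed.

(** The closure of a 2-box, with a 0-box in the region on its left: it makes a
    product of scalars out of two closed diagrams. *)
Definition side_by_side_col t (b : bool) : color := if b then (0%N, t) else (2%N, t).

Definition side_by_side_code t :=
  TCode (0%N, t) [:: (0%N, t); (2%N, t)] 2 3 [:: t; ~~ t; t]
    (if t then [:: (0, 1); (2, 1)] else [:: (1, 0); (1, 2)])%N
    [:: [::]; [::]; [:: 0; 1; 1; 0]]%N [:: [:: 0]; [:: 0]; [:: 0; 1; 2; 1; 0]]%N.

Lemma side_by_side_exists t : exists T : tangle (side_by_side_col t) (0%N, t),
  inhabited (encoding T (side_by_side_code t) bool_key).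
Proof.
apply: (decode_tangle (k := side_by_side_code t) listed_bool_key).
  by case.
by case: t; vm_compute.
Qed.

(** The closure of a 2-box, with the region on its right at infinity: when two
    boxes side by side are closed up, the second one stands in the region on the
    right of the first one. *)
Definition right_trace_code t := TCode (0%N, t) [:: (2%N, t)] 2 3 [:: t; ~~ t; t]
    (if t then [:: (0, 1); (2, 1)] else [:: (1, 0); (1, 2)])%N
    [:: [::]; [:: 0; 1; 1; 0]]%N [:: [:: 2]; [:: 0; 1; 2; 1; 0]]%N.

Lemma right_trace_exists t : exists T : tangle (fun _ : unit => (2%N, t)) (0%N, t),
  inhabited (encoding T (right_trace_code t) (fun _ => 0%N)).
Proof.
apply: (decode_tangle (k := right_trace_code t) listed_unit).
  by case.
by case: t; vm_compute.
Qed.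

(** A string on the left of a 1-box.  Filled with a string it is the unit of the
    2-boxes, and filled with [capl_code] it is the coproduct of the unit with a
    2-box. *)
Definition add_string_code t := TCode (2%N, t) [:: (1%N, ~~ t)] 3 3 [:: t; ~~ t; t]
    (if t then [:: (0, 1); (2, 1); (2, 1)] else [:: (1, 0); (1, 2); (1, 2)])%N
    [:: [:: 0; 1; 2; 0]; [:: 1; 2]]%N [:: [:: 0; 1; 2; 1; 0]; [:: 1; 2; 1]]%N.

Lemma add_string_exists t : exists T : tangle (fun _ : unit => (1%N, ~~ t)) (2%N, t),
  inhabited (encoding T (add_string_code t) (fun _ => 0%N)).
Proof.
apply: (decode_tangle (k := add_string_code t) listed_unit).
  by case.
by case: t; vm_compute.
Qed.

Definition close1_code t := TCode (0%N, ~~ t) [:: (1%N, ~~ t)] 1 2 [:: ~~ t; t]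
    (if t then [:: (1, 0)] else [:: (0, 1)])%N
    [:: [::]; [:: 0; 0]]%N [:: [:: 0]; [:: 0; 1; 0]]%N.

Lemma close1_exists t : exists T : tangle (fun _ : unit => (1%N, ~~ t)) (0%N, ~~ t),
  inhabited (encoding T (close1_code t) (fun _ => 0%N)).
Proof.
apply: (decode_tangle (k := close1_code t) listed_unit).
  by case.
by case: t; vm_compute.
Qed.

Definition strand_code t := TCode (1%N, ~~ t) [::] 1 2 [:: ~~ t; t]
    (if t then [:: (1, 0)] else [:: (0, 1)])%N
    [:: [:: 0; 0]]%N [:: [:: 0; 1; 0]]%N.

(** A 2-box whose two left points are joined. *)
Definition capl_code t := TCode (1%N, ~~ t) [:: (2%N, t)] 3 3 [:: t; ~~ t; t]
    (if t then [:: (0, 1); (2, 1); (2, 1)] else [:: (1, 0); (1, 2); (1, 2)])%N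
    [:: [:: 1; 2]; [:: 0; 1; 2; 0]]%N [:: [:: 1; 2; 1]; [:: 0; 1; 2; 1; 0]]%N.

Section Scalars.
Variables (R : realType) (A : planar_star_algebra R).
Hypothesis hA : is_subfactor_planar_algebra A.
Local Notation C := R[i].
Local Notation "x ∘ y" := (mul2 x y) (at level 40, left associativity).

Let hsph : is_spherical A. Proof. by case: hA. Qed.

Lemma rep_empty s (env : nat -> box A (2%N, s)) t :
  rep env (empty_code t) [::] (empty_box A t).
Proof.
have h : rep env (g_code (glue_codes (empty_code t) [::] [::]))
  (g_vars (glue_codes (empty_code t) [::] [::])) (empty_box A t).
  apply: (rep_node (empty_encoding t) (v := fun d => match d with end)).
  - exact: empty_planar.
  - by case.
  - by case: s {env}; case: t; vm_compute.
by case: t h.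
Qed.

Lemma rep_strand s : exists v : box A (1%N, ~~ s),
  forall env : nat -> box A (2%N, s), rep env (strand_code s) [::] v.
Proof.
have [|v hv] := @rep_exists _ A s (fun _ => 0) (strand_code s) [::].
  by case: (s); vm_compute.
by exists v => env; apply: rep_env hv.
Qed.

Lemma rep_capl s (y : box A (2%N, s)) :
  exists v : box A (1%N, ~~ s), rep (fun _ => y) (capl_code s) [:: 0%N] v.
Proof.
apply: (@rep_exists _ A s (fun _ => y) (capl_code s) [:: 0%N]).
by case: (s); vm_compute.
Qed.

Lemma tr2_gt0 s (x : box A (2%N, s)) : x != 0 -> 0 < tr2 (star x ∘ x).
Proof. by move=> hx; case: hA => _ _ /(_ _ _ hx); rewrite pairing_tr2. Qed.

Lemma scalarZ s a (v : box A (0%N, s)) : Defs.scalar (a *: v) = a * Defs.scalar v.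
Proof. by have [_ _ _ h _] := linear_morphisms (@scalar_linear R A s); rewrite h. Qed.

Lemma tr2_linear s : linear (@tr2 R A s : _ -> C^o).
Proof.
move=> a x y; rewrite /tr2.
have -> : (fun _ : unit => x) = (fun d => match d with tt => x end).
  by apply: funext; case.
have -> : (fun _ : unit => y) = (fun d => match d with tt => y end).
  by apply: funext; case.
have -> : (fun _ : unit => a *: x + y) = (fun d => match d with tt => a *: x + y end).
  by apply: funext; case.
rewrite (act_linear_unit (col := fun _ => (2%N, s)) (trace_planar s)) /=.
exact: scalar_linear.
Qed.

Lemma mul2_linearl s (y : box A (2%N, s)) : linear (fun x => x ∘ y).
Proof.
by move=> a u v; exact: (act_linear_false (col := fun _ => (2%N, s)) y (mult_planar s)).
Qed.

Lemma mul2_linearr s (x : box A (2%N, s)) : linear (fun y => x ∘ y).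
Proof.
by move=> a u v; exact: (act_linear_true (col := fun _ => (2%N, s)) x (mult_planar s)).
Qed.

Lemma coprod_linearl s (y : box A (2%N, s)) : linear (fun x => x ⋆ y).
Proof.
by move=> a u v; exact: (act_linear_true (col := fun _ => (2%N, s)) y (coprod_planar s)).
Qed.

Lemma coprod_linearr s (x : box A (2%N, s)) : linear (fun y => x ⋆ y).
Proof.
by move=> a u v; exact: (act_linear_false (col := fun _ => (2%N, s)) x (coprod_planar s)).
Qed.

Lemma fourier_linear s : linear (@fourier R A s).
Proof.
move=> a x y; rewrite /fourier.
have e (z : box A (2%N, s)) : (fun _ : unit => z) = (fun d => match d with tt => z end).
  by apply: funext; case.
rewrite !e.
by rewrite (act_linear_unit (col := fun _ => (2%N, s)) (rotation_planar s)).
Qed.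

Section NonZero.
Variables (s : bool) (x0 : box A (2%N, s)).
Hypothesis x0_neq0 : x0 != 0.

Lemma one2_neq0 : one2 A s != 0.
Proof.
apply: contra_neq x0_neq0 => h; rewrite -(mul1_2 x0) h.
by have [_ _ _ _ ->] := linear_morphisms (mul2_linearl x0).
Qed.

Lemma tr2_one_gt0 : 0 < tr2 (one2 A s).
Proof.
by have := tr2_gt0 one2_neq0; rewrite star_one2 mul1_2.
Qed.

Let e0 (_ : nat) : box A (2%N, s) := 0.

(** The closure of the unit is unchanged by an empty diagram next to it, and its
    value is not zero. *)
Lemma empty_neq0 : empty_box A s != 0.
Proof.
have [T [enT]] := side_by_side_exists s.
have hT : planar T by apply: (planarP enT); case: (s); vm_compute.
have hE : act T (fun b => if b return box A (side_by_side_col s b)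
                          then empty_box A s else one2 A s)
          = act (trace_tangle s) (fun _ => one2 A s).
  eapply (@rep_eq _ _ _ e0).
  - eapply (rep_node enT (v := fun b => if b return box A (side_by_side_col s b)
       then empty_box A s else one2 A s) (ks := [:: empty_code s; _])
       (nss := [:: [::]; _]) hT).
      case; first exact: rep_empty.
      apply: rep_one; case: (s); vm_check.
    case: (s); vm_check.
  - eapply rep_trace; [apply: rep_one; case: (s); vm_check | case: (s); vm_check].
  - case: (s); vm_check.
apply/eqP => h0; have := tr2_one_gt0; rewrite /tr2 -hE h0.
have [_ _ _ _ h1] := linear_morphisms (act_linear_true (col := side_by_side_col s)
  (one2 A s) hT).
have [_ _ _ _ h2] := linear_morphisms (@scalar_linear R A s).
by rewrite /= in h1; rewrite h1 h2 ltxx.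
Qed.

Lemma empty_basis : basis_of fullv [tuple empty_box A s].
Proof.
rewrite basisEfree /= subvf seq1_free empty_neq0 /=.
by case: hA => h _ _; rewrite h.
Qed.

Lemma scalarE (v : box A (0%N, s)) : v = Defs.scalar v *: empty_box A s.
Proof.
have := coord_basis empty_basis (memvf v).
by rewrite big_ord1.
Qed.

(** The zero-box spaces are lines, so the value of a closed diagram with two
    components is the product of their values. *)
Lemma disjoint_closures : exists D : box A (2%N, s) -> box A (2%N, s) -> box A (0%N, s),
  (forall (env : nat -> box A (2%N, s)) k1 n1 k2 n2 x y, rep env k1 n1 x -> rep env k2 n2 y ->
    let k := g_code (glue_codes (right_trace_code s) [:: k1] [:: n1]) in
    let n := g_vars (glue_codes (right_trace_code s) [:: k1] [:: n1]) in
    node_check s (right_trace_code s) [:: k1] [:: n1] &&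
    node_check s (side_by_side_code s) [:: k; k2] [:: n; n2] ->
    rep env (g_code (glue_codes (side_by_side_code s) [:: k; k2] [:: n; n2]))
      (g_vars (glue_codes (side_by_side_code s) [:: k; k2] [:: n; n2])) (D x y)) /\
  forall x y, Defs.scalar (D x y) = tr2 x * tr2 y.
Proof.
have [T [enT]] := side_by_side_exists s.
have hT : planar T by apply: (planarP enT); case: (s); vm_compute.
have [U [enU]] := right_trace_exists s.
have hU : planar U by apply: (planarP enU); case: (s); vm_compute.
exists (fun x y => act T (fun b => if b return box A (side_by_side_col s b)
                          then act U (fun _ => x) else y)); split.
  move=> env k1 n1 k2 n2 x y h1 h2 k n /andP[c1 c2].
  have hk : rep env k n (act U (fun _ => x)).
    by apply: (rep_node enU) c1 => //; case.
  by apply: (rep_node enT) c2 => //; case.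
move=> x y; have -> : tr2 x = Defs.scalar (act U (fun _ => x)).
  eapply (@rep_scalar _ _ _ (fun _ => x)); [exact: hsph| | |].
  - eapply rep_trace; [exact: (@rep_var _ _ _ _ 0 _ (erefl _))|case: (s); vm_check].
  - eapply (rep_node enU (ks := [:: _]) (nss := [:: _]) hU).
      by case; exact: (@rep_var _ _ _ _ 0 _ (erefl _)).
    case: (s); vm_check.
  - case: (s); vm_check.
set v := act U _.
have [_ _ _ h1 _] := linear_morphisms (act_linear_true (col := side_by_side_col s) y hT).
rewrite /= in h1; rewrite {1}(scalarE v) h1 scalarZ; congr (_ * _).
eapply (@rep_scalar _ _ _ (fun _ => y)); [exact: hsph| | |].
- eapply (rep_node enT (v := fun b => if b return box A (side_by_side_col s b)
       then empty_box A s else y) (ks := [:: empty_code s; _])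
       (nss := [:: [::]; _]) hT).
    case; first exact: rep_empty.
    exact: (@rep_var _ _ _ _ 0 _ (erefl _)).
  case: (s); vm_check.
- eapply rep_trace; [exact: (@rep_var _ _ _ _ 0 _ (erefl _))|case: (s); vm_check].
- case: (s); vm_check.
Qed.

End NonZero.

Lemma loop_delta t : Defs.scalar (act (loop_tangle t) (@no_input R A t)) = delta A.
Proof.
rewrite /delta; pose e0 (_ : nat) : box A (2%N, true) := 0.
case: t => //.
by eapply (@rep_scalar _ _ _ e0); [exact: hsph | rep_tac | rep_tac | vm_check].
Qed.

End Scalars.

(** * Vectors in the 3-boxes and 4-boxes *)

(** The 3-box made of y on top of a and b side by side, with neighbouring points
    of a and b joined: the square of its norm is the value of the vector state
    given by y at the coproduct of the absolute squares of a and b. *)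
Definition schur_code t := tab_code [:: 0; 1; 2]%N (3%N, t) t 8 6
  [:: false; true; false; true; false; true; true]
  [:: (0, 1); (2, 1); (0, 3); (2, 3); (4, 3); (2, 5); (4, 5); (4, 6); (0, 6)]%N
  (fun d => match d with
     | None => [:: 0; 1; 5; 6; 7; 8]
     | Some 0 => [:: 2; 4; 7; 8]
     | Some 1 => [:: 4; 3; 5; 6]
     | _ => [:: 0; 1; 3; 2] end)%N
  (fun d => match d with
     | None => [:: 0; 1; 2; 5; 4; 6; 0]
     | Some 0 => [:: 0; 3; 4; 6; 0]
     | Some 1 => [:: 4; 3; 2; 5; 4]
     | _ => [:: 0; 1; 2; 3; 0] end)%N.

(** Two 2-boxes side by side, with no string in common. *)
Definition tensor_code t := tab_code [:: 0; 1]%N (4%N, t) t 7 6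
  [:: false; true; false; true; false; true; true]
  [:: (0, 1); (2, 1); (2, 3); (4, 3); (4, 5); (2, 5); (2, 6); (0, 6)]%N
  (fun d => match d with
     | None => [:: 0; 1; 2; 3; 4; 5; 6; 7]
     | Some 0 => [:: 0; 1; 6; 7]
     | _ => [:: 2; 3; 4; 5] end)%N
  (fun d => match d with
     | None => [:: 0; 1; 2; 3; 4; 5; 2; 6; 0]
     | Some 0 => [:: 0; 1; 2; 6; 0]
     | _ => [:: 2; 3; 4; 5; 2] end)%N.

(** Two pairs of boxes side by side, p, q on top and p', q' at the bottom, each
    pair joined by a string in the middle, and w between the two pairs.  If w is
    an inverse of p ⋆ q on its support and p', q' are p, q, this is the
    projection under p ⊗ q equivalent to the support of p ⋆ q. *)
Definition hourglass_code t := tab_code [:: 0; 1; 2; 3; 4]%N (4%N, t) t 13 9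
  [:: false; true; false; true; false; true; true; false; true; true]
  [:: (0,1); (2,1); (2,3); (4,3); (2,5); (0,5); (4,5); (0,6); (4,6); (7,6);
      (4,8); (7,8); (7,9); (0,9)]%N
  (fun d => match d with
     | None => [:: 0; 1; 2; 3; 10; 11; 12; 13]
     | Some 0 => [:: 0; 1; 4; 5]
     | Some 1 => [:: 2; 3; 6; 4]
     | Some 2 => [:: 5; 6; 8; 7]
     | Some 3 => [:: 7; 9; 12; 13]
     | _ => [:: 9; 8; 10; 11] end)%N
  (fun d => match d with
     | None => [:: 0; 1; 2; 3; 4; 8; 7; 9; 0]
     | Some 0 => [:: 0; 1; 2; 5; 0]
     | Some 1 => [:: 2; 3; 4; 5; 2]
     | Some 2 => [:: 0; 5; 4; 6; 0]
     | Some 3 => [:: 0; 6; 7; 9; 0]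
     | _ => [:: 7; 6; 4; 8; 7] end)%N.

Section Vectors.
Variables (R : realType) (A : planar_star_algebra R) (s : bool).
Local Notation P := (box A (2%N, s)).
Local Notation "x ∘ y" := (mul2 x y) (at level 40, left associativity).

Lemma schur_exists (a b y : P) : exists v : box A (3%N, s),
  rep (nth 0 [:: a; b; y]) (schur_code s) [:: 0; 1; 2]%N v.
Proof.
apply: (@rep_exists _ A s _ (schur_code s) [:: 0; 1; 2]%N).
by case: (s); vm_compute.
Qed.

Lemma tensor_exists (p q : P) : exists v : box A (4%N, s),
  rep (nth 0 [:: p; q]) (tensor_code s) [:: 0; 1]%N v.
Proof.
apply: (@rep_exists _ A s _ (tensor_code s) [:: 0; 1]%N).
by case: (s); vm_compute.
Qed.

Lemma hourglass_exists (p q w p' q' : P) : exists v : box A (4%N, s),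
  rep (nth 0 [:: p; q; w; p'; q']) (hourglass_code s) [:: 0; 1; 2; 3; 4]%N v.
Proof.
apply: (@rep_exists _ A s _ (hourglass_code s) [:: 0; 1; 2; 3; 4]%N).
by case: (s); vm_compute.
Qed.

Hypothesis hA : is_subfactor_planar_algebra A.
Let hsph : is_spherical A. Proof. by case: hA. Qed.

Lemma schur_ip (a b y : P) (v : box A (3%N, s)) :
  rep (nth 0 [:: a; b; y]) (schur_code s) [:: 0; 1; 2]%N v ->
  ip v v = tr2 (star y ∘ ((star a ∘ a) ⋆ (star b ∘ b)) ∘ y).
Proof.
case: s a b y v => a b y v hv; pose e := nth 0 [:: a; b; y; star a; star b; star y];
 have h1 := @rep_env _ _ _ (nth 0 [:: a; b; y]) e _ [:: 0; 1; 2]%N [:: 0; 1; 2]%N _ _ (erefl _) hv;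
 have h2 := @rep_star _ _ _ (nth 0 [:: a; b; y]) e _ [:: 0; 1; 2]%N [:: 3; 4; 5]%N _ _ hv erefl;
 rewrite /ip; (eapply (@rep_scalar _ _ _ e); [exact: hsph | | |]).
- eapply rep_pairing; [apply: h2; vm_check | exact: h1 | vm_check].
- rewrite /e; rep_tac.
- vm_check.
- eapply rep_pairing; [apply: h2; vm_check | exact: h1 | vm_check].
- rewrite /e; rep_tac.
- vm_check.
Qed.

Lemma tensor_ip (p q : P) (v : box A (4%N, s)) : p != 0 ->
  rep (nth 0 [:: p; q]) (tensor_code s) [:: 0; 1]%N v ->
  ip v v = tr2 (star p ∘ p) * tr2 (star q ∘ q).
Proof.
move=> p0; have [D [hD <-]] := disjoint_closures hA p0.
case: s p q p0 v D hD => p q p0 v D hD hv;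
 pose e := nth 0 [:: p; q; star p; star q];
 have h1 := @rep_env _ _ _ (nth 0 [:: p; q]) e _ [:: 0; 1]%N [:: 0; 1]%N _ _
   (erefl _) hv;
 have h2 := @rep_star _ _ _ (nth 0 [:: p; q]) e _ [:: 0; 1]%N [:: 2; 3]%N _ _ hv erefl;
 rewrite /ip; (eapply (@rep_scalar _ _ _ e); [exact: hsph | | |]).
- eapply rep_pairing; [apply: h2; vm_check | exact: h1 | vm_check].
- apply: hD; [rewrite /e; rep_tac | rewrite /e; rep_tac | vm_check].
- vm_check.
- eapply rep_pairing; [apply: h2; vm_check | exact: h1 | vm_check].
- apply: hD; [rewrite /e; rep_tac | rewrite /e; rep_tac | vm_check].
- vm_check.
Qed.

Lemma hourglass_ip (p q w p' q' : P) (v : box A (4%N, s)) :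
  rep (nth 0 [:: p; q; w; p'; q']) (hourglass_code s) [:: 0; 1; 2; 3; 4]%N v ->
  ip v v = tr2 (star w ∘ ((star p' ∘ p') ⋆ (star q' ∘ q')) ∘ w ∘
                ((p ∘ star p) ⋆ (q ∘ star q))).
Proof.
case: s p q w p' q' v => p q w p' q' v hv;
 pose e := nth 0 [:: p; q; w; p'; q'; star p; star q; star w; star p'; star q'];
 have h1 := @rep_env _ _ _ (nth 0 [:: p; q; w; p'; q']) e _ [:: 0; 1; 2; 3; 4]%N
   [:: 0; 1; 2; 3; 4]%N _ _ (erefl _) hv;
 have h2 := @rep_star _ _ _ (nth 0 [:: p; q; w; p'; q']) e _ [:: 0; 1; 2; 3; 4]%N
   [:: 5; 6; 7; 8; 9]%N _ _ hv erefl;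
 rewrite /ip; (eapply (@rep_scalar _ _ _ e); [exact: hsph | | |]).
- eapply rep_pairing; [apply: h2; vm_check | exact: h1 | vm_check].
- rewrite /e; rep_tac.
- vm_check.
- eapply rep_pairing; [apply: h2; vm_check | exact: h1 | vm_check].
- rewrite /e; rep_tac.
- vm_check.
Qed.

Lemma tensor_hourglass_ip (p0 q0 p q w p' q' : P) (u v : box A (4%N, s)) :
  rep (nth 0 [:: p0; q0]) (tensor_code s) [:: 0; 1]%N u ->
  rep (nth 0 [:: p; q; w; p'; q']) (hourglass_code s) [:: 0; 1; 2; 3; 4]%N v ->
  ip u v = tr2 (w ∘ ((p ∘ star p0 ∘ p') ⋆ (q ∘ star q0 ∘ q'))).
Proof.
case: s p0 q0 p q w p' q' u v => p0 q0 p q w p' q' u v hu hv;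
 pose e := nth 0 [:: p; q; w; p'; q'; star p0; star q0];
 have h1 := @rep_env _ _ _ (nth 0 [:: p; q; w; p'; q']) e _ [:: 0; 1; 2; 3; 4]%N
   [:: 0; 1; 2; 3; 4]%N _ _ (erefl _) hv;
 have h2 := @rep_star _ _ _ (nth 0 [:: p0; q0]) e _ [:: 0; 1]%N
   [:: 5; 6]%N _ _ hu erefl;
 rewrite /ip; (eapply (@rep_scalar _ _ _ e); [exact: hsph | | |]).
- eapply rep_pairing; [apply: h2; vm_check | exact: h1 | vm_check].
- rewrite /e; rep_tac.
- vm_check.
- eapply rep_pairing; [apply: h2; vm_check | exact: h1 | vm_check].
- rewrite /e; rep_tac.
- vm_check.
Qed.

Lemma hourglass_tensor_ip (p0 q0 p q w p' q' : P) (u v : box A (4%N, s)) :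
  rep (nth 0 [:: p0; q0]) (tensor_code s) [:: 0; 1]%N u ->
  rep (nth 0 [:: p; q; w; p'; q']) (hourglass_code s) [:: 0; 1; 2; 3; 4]%N v ->
  ip v u = tr2 (star w ∘ ((star p' ∘ p0 ∘ star p) ⋆ (star q' ∘ q0 ∘ star q))).
Proof.
case: s p0 q0 p q w p' q' u v => p0 q0 p q w p' q' u v hu hv;
 pose e := nth 0 [:: p0; q0; star p; star q; star w; star p'; star q'];
 have h1 := @rep_env _ _ _ (nth 0 [:: p0; q0]) e _ [:: 0; 1]%N
   [:: 0; 1]%N _ _ (erefl _) hu;
 have h2 := @rep_star _ _ _ (nth 0 [:: p; q; w; p'; q']) e _ [:: 0; 1; 2; 3; 4]%N
   [:: 2; 3; 4; 5; 6]%N _ _ hv erefl;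
 rewrite /ip; (eapply (@rep_scalar _ _ _ e); [exact: hsph | | |]).
- eapply rep_pairing; [apply: h2; vm_check | exact: h1 | vm_check].
- rewrite /e; rep_tac.
- vm_check.
- eapply rep_pairing; [apply: h2; vm_check | exact: h1 | vm_check].
- rewrite /e; rep_tac.
- vm_check.
Qed.

Hypothesis hirr : is_irreducible A.
Variable x0 : P.
Hypothesis x0_neq0 : x0 != 0.
Let e0 (_ : nat) : P := 0.

(** The space of 1-boxes is a line spanned by a string, which has norm δ.  So the
    2-box y capped on its left is a multiple of the string, and closing both
    shows that the factor is tr(y) / δ. *)
Lemma delta_and_unit : 0 < delta A /\
  forall y : P, one2 A s ⋆ y = (tr2 y / delta A) *: one2 A s.
Proof.
have [T [enT]] := add_string_exists s.
have hT : planar T by apply: (planarP enT); case: (s); vm_compute.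
have [U [enU]] := close1_exists s.
have hU : planar U by apply: (planarP enU); case: (s); vm_compute.
have [st hst] := rep_strand A s.
have oneE : act T (fun d => match d return box A (1%N, ~~ s) with tt => st end)
    = one2 A s.
  eapply (@rep_eq _ _ _ e0).
  - eapply (rep_node enT (ks := [:: _]) (nss := [:: _]) hT).
      by case; exact: hst.
    case: (s); vm_check.
  - apply: rep_one; case: (s); vm_check.
  - case: (s); vm_check.
have [_ _ _ TZ T0] := linear_morphisms (@act_linear_unit R A (fun _ => (1%N, ~~ s)) _ _ hT).
have [_ _ _ UZ U0] := linear_morphisms (@act_linear_unit R A (fun _ => (1%N, ~~ s)) _ _ hU).
rewrite /= in TZ T0 UZ U0.
(* a zero string would make the unit of the 2-boxes vanish *)
have st0 : st != 0.
  by apply: contra_neq (one2_neq0 x0_neq0) => h; rewrite -oneE h T0.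
(* the square of the norm of a string is a closed loop *)
have dgt : 0 < delta A.
  case: (hA) => _ _ /(_ _ _ st0).
  congr (0 < _); rewrite -(loop_delta hA s).
  have hs := rep_star_same (env' := e0) (hst e0).
  eapply (@rep_scalar _ _ _ e0); [exact: hsph | | |].
  - eapply rep_pairing; [apply: hs => // | exact: hst | ]; case: (s); vm_check.
  - apply: rep_loop; case: (s); vm_check.
  - case: (s); vm_check.
split=> // y.
have [v hv] := rep_capl y.
(* the only use of irreducibility *)
have [l hl] : exists l, v = l *: st.
  exists (coord [tuple st] ord0 v).
  have hb : basis_of fullv [tuple st].
    by rewrite basisEfree /= subvf seq1_free st0 /= hirr.
  by have := coord_basis hb (memvf v); rewrite big_ord1.
have tr_v : tr2 y = l * delta A.
  rewrite -(loop_delta hA (~~ s)).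
  have -> : act (loop_tangle (~~ s)) (@no_input _ A (~~ s)) =
      act U (fun d => match d return box A (1%N, ~~ s) with tt => st end).
    eapply (@rep_eq _ _ _ e0).
    - apply: rep_loop; case: (s); vm_check.
    - eapply (rep_node enU (ks := [:: _]) (nss := [:: _]) hU).
        by case; exact: hst.
      case: (s); vm_check.
    - case: (s); vm_check.
  rewrite -scalarZ -UZ -hl.
  eapply (@rep_scalar _ _ _ (fun _ => y)); [exact: hsph | | |].
  - eapply rep_trace; [exact: (@rep_var _ _ _ _ 0 _ (erefl _))|case: (s); vm_check].
  - eapply (rep_node enU (ks := [:: _]) (nss := [:: _]) hU).
      by case; exact: hv.
    case: (s); vm_check.
  - case: (s); vm_check.
have -> : one2 A s ⋆ y = act T (fun d => match d return box A (1%N, ~~ s) with tt => v end).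
  eapply (@rep_eq _ _ _ (fun _ => y)).
  - eapply rep_coprod.
    + apply: rep_one; case: (s); vm_check.
    + exact: (@rep_var _ _ _ _ 0 _ (erefl _)).
    + case: (s); vm_check.
  - eapply (rep_node enT (ks := [:: _]) (nss := [:: _]) hT).
      by case; exact: hv.
    case: (s); vm_check.
  - case: (s); vm_check.
by rewrite hl TZ oneE tr_v mulfK // gt_eqF.
Qed.

End Vectors.

(** * Spectral theory of the 2-boxes *)

(** An eigenvector of the matrix of the restricted map in a basis of W. *)
Lemma invariant_eigenvector (C : numClosedFieldType) (V : vectType C)
    (g : {linear V -> V}) (W : {vspace V}) :
  W != 0%VS -> (forall y, y \in W -> g y \in W) ->
  exists a y, [/\ y \in W, y != 0 & g y = a *: y].
Proof.
move=> W0 gW; pose b := vbasis W; pose n := \dim W.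
have n0 : (0 < n)%N by rewrite lt0n dimv_eq0.
have hb : basis_of W b := vbasisP W.
have bW i : b`_i \in W.
  have [hi|hi] := ltnP i n; last by rewrite nth_default ?mem0v // size_tuple.
  by apply: vbasis_mem; apply: mem_nth; rewrite size_tuple.
pose M : 'M[C]_n := \matrix_(i, j) coord b j (g b`_i).
have [a /eigenvalueP[v hv v0]] := eigenvalue_closed M n0.
pose y := \sum_i v 0 i *: b`_i.
exists a, y; split.
- by apply: memv_suml => i _; rewrite memvZ.
- apply: contraNneq v0 => y0; apply/eqP/rowP => i; rewrite mxE.
  have fb : free b by exact: basis_free hb.
  by have := coord_sum_free (fun i => v 0 i) i fb; rewrite -/y y0 linear0.
- rewrite {1}/y linear_sum /=.
  under eq_bigr => i _ do rewrite linearZ /= (coord_basis hb (gW _ (bW i))) scaler_sumr.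
  rewrite exchange_big /= scaler_sumr; apply: eq_bigr => j _.
  have := congr1 (fun m : 'rV_n => m 0 j) hv; rewrite !mxE => h.
  rewrite scalerA -h scaler_suml; apply: eq_bigr => i _.
  by rewrite scalerA mxE.
Qed.

Section CStar.
Variables (R : realType) (A : planar_star_algebra R).
Hypothesis hA : is_subfactor_planar_algebra A.
Variable s : bool.
Local Notation C := R[i].
Local Notation P := (box A (2%N, s)).
Local Notation "x ∘ y" := (mul2 x y) (at level 40, left associativity).
Local Notation one := (one2 A s).
Implicit Types (x y z e f p q r h : P).

Let hsph : is_spherical A. Proof. by case: hA. Qed.

Lemma mul2Dl x y z : (x + y) ∘ z = x ∘ z + y ∘ z.
Proof. by have [h _ _ _ _] := linear_morphisms (mul2_linearl z); exact: h. Qed.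
Lemma mul2Dr x y z : z ∘ (x + y) = z ∘ x + z ∘ y.
Proof. by have [h _ _ _ _] := linear_morphisms (mul2_linearr z); exact: h. Qed.
Lemma mul2Bl x y z : (x - y) ∘ z = x ∘ z - y ∘ z.
Proof. by have [_ h _ _ _] := linear_morphisms (mul2_linearl z); exact: h. Qed.
Lemma mul2Br x y z : z ∘ (x - y) = z ∘ x - z ∘ y.
Proof. by have [_ h _ _ _] := linear_morphisms (mul2_linearr z); exact: h. Qed.
Lemma mul2Zl a x y : (a *: x) ∘ y = a *: (x ∘ y).
Proof. by have [_ _ _ h _] := linear_morphisms (mul2_linearl y); exact: h. Qed.
Lemma mul2Zr a x y : y ∘ (a *: x) = a *: (y ∘ x).
Proof. by have [_ _ _ h _] := linear_morphisms (mul2_linearr y); exact: h. Qed.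
Lemma mul20 x : x ∘ 0 = 0.
Proof. by have [_ _ _ _ h] := linear_morphisms (mul2_linearr x); exact: h. Qed.
Lemma mul02 x : 0 ∘ x = 0.
Proof. by have [_ _ _ _ h] := linear_morphisms (mul2_linearl x); exact: h. Qed.
Lemma mul2_suml n (F : 'I_n -> P) y : (\sum_i F i) ∘ y = \sum_i F i ∘ y.
Proof.
by apply: (big_morph (fun x => x ∘ y)); [move=> u v; exact: mul2Dl|exact: mul02].
Qed.
Lemma mul2_sumr n (F : 'I_n -> P) y : y ∘ (\sum_i F i) = \sum_i y ∘ F i.
Proof.
by apply: (big_morph (fun x => y ∘ x)); [move=> u v; exact: mul2Dr|exact: mul20].
Qed.

Lemma tr2D x y : tr2 (x + y) = tr2 x + tr2 y.
Proof. by have [h _ _ _ _] := linear_morphisms (@tr2_linear _ A s); exact: h. Qed.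
Lemma tr2B x y : tr2 (x - y) = tr2 x - tr2 y.
Proof. by have [_ h _ _ _] := linear_morphisms (@tr2_linear _ A s); exact: h. Qed.
Lemma tr2Z a x : tr2 (a *: x) = a * tr2 x.
Proof. by have [_ _ _ h _] := linear_morphisms (@tr2_linear _ A s); exact: h. Qed.
Lemma tr20 : tr2 (0 : P) = 0.
Proof. by have [_ _ _ _ h] := linear_morphisms (@tr2_linear _ A s); exact: h. Qed.
Lemma tr2_sum n (F : 'I_n -> P) : tr2 (\sum_i F i) = \sum_i tr2 (F i).
Proof. by apply: (big_morph (@tr2 _ A s)); [exact: tr2D | exact: tr20]. Qed.

Lemma tr2_ge0 x : 0 <= tr2 (star x ∘ x).
Proof.
have [->|h] := eqVneq x 0; first by rewrite mul20 tr20.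
exact/ltW/tr2_gt0.
Qed.

Lemma tr2_eq0 x : tr2 (star x ∘ x) = 0 -> x = 0.
Proof.
by have [//|h] := eqVneq x 0; have /gt_eqF/eqP := tr2_gt0 hA h.
Qed.

Lemma orthogonal_projection_seq (X : seq P) y : exists2 w, w \in <<X>>%VS &
  forall u, u \in X -> tr2 (star u ∘ (y - w)) = 0.
Proof.
elim: X y => [|x X IH] y; first by exists 0; rewrite ?mem0v.
have [x1 x1X hx1] := IH x; have [y1 y1X hy1] := IH y.
(* a Gram-Schmidt step: x' is orthogonal to the span of X *)
pose x' := x - x1.
have span_orth w v : w \in <<X>>%VS ->
    (forall u, u \in X -> tr2 (star u ∘ v) = 0) -> tr2 (star w ∘ v) = 0.
  move=> hw hv; rewrite (@coord_span _ _ _ (in_tuple X) w hw); elim/big_rec: _ => [|i v' _ IHv].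
    by rewrite star0 mul02 tr20.
  rewrite starD starZ mul2Dl mul2Zl tr2D tr2Z IHv addr0 hv ?mulr0 //.
  exact: mem_nth.
have hx' w : w \in <<X>>%VS -> tr2 (star w ∘ x') = 0.
  by move=> hw; exact: span_orth.
have sub w : w \in <<X>>%VS -> w \in <<x :: X>>%VS.
  by move=> hw; rewrite span_cons; apply: (subvP (addvSr _ _)).
have hxX : x \in <<x :: X>>%VS by rewrite memv_span // mem_head.
have [x'0|x'0] := eqVneq x' 0.
  exists y1; first exact: sub.
  move=> u; rewrite inE => /orP[/eqP->|]; last exact: hy1.
  have -> : x = x1 by apply/eqP; rewrite -subr_eq0 -/x' x'0.
  exact: span_orth.
pose a := tr2 (star x' ∘ (y - y1)) / tr2 (star x' ∘ x').
exists (y1 + a *: x').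
  by apply: memvD; [exact: sub | apply: memvZ; apply: memvB => //; exact: sub].
have hX u : u \in X -> tr2 (star u ∘ (y - (y1 + a *: x'))) = 0.
  move=> hu; rewrite opprD addrA mul2Br tr2B hy1 // mul2Zr tr2Z hx' ?mulr0 ?subr0 //.
  exact: memv_span.
move=> u; rewrite inE => /orP[/eqP->|]; last exact: hX.
have -> : x = x' + x1 by rewrite subrK.
rewrite starD mul2Dl tr2D [X in _ + X](span_orth x1) // addr0.
rewrite opprD addrA mul2Br tr2B mul2Zr tr2Z divfK ?subrr //.
by rewrite gt_eqF // tr2_gt0.
Qed.

Lemma orthogonal_projection (W : {vspace P}) y : exists2 w, w \in W &
  forall u, u \in W -> tr2 (star u ∘ (y - w)) = 0.
Proof.
have [w hw h] := orthogonal_projection_seq (vbasis W) y.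
exists w; first by rewrite -(span_basis (vbasisP W)).
move=> u hu; rewrite (coord_vbasis hu); elim/big_rec: _ => [|i v' _ IHv].
  by rewrite star0 mul02 tr20.
rewrite starD starZ mul2Dl mul2Zl tr2D tr2Z IHv addr0 h ?mulr0 //.
by apply: mem_nth; rewrite size_tuple.
Qed.

(** The projection is the orthogonal projection e of 1 on W.  As W is a right
    ideal, orthogonality to W reads y^* (1 - e) = 0 for y in W, by
    faithfulness of the trace. *)
Lemma right_ideal_projection (W : {vspace P}) :
  (forall y z, y \in W -> y ∘ z \in W) ->
  exists e, [/\ is_proj e, e \in W & forall y, y \in W -> e ∘ y = y].
Proof.
move=> hW; have [e eW he] := orthogonal_projection W one.
have h1 y : y \in W -> star y = star y ∘ e.
  move=> hy; pose z := star y ∘ (one - e).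
  have : tr2 (star z ∘ z) = 0.
    by have := he _ (hW y z hy); rewrite star_mul2 -mul2A.
  by move/tr2_eq0; rewrite /z mul2Br mul2_1 => /subr0_eq.
have h2 y : y \in W -> y = star e ∘ y.
  by move=> hy; rewrite -[LHS]starK (h1 y hy) star_mul2 starK.
have es : star e = e by rewrite {2}(h2 e eW) [LHS](h1 e eW).
by exists e; split=> // [|y hy]; [split=> //; rewrite [RHS](h2 e eW) es|
  rewrite [RHS](h2 y hy) es].
Qed.

Definition mulL x : P -> P := fun y => x ∘ y.
HB.instance Definition _ x := GRing.isLinear.Build C P P _ (mulL x)
  (mul2_linearr x).

Lemma right_ideal_mul x : exists e, [/\ is_proj e, e ∘ x = x &
  exists z, e = x ∘ z].
Proof.
have [|e [he eW h]] := @right_ideal_projection (limg (linfun (mulL x))).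
  move=> _ z /memv_imgP[y _ ->]; rewrite lfunE /= /mulL -mul2A.
  have -> : x ∘ (y ∘ z) = linfun (mulL x) (y ∘ z) by rewrite lfunE.
  by rewrite memv_img ?memvf.
exists e; split=> //.
- have -> : x = linfun (mulL x) one by rewrite lfunE /= /mulL mul2_1.
  by rewrite h // memv_img ?memvf.
- by case/memv_imgP: eW => z _ ->; exists z; rewrite lfunE.
Qed.

Lemma proj_compl e f : is_proj e -> is_proj f -> e ∘ f = e ->
  is_proj (f - e) /\ f ∘ e = e.
Proof.
move=> [es ee] [fs ff] ef.
have fe : f ∘ e = e by rewrite -[e]es -[f]fs -star_mul2 ef.
split=> //; split; first by rewrite starB fs es.
by rewrite mul2Bl !mul2Br ff ef fe ee subrr subr0.
Qed.

Definition spectral_dec f h (n : nat) (l : nat -> C) (e : nat -> P) : Prop :=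
  [/\ forall i, (i < n)%N -> is_proj (e i) /\ (l i)^*%R = l i,
      forall i j, (i < n)%N -> (j < n)%N -> i != j -> e i ∘ e j = 0,
      \sum_(i < n) e i = f &
      forall i, (i < n)%N -> h ∘ e i = l i *: e i].

(** Left multiplication by h has an eigenvector under f; the eigenvectors with
    the same eigenvalue form a right ideal, hence a projection e, which commutes
    with h because h is self-adjoint.  The induction goes on under f - e. *)
Lemma spectral_rec m f h : star h = h -> is_proj f -> f ∘ h = h ∘ f ->
  (\dim (limg (linfun (mulL f))) <= m)%N ->
  exists n l u, spectral_dec f h n l u.
Proof.
move=> hs; elim: m f => [|m IH] f fp fh hm.
  exists 0%N, (fun=> 0), (fun=> 0); split=> //; rewrite big_ord0.
  move: hm; rewrite leqn0 dimv_eq0 => /eqP h0.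
  have : linfun (mulL f) one \in limg (linfun (mulL f)) by rewrite memv_img ?memvf.
  by rewrite h0 memv0 lfunE /= /mulL mul2_1 => /eqP ->.
pose W := limg (linfun (mulL f)); rewrite -/W in hm.
have inW y : (y \in W) = (f ∘ y == y).
  apply/idP/eqP => [/memv_imgP[z _ ->]|hy].
    by rewrite lfunE /= /mulL mul2A fp.2.
  by apply/memv_imgP; exists y; rewrite ?memvf // lfunE /= /mulL hy.
(* the dimension is only bounded by m + 1, so the ideal may still be zero *)
have [W0|W0] := eqVneq W 0%VS.
  by apply: IH => //; rewrite -/W W0 dimv0.
have [|a [y [yW y0 hy]]] := invariant_eigenvector (g := mulL h) W0.
  by move=> y; rewrite !inW /mulL mul2A fh -mul2A => /eqP->.
(* the eigenvectors of eigenvalue a under f, a right ideal *)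
pose V := (W :&: lker (linfun (mulL h) - a *: \1)%VF)%VS.
have inV z : (z \in V) = (f ∘ z == z) && (h ∘ z == a *: z).
  by rewrite memv_cap inW memv_ker add_lfunE opp_lfunE scale_lfunE id_lfunE
             lfunE subr_eq0.
have [|e [ep eV he]] := @right_ideal_projection V.
  by move=> u v; rewrite !inV !mul2A => /andP[/eqP-> /eqP->]; rewrite mul2Zl !eqxx.
have e0 : e != 0.
  apply: contra_neq y0 => e0; rewrite -(he y) ?e0 ?mul02 //.
  by rewrite inV -inW yW /=; apply/eqP.
move: eV; rewrite inV => /andP[/eqP fe /eqP hea].
have ef : e ∘ f = e by rewrite -[e in RHS]ep.1 -[in RHS]fe star_mul2 ep.1 fp.1.
have eh : e ∘ h = a^*%R *: e.
  by rewrite -[LHS]starK star_mul2 ep.1 hs hea starZ ep.1.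
have areal : a^*%R = a.
  have h1 : e ∘ h ∘ e = a^*%R *: e by rewrite eh mul2Zl ep.2.
  have h2 : e ∘ h ∘ e = a *: e by rewrite -mul2A hea mul2Zr ep.2.
  have /eqP := congr1 (fun x => x - a *: e) h1; rewrite h2 subrr -scalerBl.
  by rewrite eq_sym scaler_eq0 (negbTE e0) orbF subr_eq0 => /eqP.
have [fep _] := proj_compl ep fp ef.
have [n [l [u [hu1 hu2 hu3 hu4]]]] : exists n l u, spectral_dec (f - e) h n l u.
  apply: IH => //.
    by rewrite mul2Bl mul2Br fh eh hea areal.
  rewrite -ltnS; apply: leq_trans hm.
  set W' := limg _.
  have sW : (W' <= W)%VS.
    apply/subvP => _ /memv_imgP[z _ ->].
    by rewrite inW lfunE /= /mulL mul2A mul2Br fp.2 fe.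
  have hlt := dimv_leqif_sup sW.
  rewrite ltn_neqAle (dimvS sW) andbT hlt.2; apply: contra e0 => /subvP/(_ e).
  rewrite inW fe eqxx => /(_ isT) /memv_imgP[z _]; rewrite lfunE /= /mulL => ez.
  rewrite -[e]ep.2 {2}ez mul2A mul2Br ef ep.2 subrr mul02.
  exact: eqxx.
exists n.+1, (fun i => if i is i'.+1 then l i' else a),
  (fun i => if i is i'.+1 then u i' else e).
have absorb i : (i < n)%N -> (f - e) ∘ u i = u i.
  move=> hi; rewrite -hu3 mul2_suml (bigD1 (Ordinal hi)) //= (hu1 i hi).1.2.
  rewrite big1 ?addr0 // => j hj; apply: hu2 => //.
have eu i : (i < n)%N -> e ∘ u i = 0.
  by move=> hi; rewrite -absorb // mul2A mul2Br ef ep.2 subrr mul02.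
split.
- by case=> [|i] //; exact: hu1.
- move=> [|i] [|j] //= hi hj ij; [exact: eu| |exact: hu2].
  by rewrite -[LHS]starK star_mul2 ep.1 (hu1 i hi).1.1 eu ?star0.
- by rewrite big_ord_recl /= hu3 addrC subrK.
- by case=> [|i] //; exact: hu4.
Qed.

Lemma spectral_theorem h : star h = h -> exists n (l : 'I_n -> C) (e : 'I_n -> P),
  [/\ forall i, is_proj (e i), forall i j, i != j -> e i ∘ e j = 0,
      \sum_i e i = one, h = \sum_i l i *: e i & forall i, (l i)^*%R = l i].
Proof.
move=> hs; have p1 : is_proj one by split; rewrite ?star_one2 ?mul1_2.
have [|n [l [e [h1 h2 h3 h4]]]] := spectral_rec hs p1 _ (leqnn _).
  by rewrite mul1_2 mul2_1.
exists n, (fun i => l i), (fun i => e i); split=> //.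
- by move=> i; case: (h1 i (ltn_ord i)).
- by move=> i j ij; exact: h2.
- rewrite -[LHS]mul2_1 -h3 mul2_sumr; apply: eq_bigr => i _.
  exact: h4.
- by move=> i; case: (h1 i (ltn_ord i)).
Qed.

End CStar.

(** * Positive elements and range projections *)

Section Positivity.
Variables (R : realType) (A : planar_star_algebra R).
Hypothesis hA : is_subfactor_planar_algebra A.
Variable s : bool.
Local Notation C := R[i].
Local Notation P := (box A (2%N, s)).
Local Notation "x ∘ y" := (mul2 x y) (at level 40, left associativity).
Local Notation one := (one2 A s).
Implicit Types (x y z e f p q r h : P).

Let hsph : is_spherical A. Proof. by case: hA. Qed.

Lemma mul2_orthogonal n (e : 'I_n -> P) (a b : 'I_n -> C) : (forall i, is_proj (e i)) ->
  (forall i j, i != j -> e i ∘ e j = 0) ->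
  (\sum_i a i *: e i) ∘ (\sum_i b i *: e i) = \sum_i (a i * b i) *: e i.
Proof.
move=> e1 e2; rewrite mul2_suml; apply: eq_bigr => i _.
rewrite mul2_sumr (bigD1 i) //= mul2Zl mul2Zr (e1 i).2 scalerA.
rewrite big1 ?addr0 // => j ji.
by rewrite mul2Zl mul2Zr e2 ?scaler0 // eq_sym.
Qed.

(** This turns the algebraic definition of positivity into a condition that is
    clearly additive; a self-adjoint element of nonnegative spectrum has a square
    root. *)
Lemma posP h : is_positive h <->
  star h = h /\ forall y, 0 <= tr2 (star y ∘ h ∘ y).
Proof.
split=> [[z ->]|[hs hpos]].
  split=> [|y]; first by rewrite star_mul2 starK.
  by have := tr2_ge0 hA (z ∘ y); rewrite star_mul2 !mul2A.
have [n [l [e [e1 e2 e3 e4 e5]]]] := spectral_theorem hA hs.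
(* the eigenvalue of a zero projection is arbitrary, and may be negative *)
pose c i := if e i == 0 then 0 else sqrtC (l i).
have l0 i : e i != 0 -> 0 <= l i.
  move=> ei; have := hpos (e i); rewrite e4 (e1 i).1.
  have -> : e i ∘ (\sum_j l j *: e j) ∘ e i = l i *: e i.
    rewrite mul2_sumr mul2_suml (bigD1 i) //= mul2Zr mul2Zl !(e1 i).2.
    rewrite big1 ?addr0 // => j ji.
    by rewrite mul2Zr e2 1?eq_sym // scaler0 mul02.
  rewrite tr2Z pmulr_lge0 // -{1}(e1 i).2 -{1}(e1 i).1; exact: tr2_gt0.
exists (\sum_i c i *: e i).
have -> : star (\sum_i c i *: e i) = \sum_i c i *: e i.
  rewrite (big_morph _ (@starD _ A _) (star0 A _)); apply: eq_bigr => i _.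
  rewrite starZ (e1 i).1 /c; case: eqVneq => [->|ei]; first by rewrite !scaler0.
  by congr (_ *: _); apply/CrealP/ger0_real; rewrite sqrtC_ge0 l0.
rewrite mul2_orthogonal // e4; apply: eq_bigr => i _; rewrite /c.
by case: eqVneq => [->|ei]; rewrite ?scaler0 // -expr2 sqrtCK.
Qed.

Lemma pos_star h : is_positive h -> star h = h.
Proof. by case/posP. Qed.

Lemma pos_add x y : is_positive x -> is_positive y -> is_positive (x + y).
Proof.
move=> /posP[xs hx] /posP[ys hy]; apply/posP; split=> [|z].
  by rewrite starD xs ys.
by rewrite mul2Dr mul2Dl tr2D addr_ge0.
Qed.

Lemma pos_scale a x : 0 <= a -> is_positive x -> is_positive (a *: x).
Proof.
move=> a0 /posP[xs hx]; apply/posP; split=> [|z].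
  by rewrite starZ xs; congr (_ *: _); apply/CrealP/ger0_real.
by rewrite mul2Zr mul2Zl tr2Z mulr_ge0.
Qed.

Lemma pos_proj p : is_proj p -> is_positive p.
Proof. by case=> ps pp; exists p; rewrite ps pp. Qed.

Lemma pos0 : is_positive (0 : P).
Proof. by exists 0; rewrite mul20. Qed.

Lemma proj_one : is_proj one.
Proof. by split; rewrite ?star_one2 ?mul1_2. Qed.

Lemma pos_conj x y : is_positive x -> is_positive (star y ∘ x ∘ y).
Proof. by case=> z ->; exists (z ∘ y); rewrite star_mul2 !mul2A. Qed.

Lemma pos_tr_mul x y : is_positive x -> is_positive y -> 0 <= tr2 (x ∘ y).
Proof.
case=> z -> /posP[_ h]; have := h (star z).
by rewrite starK tr2C // !mul2A tr2C // mul2A.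
Qed.

Lemma pos_tr x : is_positive x -> 0 <= tr2 x.
Proof. by case=> z ->; exact: tr2_ge0. Qed.

Lemma pos_tr_eq0 x : is_positive x -> tr2 x = 0 -> x = 0.
Proof. by case=> z -> /(tr2_eq0 hA) ->; rewrite mul20. Qed.

Lemma pos_tr_gt0 x : is_positive x -> x != 0 -> 0 < tr2 x.
Proof.
move=> px x0; rewrite lt_def pos_tr // andbT; apply: contra_neq x0.
exact: pos_tr_eq0.
Qed.

(** For x = a^* a and y = b^* b, the trace of the product is the square of the
    norm of a b^* . *)
Lemma pos_mul_eq0 x y : is_positive x -> is_positive y -> tr2 (x ∘ y) = 0 ->
  x ∘ y = 0.
Proof.
move=> [a ->] [b ->] h; have : a ∘ star b = 0.
  apply: (tr2_eq0 hA); rewrite star_mul2 starK -h.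
  by rewrite !mul2A tr2C // !mul2A tr2C // !mul2A tr2C // !mul2A.
by move=> h0; rewrite mul2A -[star a ∘ a ∘ _]mul2A h0 mul20 mul02.
Qed.

(** The two conditions on the trace say that p (k - c) and (1 - p) c have trace
    zero; these are products of positive elements, so they vanish. *)
Lemma proj_rigid p c (k : C) : is_proj p -> is_positive c ->
  is_positive (k *: one - c) -> tr2 c = k * tr2 p -> tr2 (p ∘ c) = k * tr2 p ->
  c = k *: p.
Proof.
move=> pp pc pkc hc hpc.
have h1 : p ∘ (k *: one - c) = 0.
  apply: pos_mul_eq0 => //; first exact: pos_proj.
  by rewrite mul2Br mul2Zr mul2_1 tr2B tr2Z hpc subrr.
have [pp' _] : is_proj (one - p) /\ one ∘ p = p.
  by apply: (proj_compl pp proj_one); rewrite mul2_1.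
have h2 : (one - p) ∘ c = 0.
  apply: pos_mul_eq0 => //; first exact: pos_proj.
  by rewrite mul2Bl mul1_2 tr2B hc hpc subrr.
move: h1 h2; rewrite mul2Br mul2Zr mul2_1 mul2Bl mul1_2.
by move=> /subr0_eq -> /subr0_eq.
Qed.

(** Likewise, a (1 - b) and b (1 - a) vanish, so a = a b = b a = b. *)
Lemma pos_rigid a b : is_positive a -> is_positive b ->
  is_positive (one - a) -> is_positive (one - b) ->
  tr2 a = tr2 (a ∘ b) -> tr2 b = tr2 (a ∘ b) -> a = b /\ is_proj b.
Proof.
move=> pa pb pa' pb' ha hb.
have h1 : a ∘ (one - b) = 0.
  by apply: pos_mul_eq0 => //; rewrite mul2Br mul2_1 tr2B -ha subrr.
have h2 : b ∘ (one - a) = 0.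
  by apply: pos_mul_eq0 => //; rewrite mul2Br mul2_1 tr2B tr2C // -hb subrr.
move: h1 h2; rewrite !mul2Br !mul2_1 => /subr0_eq h1 /subr0_eq h2.
have ab : a = b by rewrite -(pos_star pa) h1 star_mul2 !pos_star.
by split=> //; split; [exact: pos_star | rewrite -[in RHS]ab h1 ab].
Qed.

Lemma supp_mono (B a b : P) : is_proj B -> is_positive a -> is_positive (b - a) ->
  B ∘ b = b -> B ∘ a = a.
Proof.
move=> pB pa pba hb.
have [[qs qq] _] : is_proj (one - B) /\ one ∘ B = B.
  by apply: (proj_compl pB proj_one); rewrite mul2_1.
have hq : (one - B) ∘ b = 0 by rewrite mul2Bl mul1_2 hb subrr.
have h0 : (one - B) ∘ a = 0.
  apply: pos_mul_eq0 => //; first by apply: pos_proj.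
  apply/eqP; rewrite eq_le pos_tr_mul //; last by apply: pos_proj.
  rewrite andbT -subr_ge0 sub0r.
  have := pos_tr_mul (pos_proj (conj qs qq)) pba.
  by rewrite mul2Br hq sub0r -scaleN1r tr2Z mulN1r.
by move: h0; rewrite mul2Bl mul1_2 => /subr0_eq <-.
Qed.

(** The Schur product theorem: vector states take nonnegative values at the
    coproduct because these values are squares of norms of 3-boxes. *)
Lemma pos_coprod x y : is_positive x -> is_positive y -> is_positive (x ⋆ y).
Proof.
move=> [a ->] [b ->]; apply/posP; split=> [|y'].
  by rewrite star_coprod !star_mul2 !starK.
have [v hv] := schur_exists a b y'.
rewrite -(schur_ip hA hv); apply: ip_ge0 => //.
by case: (s); vm_compute.
Qed.

Lemma coprodBl x y z : (x - y) ⋆ z = x ⋆ z - y ⋆ z.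
Proof. by have [_ h _ _ _] := linear_morphisms (coprod_linearl z); exact: h. Qed.
Lemma coprodBr x y z : z ⋆ (x - y) = z ⋆ x - z ⋆ y.
Proof. by have [_ h _ _ _] := linear_morphisms (coprod_linearr z); exact: h. Qed.
Lemma coprodZl a x y : (a *: x) ⋆ y = a *: (x ⋆ y).
Proof. by have [_ _ _ h _] := linear_morphisms (coprod_linearl y); exact: h. Qed.
Lemma coprodZr a x y : y ⋆ (a *: x) = a *: (y ⋆ x).
Proof. by have [_ _ _ h _] := linear_morphisms (coprod_linearr y); exact: h. Qed.
Lemma coprod0r x : x ⋆ 0 = 0.
Proof. by have [_ _ _ _ h] := linear_morphisms (coprod_linearr x); exact: h. Qed.

Lemma pos_contragredient x : is_positive x -> is_positive (contragredient x).
Proof.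
case=> z ->; exists (star (contragredient z)).
by rewrite starK contragredient_mul2 star_contragredient.
Qed.

Lemma proj_contragredient p : is_proj p -> is_proj (contragredient p).
Proof.
case=> ps pp; split; first by rewrite star_contragredient ps.
by rewrite -contragredient_mul2 pp.
Qed.

Lemma le2_projP e f : is_proj e -> is_proj f -> le2 e f <-> f ∘ e = e.
Proof.
move=> pe pf; split=> [h|fe].
  by apply: (supp_mono pf (pos_proj pe) h pf.2).
have ef : e ∘ f = e by rewrite -[LHS]starK star_mul2 pe.1 pf.1 fe pe.1.
exact/pos_proj/(proj_compl pe pf ef).1.
Qed.

Lemma range_projP x : [/\ is_proj (range_proj x), range_proj x ∘ x = x &
  exists z, range_proj x = x ∘ z].
Proof.
have [r [pr rx [z hz]]] := right_ideal_mul hA x.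
have hr : exists r', [/\ is_proj r', r' ∘ x = x &
    forall e, is_proj e -> e ∘ x = x -> le2 r' e].
  exists r; split=> // e pe ex; apply/(le2_projP pr pe).
  by rewrite hz mul2A ex.
have [pr' rx' hmin] := xgetPex 0 hr; rewrite -/(range_proj x) in pr' rx' hmin.
split=> //; exists z; rewrite -hz.
have h1 : r ∘ range_proj x = range_proj x by apply/(le2_projP pr' pr)/hmin.
have h2 : range_proj x ∘ r = r by rewrite hz mul2A rx'.
by rewrite -pr'.1 -h1 star_mul2 pr.1 pr'.1.
Qed.

Lemma range_proj_proj x : is_proj (range_proj x).
Proof. by case: (range_projP x). Qed.

Lemma range_proj_mul x : range_proj x ∘ x = x.
Proof. by case: (range_projP x). Qed.

Lemma range_proj_min x e : e ∘ x = x -> e ∘ range_proj x = range_proj x.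
Proof. by move=> ex; have [_ _ [z ->]] := range_projP x; rewrite mul2A ex. Qed.

Lemma proj_antisym e f : is_proj e -> is_proj f -> e ∘ f = f -> f ∘ e = e -> e = f.
Proof. by move=> pe pf ef fe; rewrite -pe.1 -fe star_mul2 pe.1 pf.1. Qed.

Lemma range_proj_eq x r : is_proj r -> r ∘ x = x -> (exists z, r = x ∘ z) ->
  range_proj x = r.
Proof.
move=> pr rx [z rz]; apply: proj_antisym => //; first exact: range_proj_proj.
  by rewrite rz mul2A range_proj_mul.
exact: range_proj_min.
Qed.

Lemma range_projZ (a : C) x : a != 0 -> range_proj (a *: x) = range_proj x.
Proof.
move=> a0; have [pr rx [z hz]] := range_projP x.
apply: range_proj_eq => //; first by rewrite mul2Zr rx.
by exists (a^-1 *: z); rewrite mul2Zl mul2Zr scalerA mulfV // scale1r.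
Qed.

Lemma range_proj_of_proj p : is_proj p -> range_proj p = p.
Proof.
by move=> pp; apply: range_proj_eq => //; [exact: pp.2|exists p; rewrite pp.2].
Qed.

Lemma supp_sizeZ (a : C) x : a != 0 -> supp_size (a *: x) = supp_size x.
Proof. by move=> a0; rewrite /supp_size range_projZ. Qed.

Lemma le_range x (k : C) : is_positive x -> is_positive (k *: one - x) ->
  is_positive (k *: range_proj x - x).
Proof.
move=> px pkx; have [[rs rr] rx _] := range_projP x.
have xr : x ∘ range_proj x = x by rewrite -{1}(pos_star px) -{1}rs -star_mul2 rx pos_star.
have := pos_conj (range_proj x) pkx.
by rewrite rs mul2Br mul2Bl mul2Zr mul2_1 mul2Zl rr rx xr.
Qed.

(** Since x <= k, also x <= k R(x). *)
Lemma supp_size_ge x (k : C) : is_positive x -> is_positive (k *: one - x) ->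
  tr2 x <= k * supp_size x.
Proof.
move=> px pkx; have := pos_tr (le_range px pkx).
by rewrite tr2B tr2Z subr_ge0.
Qed.

Lemma supp_size_eq x : is_positive x -> is_positive (one - x) ->
  supp_size x = tr2 x <-> is_proj x.
Proof.
move=> px px1; split=> [h|pp]; last by rewrite /supp_size range_proj_of_proj.
have hx : is_positive (1 *: range_proj x - x).
  by apply: le_range => //; rewrite scale1r.
have : 1 *: range_proj x - x = 0.
  by apply: pos_tr_eq0 => //; rewrite tr2B tr2Z mul1r -/(supp_size x) h subrr.
by rewrite scale1r => /subr0_eq <-; exact: range_proj_proj.
Qed.

Lemma pos_spectral h : is_positive h ->
  exists n (l : 'I_n -> C) (e : 'I_n -> P),
  [/\ forall i, is_proj (e i), forall i j, i != j -> e i ∘ e j = 0,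
      \sum_i e i = one, h = \sum_i l i *: e i & forall i, 0 <= l i].
Proof.
move=> ph; have [n [l [e [e1 e2 e3 e4 e5]]]] := spectral_theorem hA (pos_star ph).
exists n, (fun i => if e i == 0 then 0 else l i), e; split=> //.
  by rewrite e4; apply: eq_bigr => i _; case: eqVneq => // ->; rewrite !scaler0.
move=> i; case: eqVneq => // ei.
have := pos_tr_mul ph (pos_proj (e1 i)); rewrite e4 mul2_suml (bigD1 i) //=.
rewrite mul2Zl (e1 i).2 big1 ?addr0 => [|j ji]; last by rewrite mul2Zl e2 ?scaler0.
by rewrite tr2Z pmulr_lge0 // pos_tr_gt0 //; exact: pos_proj.
Qed.

Lemma pos_sum_proj n (e : 'I_n -> P) (a : 'I_n -> C) : (forall i, is_proj (e i)) ->
  (forall i, 0 <= a i) -> is_positive (\sum_i a i *: e i).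
Proof.
move=> e1 a0; elim/big_rec: _ => [|i x _ px]; first exact: pos0.
by apply: pos_add => //; apply: pos_scale => //; exact: pos_proj.
Qed.

(** The constant c, a sum of inverses of eigenvalues, exceeds the inverse of each
    nonzero eigenvalue of h. *)
Lemma pseudo_inverse h : is_positive h -> exists w,
  [/\ is_positive w, w ∘ h = range_proj h, h ∘ w = range_proj h &
      exists2 c, 0 <= c & is_positive (c *: h - range_proj h)].
Proof.
move=> ph; have [n [l [e [e1 e2 e3 e4 e5]]]] := pos_spectral ph.
pose w := \sum_i (l i)^-1 *: e i.
pose r := \sum_i (l i != 0)%:R *: e i.
have lV i : l i * (l i)^-1 = (l i != 0)%:R.
  by case: eqVneq => [->|li]; rewrite ?mul0r // mulfV.
have hw : h ∘ w = r.
  by rewrite e4 mul2_orthogonal //; apply: eq_bigr => i _; rewrite lV.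
have wh : w ∘ h = r.
  by rewrite e4 mul2_orthogonal //; apply: eq_bigr => i _; rewrite mulrC lV.
have pr : is_positive r by apply: pos_sum_proj => // i; exact: ler0n.
have rr : range_proj h = r.
  apply: range_proj_eq; last by exists w.
    split; first exact: pos_star.
    by rewrite mul2_orthogonal //; apply: eq_bigr => i _; case: eqP; rewrite ?mulr0 ?mulr1.
  rewrite e4 mul2_orthogonal //; apply: eq_bigr => i _.
  by case: eqVneq => [->|]; rewrite ?mulr0 ?mul1r.
exists w; rewrite rr; split=> //.
  by apply: pos_sum_proj => // i; rewrite invr_ge0.
exists (\sum_i (l i)^-1); first by apply: sumr_ge0 => i _; rewrite invr_ge0.
rewrite e4 scaler_sumr -sumrB.
under eq_bigr => i _ do rewrite scalerA -scalerBl.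
apply: pos_sum_proj => // i; have [->|li] := eqVneq (l i) 0.
  by rewrite mulr0 subr0.
rewrite subr_ge0 (bigD1 i) //= mulrDl mulVf // lerDl mulr_ge0 //.
by apply: sumr_ge0 => j _; rewrite invr_ge0.
Qed.

End Positivity.

(** * Functional calculus *)

Section FunCalc.
Variables (R : realType) (A : planar_star_algebra R).
Hypothesis hA : is_subfactor_planar_algebra A.
Variable s : bool.
Local Notation C := R[i].
Local Notation P := (box A (2%N, s)).
Local Notation "x ∘ y" := (mul2 x y) (at level 40, left associativity).
Local Notation one := (one2 A s).

Lemma mul2_eigenr n (e : 'I_n -> P) (l : 'I_n -> C) i : (forall i, is_proj (e i)) ->
  (forall i j, i != j -> e i ∘ e j = 0) -> (\sum_i l i *: e i) ∘ e i = l i *: e i.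
Proof.
move=> e1 e2; rewrite mul2_suml (bigD1 i) //= mul2Zl (e1 i).2.
by rewrite big1 ?addr0 // => j ji; rewrite mul2Zl e2 ?scaler0.
Qed.

Lemma mul2_eigenl n (e : 'I_n -> P) (l : 'I_n -> C) i : (forall i, is_proj (e i)) ->
  (forall i j, i != j -> e i ∘ e j = 0) -> e i ∘ (\sum_i l i *: e i) = l i *: e i.
Proof.
move=> e1 e2; rewrite mul2_sumr (bigD1 i) //= mul2Zr (e1 i).2.
by rewrite big1 ?addr0 // => j ji; rewrite mul2Zr e2 ?scaler0 // eq_sym.
Qed.

(** Two decompositions of x give the same element: if e_i and e'_j are not
    orthogonal, then their eigenvalues coincide, hence also the values of f. *)
Lemma fun_calcE (f : C -> C) (x : P) n (l : 'I_n -> C) (e : 'I_n -> P) :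
  (forall i, is_proj (e i)) -> (forall i j, i != j -> e i ∘ e j = 0) ->
  \sum_i e i = one -> x = \sum_i l i *: e i ->
  fun_calc f x = \sum_i f (l i) *: e i.
Proof.
move=> e1 e2 e3 e4.
have hex : exists y, [set y : P | exists (n : nat) (l : 'I_n -> C) (e : 'I_n -> P),
    [/\ forall i, is_proj (e i), forall i j, i != j -> e i ∘ e j = 0,
        \sum_i e i = one2 A s, x = \sum_i l i *: e i &
        y = \sum_i f (l i) *: e i]]%classic y.
  by exists (\sum_i f (l i) *: e i), n, l, e.
have [m [l' [e' [e1' e2' e3' e4' hy]]]] := xgetPex 0 hex.
apply: etrans hy _.
have key i j : f (l' j) *: (e' j ∘ e i) = f (l i) *: (e' j ∘ e i).
  have h : l' j *: (e' j ∘ e i) = l i *: (e' j ∘ e i).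
    by rewrite -mul2Zl -(mul2_eigenl l') // -e4' e4 -mul2A (mul2_eigenr l) // mul2Zr.
  have [->|h0] := eqVneq (e' j ∘ e i) 0; first by rewrite !scaler0.
  congr (f _ *: _); apply/eqP; rewrite -subr_eq0.
  by have /eqP := h; rewrite -subr_eq0 -scalerBl scaler_eq0 (negbTE h0) orbF.
transitivity (\sum_j \sum_i f (l' j) *: (e' j ∘ e i)).
  rewrite -[LHS]mul2_1 -e3 mul2_suml; apply: eq_bigr => j _.
  by rewrite mul2_sumr; apply: eq_bigr => i _; rewrite mul2Zl.
rewrite -[RHS]mul1_2 -e3' mul2_suml; apply: eq_bigr => j _.
by rewrite mul2_sumr; apply: eq_bigr => i _; rewrite mul2Zr key.
Qed.

Lemma spectral_projP (h : P) (k : C) : star h = h ->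
  is_proj (spectral_proj h k) /\
  forall y, h ∘ y = k *: y <-> spectral_proj h k ∘ y = y.
Proof.
move=> hs; have [n [l [e [e1 e2 e3 e4 e5]]]] := spectral_theorem hA hs.
rewrite /spectral_proj (fun_calcE _ e1 e2 e3 e4).
set B := \sum_i _.
have BB : B ∘ B = B.
  by rewrite mul2_orthogonal //; apply: eq_bigr => i _; case: eqP; rewrite ?mulr0 ?mulr1.
have pB : is_positive B by apply: pos_sum_proj => // i; exact: ler0n.
have hB : h ∘ B = k *: B.
  rewrite e4 mul2_orthogonal // scaler_sumr; apply: eq_bigr => i _.
  by rewrite scalerA; case: eqP => [->|]; rewrite ?mulr0.
split; first by split=> //; exact: pos_star.
move=> y; split=> [hy|<-]; last by rewrite mul2A hB mul2Zl.
rewrite -[RHS]mul1_2 -e3 !mul2_suml; apply: eq_bigr => i _.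
case: eqVneq => [|li]; first by rewrite scale1r.
rewrite scale0r mul02.
have : l i *: (e i ∘ y) = k *: (e i ∘ y).
  by rewrite -[RHS]mul2Zr -hy mul2A e4 (mul2_eigenl l) // mul2Zl.
move/eqP; rewrite -subr_eq0 -scalerBl scaler_eq0 subr_eq0 (negbTE li) /=.
by move/eqP.
Qed.

End FunCalc.

(** * Absorbed elements and biprojections *)

Section Young.
Variables (R : realType) (A : planar_star_algebra R).
Hypothesis hA : is_subfactor_planar_algebra A.
Hypothesis hirr : is_irreducible A.
Variable s : bool.
Local Notation C := R[i].
Local Notation P := (box A (2%N, s)).
Local Notation "x ∘ y" := (mul2 x y) (at level 40, left associativity).
Local Notation one := (one2 A s).
Local Notation δ := (delta A).
Implicit Types (x y z e f p q r h B : P).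
Variable x0 : P.
Hypothesis x0_neq0 : x0 != 0.

Let hsph : is_spherical A. Proof. by case: hA. Qed.

Lemma delta_gt0 : 0 < δ.
Proof. by case: (delta_and_unit hA hirr x0_neq0). Qed.

Lemma delta_neq0 : δ != 0.
Proof. by rewrite gt_eqF // delta_gt0. Qed.

Lemma coprod1l y : one ⋆ y = (tr2 y / δ) *: one.
Proof. by case: (delta_and_unit hA hirr x0_neq0) => _ ->. Qed.

Lemma contragredientZ (a : C) x : contragredient (a *: x) = a *: contragredient x.
Proof.
have fZ t (b : C) (u : box A (2%N, t)) : fourier (b *: u) = b *: fourier u.
  by have [_ _ _ h _] := linear_morphisms (@fourier_linear R A t); exact: h.
by case: s x => x; rewrite /contragredient !fZ.
Qed.

Lemma contragredientB x y :
  contragredient (x - y) = contragredient x - contragredient y.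
Proof.
have fB t (u v : box A (2%N, t)) : fourier (u - v) = fourier u - fourier v.
  by have [_ h _ _ _] := linear_morphisms (@fourier_linear R A t); exact: h.
by case: s x y => x y; rewrite /contragredient !fB.
Qed.

Lemma contragredient1 : contragredient one = one.
Proof.
rewrite -[LHS]mul2_1 -{2}[one]contragredientK -contragredient_mul2 mul2_1.
exact: contragredientK.
Qed.

Lemma coprod1r y : y ⋆ one = (tr2 y / δ) *: one.
Proof.
rewrite -[LHS]contragredientK contragredient_coprod contragredient1 coprod1l.
by rewrite contragredientZ contragredient1 tr2_contragredient.
Qed.

Lemma tr2_coprod x y : tr2 (x ⋆ y) = tr2 x * tr2 y / δ.
Proof.
rewrite -[x ⋆ y]mul2_1 tr2_coprodl // coprod1l mul2Zr mul2_1 tr2Z.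
by rewrite tr2_contragredient // mulrC mulrA.
Qed.

Lemma coprod_jones x : x ⋆ jones_proj A s = δ^-1 *: x.
Proof. by rewrite /jones_proj coprodZr coprod_cupcap. Qed.

Lemma coprod_lel x y (k : C) : is_positive y -> is_positive (k *: one - x) ->
  is_positive ((k * (tr2 y / δ)) *: one - x ⋆ y).
Proof.
by move=> py px; have := pos_coprod hA px py; rewrite coprodBl coprodZl coprod1l scalerA.
Qed.

Lemma coprod_ler x y (k : C) : is_positive x -> is_positive (k *: one - y) ->
  is_positive ((k * (tr2 x / δ)) *: one - x ⋆ y).
Proof.
by move=> px py; have := pos_coprod hA px py; rewrite coprodBr coprodZr coprod1r scalerA.
Qed.

Lemma proj_le1 p : is_proj p -> is_positive (1 *: one - p).
Proof.
move=> pp; rewrite scale1r; apply: (pos_proj (proj_compl pp (proj_one A s) _).1).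
by rewrite mul2_1.
Qed.

(** The factor is forced by the trace; see [tr2_coprod]. *)
Definition absorbs p y := p ⋆ y = (tr2 y / δ) *: p.

(** [proj_rigid] applies because p ⋆ y <= 1 ⋆ y = tr(y)/δ. *)
Lemma absorbs_tr p y : is_proj p -> is_positive y ->
  tr2 (p ∘ (p ⋆ y)) = tr2 y / δ * tr2 p -> absorbs p y.
Proof.
move=> pp py h; apply: (proj_rigid hA) => //.
- by apply: pos_coprod => //; exact: pos_proj.
- by have := coprod_lel py (proj_le1 pp); rewrite mul1r.
- by rewrite tr2_coprod -mulrA mulrC.
Qed.

Lemma absorbs_coprod p y z : absorbs p y -> absorbs p z -> absorbs p (y ⋆ z).
Proof.
rewrite /absorbs => hy hz.
rewrite coprodA hy coprodZl hz scalerA tr2_coprod; congr (_ *: _).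
by ring.
Qed.

Lemma absorbs_contragredient p y : is_proj p -> is_positive y -> absorbs p y ->
  absorbs p (contragredient y).
Proof.
move=> pp py h; apply: absorbs_tr => //; first exact: pos_contragredient.
rewrite -{1}[contragredient y]contragredientK.
rewrite tr2C // tr2_coprodl // contragredientK contragredientK.
by rewrite h mul2Zr pp.2 tr2Z tr2_contragredient.
Qed.

(** The spectral projection B_2: the analogue of the stabilizer of a subset p of
    a group under right translations. *)
Definition stab p := spectral_proj (contragredient p ⋆ p) (tr2 p / δ).

Lemma stab_proj p : is_proj p -> is_proj (stab p).
Proof.
move=> pp; apply: (spectral_projP hA _ _).1.
rewrite star_coprod star_contragredient pp.1 //.
Qed.

(** By reciprocity tr(p (p ⋆ y)) = tr(y (p' ⋆ p)), and both p ⋆ y <= tr(y)/δ and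
    p' ⋆ p <= tr(p)/δ hold.  So this number is at most tr(y) tr(p)/δ, and equality
    means on one side that p absorbs y, on the other side that y lives where
    p' ⋆ p takes its maximal value. *)
Lemma stabP p y : is_proj p -> is_positive y -> stab p ∘ y = y <-> absorbs p y.
Proof.
move=> pp py; set k := tr2 p / δ; set h := contragredient p ⋆ p.
have hs : star h = h by rewrite star_coprod star_contragredient pp.1.
rewrite -(spectral_projP hA k hs).2.
have e : tr2 (p ∘ (p ⋆ y)) = tr2 (y ∘ h) by rewrite tr2C // tr2_coprodr.
split=> hy.
  apply: absorbs_tr => //.
  by rewrite e tr2C // hy tr2Z /k mulrC mulrA mulrAC.
have ph : is_positive (k *: one - h).
  have := coprod_ler (pos_contragredient (pos_proj pp)) (proj_le1 pp).
  by rewrite tr2_contragredient // mul1r.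
have h0 : y ∘ (k *: one - h) = 0.
  apply: (pos_mul_eq0 hA) => //; rewrite mul2Br mul2Zr mul2_1 tr2B -e hy tr2Z.
  by rewrite mul2Zr pp.2 tr2Z /k; ring.
move: (congr1 (@star _ _ _) h0).
rewrite star_mul2 star0 (pos_star hA ph) (pos_star hA py) mul2Bl mul2Zl mul1_2.
by move/subr0_eq.
Qed.

Lemma tr2_proj_gt0 p : is_proj p -> p != 0 -> 0 < tr2 p.
Proof. by move=> pp p0; apply: pos_tr_gt0 => //; exact: pos_proj. Qed.

Lemma tr2_proj_ge0 p : is_proj p -> 0 <= tr2 p.
Proof. by move=> pp; apply: (pos_tr hA); exact: pos_proj. Qed.

Lemma fourierZ t (b : C) (u : box A (2%N, t)) : fourier (b *: u) = b *: fourier u.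
Proof. by have [_ _ _ h _] := linear_morphisms (@fourier_linear R A t); exact: h. Qed.

Lemma fourier_inj : injective (@fourier R A s).
Proof.
move=> x y h; rewrite -[x]contragredientK -[y]contragredientK.
by case: s x y h => x y h; rewrite /contragredient h.
Qed.

(** Write F(B) = a Q.  The adjoint of F(B) is F(B'), so B' is a multiple of B, and
    equal to B as they have the same trace.  Then B ⋆ B = a B, as F turns the
    coproduct into the product. *)
Lemma biproj_props B : is_biproj B -> B != 0 ->
  contragredient B = B /\ absorbs B B.
Proof.
move=> [pB [a [Q [pQ hQ]]]] B0.
have a0 : a != 0.
  apply: contra_neq B0 => a0; apply: fourier_inj.
  by rewrite hQ a0 scale0r; have [_ _ _ _ ->] := linear_morphisms (@fourier_linear R A s).
(* F(B)* = F(\bar B) *)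
have h1 : fourier (contragredient B) = a^*%R *: Q.
  by rewrite -{1}pB.1 -star_fourier hQ starZ pQ.1.
have h2 : contragredient B = (a^*%R / a) *: B.
  by apply: fourier_inj; rewrite fourierZ hQ scalerA divfK.
have tB : 0 < tr2 B by exact: tr2_proj_gt0.
have a1 : a^*%R / a = 1.
  have := tr2_contragredient hsph B; rewrite h2 tr2Z => /eqP.
  by rewrite -subr_eq0 -{2}[tr2 B]mul1r -mulrBl mulf_eq0 subr_eq0 (gt_eqF tB) orbF
    => /eqP.
have hb : contragredient B = B by rewrite h2 a1 scale1r.
have h3 : B ⋆ B = a *: B.
  apply: fourier_inj; rewrite fourier_coprod hQ fourierZ hQ mul2Zl mul2Zr pQ.2.
  by rewrite scalerA.
split=> //; rewrite /absorbs h3; congr (_ *: _).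
have := congr1 (@tr2 _ _ _) h3; rewrite tr2_coprod tr2Z mulrAC => /eqP.
by rewrite -subr_eq0 -mulrBl mulf_eq0 subr_eq0 (gt_eqF tB) orbF => /eqP.
Qed.

Lemma biproj0 : is_biproj (0 : P).
Proof.
have p0 t : is_proj (0 : box A (2%N, t)) by split; rewrite ?star0 ?mul20.
split; first exact: p0.
exists 0, 0; split; first exact: p0.
by rewrite scale0r; have [_ _ _ _ ->] := linear_morphisms (@fourier_linear R A s).
Qed.

(** The analogue of: a nonempty finite subset of a group that is closed under
    products and inverses is a subgroup.  The inclusions are equalities by
    comparison of traces, and then F(B) is self-adjoint with square a multiple of
    itself. *)
Lemma biprojP B : is_biproj B <->
  [/\ is_proj B, B ∘ (B ⋆ B) = B ⋆ B & B ∘ contragredient B = contragredient B].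
Proof.
have [->|B0] := eqVneq B 0.
  split=> [_|_]; last exact: biproj0.
  split; first by case: biproj0.
    by rewrite coprod0r mul20.
  by rewrite mul02 -[0 in RHS](scale0r (0 : P)) contragredientZ scale0r.
split=> [bB|[pB hBB hbB]].
  have [h1 h2] := biproj_props bB B0; have [pB _] := bB.
  by split=> //; rewrite ?h1 ?pB.2 // h2 mul2Zr pB.2.
have pos_B := pos_proj pB.
have hb : contragredient B = B.
  rewrite -[RHS]scale1r; apply: (proj_rigid hA) => //.
  - exact: pos_contragredient.
  - exact/proj_le1/proj_contragredient.
  - by rewrite tr2_contragredient // mul1r.
  - by rewrite hbB tr2_contragredient // mul1r.
have hab : absorbs B B.
  by apply: absorbs_tr => //; rewrite hBB tr2_coprod mulrAC.
have tB : tr2 B / δ != 0.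
  by rewrite mulf_neq0 ?invr_neq0 ?delta_neq0 // gt_eqF // tr2_proj_gt0.
split=> //; exists (tr2 B / δ), ((tr2 B / δ)^-1 *: fourier B); split; last first.
  by rewrite scalerA mulfV // scale1r.
split.
  rewrite starZ star_fourier pB.1 hb; congr (_ *: _).
  apply/CrealP/ger0_real; rewrite invr_ge0 divr_ge0 //; last exact/ltW/delta_gt0.
  exact: tr2_proj_ge0.
rewrite mul2Zl mul2Zr -fourier_coprod hab fourierZ !scalerA; congr (_ *: _).
by rewrite -mulrA mulVf // mulr1.
Qed.

Lemma biproj_absorbs B : is_biproj B -> absorbs B B.
Proof.
have [->|B0] := eqVneq B 0 => bB; last by case: (biproj_props bB B0).
by rewrite /absorbs coprod0r scaler0.
Qed.

Lemma biproj_one : is_biproj one.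
Proof.
apply/biprojP; split; first exact: proj_one.
  by rewrite mul1_2.
by rewrite mul1_2.
Qed.

Lemma stab_biproj p : is_proj p -> is_biproj (stab p).
Proof.
move=> pp; have pB := stab_proj pp; have posB := pos_proj pB.
have ab : absorbs p (stab p) by apply/stabP => //; exact: pB.2.
apply/biprojP; split=> //; apply/stabP => //.
- exact: pos_coprod.
- exact: absorbs_coprod.
- exact: pos_contragredient.
- exact: absorbs_contragredient.
Qed.

(** The right ideals generated by e and f intersect in a right ideal. *)
Lemma proj_meet e f : is_proj e -> is_proj f -> exists m,
  [/\ is_proj m, e ∘ m = m, f ∘ m = m &
      forall y, e ∘ y = y -> f ∘ y = y -> m ∘ y = y].
Proof.
move=> pe pf.
have inW g y : is_proj g -> (y \in limg (linfun (mulL g))) = (g ∘ y == y).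
  move=> pg; apply/idP/eqP => [/memv_imgP[z _ ->]|hy].
    by rewrite lfunE /= /mulL mul2A pg.2.
  by apply/memv_imgP; exists y; rewrite ?memvf // lfunE /= /mulL hy.
pose W := (limg (linfun (mulL e)) :&: limg (linfun (mulL f)))%VS.
have [|m [pm mW hm]] := @right_ideal_projection _ _ hA s W.
  move=> y z; rewrite !memv_cap !inW // !mul2A => /andP[/eqP-> /eqP->].
  by rewrite !eqxx.
move: mW; rewrite memv_cap !inW // => /andP[/eqP h1 /eqP h2].
exists m; split=> // y h1' h2'; apply: hm.
by rewrite memv_cap !inW // h1' h2' !eqxx.
Qed.

Lemma coprod_mono x y x' y' : is_positive x -> is_positive y' ->
  is_positive (x' - x) -> is_positive (y' - y) ->
  is_positive (x' ⋆ y' - x ⋆ y).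
Proof.
move=> px py' hx hy.
have -> : x' ⋆ y' - x ⋆ y = (x' - x) ⋆ y' + x ⋆ (y' - y).
  by rewrite coprodBl coprodBr addrA subrK.
by apply: pos_add => //; apply: pos_coprod.
Qed.

Lemma biproj_meet e m : is_biproj e -> is_proj m -> e ∘ m = m ->
  e ∘ (m ⋆ m) = m ⋆ m /\ e ∘ contragredient m = contragredient m.
Proof.
move=> /biprojP[pe h1 h2] pm em.
have pos_m := pos_proj pm.
have le : is_positive (e - m) by apply/(le2_projP hA pm pe).
split.
  apply: (supp_mono hA pe _ _ h1); first exact: pos_coprod.
  by apply: coprod_mono => //; exact: pos_proj.
have pm' := proj_contragredient pm; have pe' := proj_contragredient pe.
have h3 : contragredient m ∘ contragredient e = contragredient m.
  by rewrite -contragredient_mul2 em.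
have h4 : contragredient e ∘ contragredient m = contragredient m.
  by rewrite -[LHS]starK star_mul2 pm'.1 pe'.1 h3 pm'.1.
by rewrite -h4 mul2A h2.
Qed.

(** Among the biprojections that support x, one whose right ideal has least
    dimension is contained in all the others, by taking meets. *)
Lemma gen_biprojP x : [/\ is_biproj (gen_biproj x),
  gen_biproj x ∘ x ∘ gen_biproj x = x &
  forall B, is_biproj B -> B ∘ x ∘ B = x -> le2 (gen_biproj x) B].
Proof.
have dim_ex : exists n, `[< exists B, [/\ is_biproj B, B ∘ x ∘ B = x &
     \dim (limg (linfun (mulL B))) = n] >].
  exists (\dim (limg (linfun (mulL one)))); apply/asboolP; exists one.
  by split=> //; [exact: biproj_one | rewrite mul1_2 mul2_1].
have [n /asboolP[G [bG hG dG]] nmin] := ex_minnP dim_ex.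
have supp B : is_biproj B -> B ∘ x ∘ B = x -> B ∘ x = x /\ B ∘ star x = star x.
  move=> [pB _] h; split; first by rewrite -h !mul2A pB.2.
  by rewrite -{1}h !star_mul2 pB.1 !mul2A pB.2 -{2}h !star_mul2 pB.1 mul2A.
have hex : exists B, [set B : P | [/\ is_biproj B, B ∘ x ∘ B = x &
    forall B' : P, is_biproj B' -> B' ∘ x ∘ B' = x -> le2 B B']]%classic B.
  exists G; split=> // B bB hB.
  have [[pG _] [pB _]] := (bG, bB).
  have [m [pm Gm Bm mmax]] := proj_meet pG pB.
  have [m1 m2] := biproj_meet bG pm Gm; have [m3 m4] := biproj_meet bB pm Bm.
  have bm : is_biproj m by apply/biprojP; split=> //; exact: mmax.
  have [Gx Gx'] := supp _ bG hG; have [Bx Bx'] := supp _ bB hB.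
  have mx : m ∘ x = x by exact: mmax.
  have mx' : m ∘ star x = star x by exact: mmax.
  have hm : m ∘ x ∘ m = x.
    by rewrite mx -[LHS]starK star_mul2 pm.1 mx' starK.
  have sub : (limg (linfun (mulL m)) <= limg (linfun (mulL G)))%VS.
    apply/subvP => _ /memv_imgP[z _ ->]; rewrite lfunE.
    apply/memv_imgP; exists (m ∘ z); first exact: memvf.
    by rewrite [RHS]lfunE /= /mulL mul2A Gm.
  have : (limg (linfun (mulL m)) == limg (linfun (mulL G)))%VS.
    rewrite eqEdim sub dG nmin //; apply/asboolP; exists m.
    by split.
  move=> /eqP e; have : G \in limg (linfun (mulL m)).
    by rewrite e; apply/memv_imgP; exists one; rewrite ?memvf // lfunE /= /mulL mul2_1.
  case/memv_imgP=> z _; rewrite lfunE /= /mulL => hz.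
  have mG : m ∘ G = G by rewrite hz mul2A pm.2.
  by apply/(le2_projP hA pG pB); rewrite -mG mul2A Bm.
exact: (xgetPex 0 hex).
Qed.

End Young.

(** * Supports of coproducts *)

Section Equivalences.
Variables (R : realType) (A : planar_star_algebra R).
Hypothesis hA : is_subfactor_planar_algebra A.
Hypothesis hirr : is_irreducible A.
Variable s : bool.
Local Notation C := R[i].
Local Notation P := (box A (2%N, s)).
Local Notation "x ∘ y" := (mul2 x y) (at level 40, left associativity).
Local Notation one := (one2 A s).
Local Notation δ := (delta A).
Implicit Types (x y z e f p q r h B w : P).

Let hsph : is_spherical A. Proof. by case: hA. Qed.

(** With w inverse to p ⋆ q on its support r, the hourglass b of p, q and w and
    the vector a = p ⊗ q satisfy <a, b> = <b, a> = <b, b> = tr r and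
    <a, a> = tr(p) tr(q); the bound is the positivity of <a - b, a - b>. *)
Lemma supp_size_le p q : is_proj p -> is_proj q -> p != 0 ->
  supp_size (p ⋆ q) <= tr2 p * tr2 q.
Proof.
move=> pp pq p0; have py := pos_coprod hA (pos_proj pp) (pos_proj pq).
have [w [pw wy yw _]] := pseudo_inverse hA py.
have [pr _ _] := range_projP hA (p ⋆ q).
have [u hu] := tensor_exists p q.
have [v hv] := hourglass_exists p q w p q.
have h4 : planar_check (pair_code (4%N, s)) by case: (s); vm_compute.
have := ip_ge0 (u - v) hA h4; rewrite ipB //.
rewrite (tensor_ip hA p0 hu) (hourglass_ip hA hv) (tensor_hourglass_ip hA hu hv).
rewrite (hourglass_tensor_ip hA hu hv) pp.1 pq.1 (pos_star hA pw) !pp.2 !pq.2.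
rewrite wy -mul2A wy pr.2 -/(supp_size _).
by rewrite subrK subr_ge0.
Qed.

Lemma supp_size_ge_l p q : is_proj p -> is_proj q -> q != 0 ->
  tr2 p <= supp_size (p ⋆ q).
Proof.
move=> pp pq q0; have dgt := delta_gt0 hA hirr q0.
have tq := tr2_proj_gt0 hA pq q0.
have py := pos_coprod hA (pos_proj pp) (pos_proj pq).
have := coprod_lel hA hirr q0 (pos_proj pq) (proj_le1 pp).
rewrite mul1r => /(supp_size_ge hA py); rewrite (tr2_coprod hA hirr q0).
by rewrite -mulrA mulrC ler_pM2l // divr_gt0.
Qed.

Lemma supp_size_ge_r p q : is_proj p -> is_proj q -> p != 0 ->
  tr2 q <= supp_size (p ⋆ q).
Proof.
move=> pp pq p0; have dgt := delta_gt0 hA hirr p0.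
have tp := tr2_proj_gt0 hA pp p0.
have py := pos_coprod hA (pos_proj pp) (pos_proj pq).
have := coprod_ler hA hirr p0 (pos_proj pp) (proj_le1 pq).
rewrite mul1r => /(supp_size_ge hA py); rewrite (tr2_coprod hA hirr p0).
by rewrite mulrAC ler_pM2l // divr_gt0.
Qed.

(** The analogue of the convolution by a probability measure. *)
Definition nconv y x : P := (δ / tr2 y) *: (x ⋆ y).

Section Conv.
Variable y : P.
Hypotheses (py : is_positive y) (ty : 0 < tr2 y).

Let y0 : y != 0.
Proof. by apply: contraTneq ty => ->; rewrite tr20 ltxx. Qed.

Let dgt : 0 < δ. Proof. exact: (delta_gt0 hA hirr y0). Qed.

Lemma conv_coef_gt0 : 0 < δ / tr2 y. Proof. exact: divr_gt0. Qed.

Lemma coprodE x : x ⋆ y = (tr2 y / δ) *: nconv y x.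
Proof. by rewrite scalerA mulrA divfK ?gt_eqF // divff ?gt_eqF // scale1r. Qed.

Lemma pos_conv x : is_positive x -> is_positive (nconv y x).
Proof. by move=> px; apply: pos_scale => //; [exact: ltW conv_coef_gt0|exact: pos_coprod]. Qed.

Lemma tr2_conv x : tr2 (nconv y x) = tr2 x.
Proof.
rewrite tr2Z (tr2_coprod hA hirr y0).
by field; rewrite !gt_eqF.
Qed.

Lemma conv_le1 x : is_positive (one - x) -> is_positive (one - nconv y x).
Proof.
move=> px; have := coprod_lel hA hirr y0 (k := 1) (x := x) py.
rewrite scale1r => /(_ px) /(pos_scale hA (ltW conv_coef_gt0)).
rewrite scalerBr scalerA mul1r.
by rewrite (_ : _ / _ * _ = 1) ?scale1r //; field; rewrite !gt_eqF.
Qed.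

Lemma supp_size_conv x : supp_size (x ⋆ y) = supp_size (nconv y x).
Proof. by rewrite supp_sizeZ // gt_eqF // conv_coef_gt0. Qed.

End Conv.

Lemma tr2_conv_adj y x z : tr2 (nconv y x ∘ z) = tr2 (x ∘ nconv (contragredient y) z).
Proof. by rewrite mul2Zl mul2Zr !tr2Z tr2_coprodl // tr2_contragredient. Qed.

Lemma pos_conv_contra y : is_positive y -> 0 < tr2 y ->
  is_positive (contragredient y) /\ 0 < tr2 (contragredient y).
Proof. by move=> py ty; split; [exact: pos_contragredient | rewrite tr2_contragredient]. Qed.

Lemma pos_sub1 p : is_proj p -> is_positive (one - p).
Proof. by move=> /(proj_le1); rewrite scale1r. Qed.

Lemma supp_size_conv_proj p y : is_proj p -> is_positive y -> 0 < tr2 y ->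
  supp_size (p ⋆ y) = tr2 p <-> is_proj (nconv y p).
Proof.
move=> pp py ty; rewrite supp_size_conv // -(tr2_conv ty p).
apply: supp_size_eq => //; first exact: pos_conv py ty _ (pos_proj pp).
by apply: conv_le1 => //; exact: pos_sub1.
Qed.

(** Let f be the projection obtained at the end.  Moving the last convolution to
    the other side, tr(Φ_w'(f) Φ_y(p)) = tr(f), and [pos_rigid] applies. *)
Lemma conv_proj_factor p y w : is_proj p -> is_positive y -> 0 < tr2 y ->
  is_positive w -> 0 < tr2 w -> is_proj (nconv w (nconv y p)) -> is_proj (nconv y p).
Proof.
move=> pp py ty pw tw; set b := nconv y p; set p' := nconv w b => pp'.
have [pw' tw'] := pos_conv_contra pw tw.
pose a := nconv (contragredient w) p'.
have pb : is_positive b by apply: pos_conv => //; exact: pos_proj.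
have tab : tr2 (a ∘ b) = tr2 p.
  rewrite tr2C // -tr2_conv_adj -/p' pp'.2 !tr2_conv //.
have [] // := @pos_rigid _ _ hA s a b.
- by apply: pos_conv => //; exact: pos_proj.
- by apply: conv_le1 => //; exact: pos_sub1.
- by apply: conv_le1 => //; exact: pos_sub1.
- by rewrite tab /a !tr2_conv.
- by rewrite tab /b tr2_conv.
Qed.

(** As Φ_y(p) is a projection, its trace is also the trace of its square, that is
    tr(p Φ_y'(Φ_y(p))). *)
Lemma conv_proj_absorbs p y : is_proj p -> is_positive y -> 0 < tr2 y ->
  is_proj (nconv y p) -> absorbs p (y ⋆ contragredient y).
Proof.
move=> pp py ty pc; have [py' ty'] := pos_conv_contra py ty.
have y0 : y != 0 by apply: contraTneq ty => ->; rewrite tr20 ltxx.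
apply: (absorbs_tr hA hirr y0 pp); first exact: pos_coprod.
rewrite coprodA (coprodE ty) coprodZl mul2Zr tr2Z.
rewrite (coprodE ty') mul2Zr tr2Z.
rewrite -tr2_conv_adj pc.2 tr2_conv // (tr2_coprod hA hirr y0) tr2_contragredient //.
by ring.
Qed.

(** The projection p is obtained by convolving Φ_y(p) with y'. *)
Lemma absorbs_conv_proj p y : is_proj p -> is_positive y -> 0 < tr2 y ->
  absorbs p (y ⋆ contragredient y) -> is_proj (nconv y p).
Proof.
move=> pp py ty h; have [py' ty'] := pos_conv_contra py ty.
apply: (conv_proj_factor pp py ty py' ty').
have y0 : y != 0 by apply: contraTneq ty => ->; rewrite tr20 ltxx.
have dgt := delta_gt0 hA hirr y0.
rewrite /nconv coprodZl -coprodA h (tr2_coprod hA hirr y0) tr2_contragredient //.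
rewrite !scalerA (_ : _ * _ = 1) ?scale1r //.
by field; rewrite !gt_eqF.
Qed.

Lemma tr2_coprod_gt0 y w : 0 < tr2 y -> 0 < tr2 w -> 0 < tr2 (y ⋆ w).
Proof.
move=> ty tw; have y0 : y != 0 by apply: contraTneq ty => ->; rewrite tr20 ltxx.
by rewrite (tr2_coprod hA hirr y0) divr_gt0 ?mulr_gt0 // (delta_gt0 hA hirr y0).
Qed.

Section TwoProjections.
Variables p q : P.
Hypotheses (hp : is_proj p) (hq : is_proj q) (hp0 : p != 0) (hq0 : q != 0).

Let tp : 0 < tr2 p. Proof. exact: (tr2_proj_gt0 hA). Qed.
Let tq : 0 < tr2 q. Proof. exact: (tr2_proj_gt0 hA). Qed.
Let dgt : 0 < δ. Proof. exact: (delta_gt0 hA hirr hq0). Qed.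
Let posp : is_positive p. Proof. exact: pos_proj. Qed.
Let posq : is_positive q. Proof. exact: pos_proj. Qed.
Local Notation X := (q ⋆ contragredient q).
Let posX : is_positive X.
Proof. by apply: (pos_coprod hA) => //; exact: pos_contragredient. Qed.
Let tX : 0 < tr2 X.
Proof. by apply: tr2_coprod_gt0 => //; rewrite tr2_contragredient. Qed.

Lemma supp_size_eq_proj : supp_size (p ⋆ q) = tr2 p <-> is_proj ((δ / tr2 q) *: (p ⋆ q)).
Proof. exact: supp_size_conv_proj. Qed.

Lemma supp_size_eq_absorbs : supp_size (p ⋆ q) = tr2 p <-> absorbs p X.
Proof.
rewrite supp_size_eq_proj -/(nconv q p); split; first exact: conv_proj_absorbs.
exact: absorbs_conv_proj.
Qed.

Lemma supp_size_iterates : supp_size (p ⋆ q) = tr2 p ->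
  forall m j : nat, (j <= 1)%N -> (0 < m + j)%N ->
    supp_size (p ⋆ coprod_pow X m ⋆ coprod_pow q j) = tr2 p.
Proof.
move=> h1; have /supp_size_eq_absorbs hX := h1; move=> m j hj _.
(* the coproduct power of exponent 0 is the Jones projection, which acts by 1/δ *)
have [c c0 ->] : exists2 c, c != 0 & p ⋆ coprod_pow X m = c *: p.
  have kX : tr2 X / δ != 0 by rewrite gt_eqF // divr_gt0.
  case: m => [|m]; first by exists δ^-1; rewrite ?coprod_jones ?invr_neq0 ?gt_eqF.
  elim: m => [|m [c c0 IH]]; first by exists (tr2 X / δ).
  exists (c * (tr2 X / δ)); first by rewrite mulf_neq0.
  by rewrite /= coprodA IH coprodZl hX scalerA.
rewrite coprodZl supp_sizeZ //.
case: j hj => [|[|//]] _ //=.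
rewrite coprod_jones supp_sizeZ ?invr_neq0 ?gt_eqF //.
by rewrite /supp_size range_proj_of_proj.
Qed.

(** Every iterate is of the form (p ⋆ q) ⋆ w with w positive, up to a positive
    factor, so [conv_proj_factor] recovers the first step. *)
Lemma supp_size_of_iterate m j : (j <= 1)%N -> (0 < m + j)%N ->
  supp_size (p ⋆ coprod_pow X m ⋆ coprod_pow q j) = tr2 p ->
  supp_size (p ⋆ q) = tr2 p.
Proof.
move=> hj hmj.
have dn : δ^-1 != 0 by rewrite invr_neq0 ?gt_eqF.
case: m hmj => [|m] hmj.
  case: j hj hmj => [|[|//]] _ //= _.
  by rewrite coprod_jones coprodZl supp_sizeZ.
have [r [pr tr hr]] : exists r, [/\ is_positive r, 0 < tr2 r &
    coprod_pow X m.+1 = q ⋆ r].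
  elim: m {hmj} => [|m [r [pr tr hr]]].
    exists (contragredient q); split=> //; first exact: pos_contragredient.
    by rewrite tr2_contragredient.
  exists (r ⋆ X); split; [exact: pos_coprod|exact: tr2_coprod_gt0|].
  by rewrite coprodA -hr.
have main w : is_positive w -> 0 < tr2 w -> supp_size (p ⋆ q ⋆ w) = tr2 p ->
    supp_size (p ⋆ q) = tr2 p.
  move=> pw tw.
  have k0 : tr2 q / δ != 0 by rewrite gt_eqF // divr_gt0.
  have pc : is_positive (nconv q p) by exact: pos_conv.
  have pc1 : is_positive (one - nconv q p) by apply: conv_le1 => //; exact: pos_sub1.
  rewrite (coprodE tq) coprodZl !(supp_sizeZ hA _ k0) (supp_size_conv tw).
  rewrite -[in X in X -> _](tr2_conv tq p) -[in X in X -> _](tr2_conv tw (nconv q p)).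
  move/(supp_size_eq hA (pos_conv pw tw pc) (conv_le1 pw tw pc1)).
  move=> /(conv_proj_factor hp posq tq pw tw)/(supp_size_eq hA pc pc1) ->.
  exact: tr2_conv.
rewrite hr coprodA; case: j hj hmj => [|[|//]] _ _ /=.
  by rewrite coprod_jones supp_sizeZ //; exact: main.
rewrite -coprodA; apply: main; first exact: pos_coprod.
exact: tr2_coprod_gt0.
Qed.

(** The biprojection generated by q ⋆ q' is below the biprojection B_2 iff B_2
    supports q ⋆ q', that is, iff p absorbs it. *)
Lemma supp_size_eq_gen_biproj : supp_size (p ⋆ q) = tr2 p <->
  le2 (gen_biproj X) (spectral_proj (contragredient p ⋆ p) (tr2 p / δ)).
Proof.
rewrite supp_size_eq_absorbs -(stabP hA hirr hp0 hp posX) -/(stab p).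
have pB := stab_proj hA hp; have bB := stab_biproj hA hirr hp0 hp.
have [bG GXG Gmin] := gen_biprojP hA hirr hp0 X; have [pG _] := bG.
have Xs : star X = X by exact: pos_star.
set G := gen_biproj X in bG GXG Gmin pG *.
split=> [BX|/(le2_projP hA pG pB) BG].
  apply: Gmin => //; rewrite BX.
  by rewrite -[LHS]starK star_mul2 pB.1 Xs BX Xs.
have GX : G ∘ X = X by rewrite -{1}GXG !mul2A pG.2.
by rewrite -GX mul2A BG.
Qed.

(** Take B = B_2 and x = p.  As B_2 absorbs whatever it supports, the pair (B_2, q)
    satisfies the same condition as (p, q); so the convolution of B_2 with q is a
    projection, and it is the required right shift. *)
Lemma subshift_of_supp_size : supp_size (p ⋆ q) = tr2 p ->
  exists B : P, [/\ is_biproj B, is_right_subshift B q &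
    exists x : P, is_positive x /\ p = range_proj (x ⋆ B)].
Proof.
move/supp_size_eq_absorbs => hX.
have pB := stab_proj hA hp; have bB := stab_biproj hA hirr hp0 hp.
have BX : stab p ∘ X = X by apply/(stabP hA hirr hp0 hp posX).
set B := stab p in pB bB BX *.
have B0 : B != 0.
  by apply: contraTneq tX => B0; rewrite -BX B0 mul02 tr20 ltxx.
have posB := pos_proj pB; have tB := tr2_proj_gt0 hA pB B0.
have abB : absorbs p B by apply/(stabP hA hirr hp0 hp posB); exact: pB.2.
have BB := biproj_absorbs hA hirr hp0 bB.
exists B; split=> //; last first.
  exists p; split=> //; rewrite abB range_projZ //; last by rewrite gt_eqF ?divr_gt0.
  by rewrite range_proj_of_proj.
have abX : absorbs B X.
  apply/(stabP hA hirr hp0 pB posX); rewrite -BX mul2A.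
  by congr (_ ∘ _); apply/(stabP hA hirr hp0 pB posB).
split=> //; exists (nconv q B).
have pc : is_proj (nconv q B) by exact: absorbs_conv_proj.
split; first split=> //.
- by rewrite tr2_conv.
- by rewrite coprodZr coprodA BB coprodZl !scalerA mulrC.
apply/(le2_projP hA hq pc).
have h0 : q ∘ (one - nconv q B) = 0.
  apply: (pos_mul_eq0 hA) => //; first exact: pos_sub1.
  rewrite mul2Br mul2_1 tr2B mul2Zr tr2Z tr2C // tr2_coprodl //.
  rewrite tr2C // -[X in tr2 (X ∘ B)]BX.
  rewrite tr2C // mul2A pB.2 BX (tr2_coprod hA hirr hq0) tr2_contragredient //.
  by field; rewrite !gt_eqF.
move: h0; rewrite mul2Br mul2_1 => /subr0_eq h0.
by rewrite -[LHS]starK star_mul2 pc.1 hq.1 -h0 hq.1.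
Qed.

(** The support p of x ⋆ B absorbs B because x ⋆ B does, and the right shift g
    satisfies tr((g ⋆ g') B) = tr(g (B ⋆ g)) = tr(g ⋆ g'), so B supports g ⋆ g'
    and the smaller element q ⋆ q'. *)
Lemma supp_size_of_subshift : (exists B : P, [/\ is_biproj B, is_right_subshift B q &
    exists x : P, is_positive x /\ p = range_proj (x ⋆ B)]) ->
  supp_size (p ⋆ q) = tr2 p.
Proof.
case=> B [bB [_ [g [[pg tg hg] qg]]] [x [px hpx]]].
apply/supp_size_eq_absorbs.
have [pB _] := bB; have posB := pos_proj pB; have posg := pos_proj pg.
have BB := biproj_absorbs hA hirr hp0 bB.
set y := x ⋆ B in hpx; have py : is_positive y by exact: pos_coprod.
have yB : y ⋆ B = (tr2 B / δ) *: y by rewrite /y -coprodA BB coprodZr.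
have [_ [_ _ _ [c c0 hc]]] := pseudo_inverse hA py; rewrite -hpx in hc.
have pyy : p ∘ y = y by rewrite hpx range_proj_mul.
have k0 : 0 <= tr2 B / δ by rewrite divr_ge0 ?(ltW dgt) ?(tr2_proj_ge0 hA).
have ppB : p ∘ (p ⋆ B) = p ⋆ B.
  apply: (supp_mono hA (b := (c * (tr2 B / δ)) *: y) hp).
  - exact: pos_coprod.
  - have := pos_coprod hA hc posB; rewrite coprodBl coprodZl yB scalerA //.
  - by rewrite mul2Zr pyy.
have abB : absorbs p B.
  by apply: (absorbs_tr hA hirr hp0) => //; rewrite ppB (tr2_coprod hA hirr hp0) -mulrA mulrC.
have pg' := pos_contragredient posg.
have hBg : B ∘ (g ⋆ contragredient g) = g ⋆ contragredient g.
  have pgg : is_positive (g ⋆ contragredient g) by exact: pos_coprod.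
  have h0 : (g ⋆ contragredient g) ∘ (one - B) = 0.
    apply: (pos_mul_eq0 hA) => //; first exact: pos_sub1.
    rewrite mul2Br mul2_1 tr2B tr2_coprodl // contragredientK hg mul2Zr pg.2 tr2Z.
    rewrite (tr2_coprod hA hirr hp0) tr2_contragredient // tg.
    by rewrite mulrAC subrr.
  move: h0; rewrite mul2Br mul2_1 => /subr0_eq h0.
  by rewrite -[LHS]starK star_mul2 pB.1 (pos_star hA pgg) -h0 (pos_star hA pgg).
have BX : B ∘ X = X.
  apply: (supp_mono hA pB posX _ hBg).
  apply: coprod_mono => //.
  rewrite -[contragredient g - _]/(contragredient g + - _).
  have /(pos_contragredient) := qg.
  by rewrite contragredientB.
apply/(stabP hA hirr hp0 hp posX); rewrite -BX mul2A; congr (_ ∘ _).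
by apply/(stabP hA hirr hp0 hp posB).
Qed.

End TwoProjections.

End Equivalences.

(** * Norms *)

Lemma ltr0c (R : realType) (x : R) : (0 < x%:C) = (0 < x).
Proof. exact: (ltcR 0 x). Qed.

Section Norms.
Variables (R : realType) (A : planar_star_algebra R).
Hypothesis hA : is_subfactor_planar_algebra A.
Variable s : bool.
Local Notation C := R[i].
Local Notation P := (box A (2%N, s)).
Local Notation "x ∘ y" := (mul2 x y) (at level 40, left associativity).
Local Notation one := (one2 A s).
Implicit Types (p q h z : P) (t : R).

Lemma ge0_Re (c : C) : 0 <= c -> (complex.Re c)%:C = c /\ 0 <= complex.Re c.
Proof.
move=> c0; have h : (complex.Re c)%:C = c by apply/RRe_real/ger0_real.
by split=> //; rewrite -ler0c h.
Qed.

(** The absolute value of a positive element is the element itself, so its powers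
    are computed on its own spectral decomposition. *)
Lemma lnorm_decomposition t h n (r : 'I_n -> R) (e : 'I_n -> P) :
  (forall i, is_proj (e i)) -> (forall i j, i != j -> e i ∘ e j = 0) ->
  \sum_i e i = one -> (forall i, 0 <= r i) -> h = \sum_i (r i)%:C *: e i ->
  lnorm t%:E h = (\sum_i r i `^ t * complex.Re (tr2 (e i))) `^ t^-1.
Proof.
move=> e1 e2 e3 r0 eh; rewrite /lnorm.
have hpos : is_positive h.
  by rewrite eh; apply: pos_sum_proj => // i; rewrite ler0c.
have eabs : abs2 h = \sum_i (r i)%:C *: e i.
  rewrite /abs2 (pos_star hA hpos) (fun_calcE _ e1 e2 e3 (l := fun i => (r i * r i)%:C)).
    by apply: eq_bigr => i _ /=; rewrite -expr2 sqrtr_sqr ger0_norm.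
  by rewrite {1 2}eh mul2_orthogonal //; apply: eq_bigr => i _; rewrite rmorphM.
rewrite /abs_pow (fun_calcE _ e1 e2 e3 eabs) tr2_sum; congr (_ `^ _).
have -> : \sum_i tr2 ((complex.Re (r i)%:C `^ t)%:C *: e i) =
   (\sum_i r i `^ t * complex.Re (tr2 (e i)))%:C.
  rewrite rmorph_sum; apply: eq_bigr => i _; rewrite tr2Z rmorphM /=.
  by rewrite (ge0_Re (pos_tr hA (pos_proj (e1 i)))).1.
by [].
Qed.

Lemma lnorm_proj t (k : R) p : is_proj p -> t != 0 -> 0 <= k ->
  lnorm t%:E (k%:C *: p) = k * complex.Re (tr2 p) `^ t^-1.
Proof.
move=> pp t0 k0.
have [pp' _] := proj_compl pp (proj_one A s) (mul2_1 p).
have tp0 := (ge0_Re (pos_tr hA (pos_proj pp))).2.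
rewrite (@lnorm_decomposition t _ 2 (fun i => if i == ord0 then k else 0)
  (fun i => if i == ord0 then p else one - p)).
- rewrite big_ord_recl big_ord1 /= powR0 // mul0r addr0.
  by rewrite powRM ?powR_ge0 // -powRrM mulfV // powRr1.
- by move=> i; case: ifP.
- move=> [[|[|//]] hi] [[|[|//]] hj] //= _.
  + by rewrite mul2Br mul2_1 pp.2 subrr.
  + by rewrite mul2Bl mul1_2 pp.2 subrr.
- by rewrite big_ord_recl big_ord1 /= addrC subrK.
- by move=> i; case: ifP.
- by rewrite big_ord_recl big_ord1 /= scale0r addr0.
Qed.

(** The supremum is reached at the vector p divided by its norm. *)
Lemma op_norm_proj (k : R) p : is_proj p -> p != 0 -> 0 <= k ->
  op_norm (k%:C *: p) = k.
Proof.
move=> pp p0 k0.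
have [pp' _] := proj_compl pp (proj_one A s) (mul2_1 p).
have value (y : P) : complex.Re (tr2 (star ((k%:C *: p) ∘ y) ∘ ((k%:C *: p) ∘ y))) =
    k ^+ 2 * complex.Re (tr2 (star y ∘ p ∘ y)).
  have hy : 0 <= tr2 (star y ∘ p ∘ y).
    have [_ h] := (posP hA p).1 (pos_proj pp); exact: h.
  have -> : tr2 (star ((k%:C *: p) ∘ y) ∘ ((k%:C *: p) ∘ y)) =
     (k ^+ 2)%:C * tr2 (star y ∘ p ∘ y).
    rewrite !mul2Zl starZ star_mul2 pp.1 mul2Zl mul2Zr !tr2Z mulrA.
    rewrite -mul2A [p ∘ (p ∘ y)]mul2A pp.2 mul2A; congr (_ * _).
    by rewrite expr2 rmorphM; congr (_ * _); apply/CrealP/ger0_real; rewrite ler0c.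
  by rewrite -{1}(ge0_Re hy).1 -rmorphM.
have tp := tr2_proj_gt0 hA pp p0.
have [tpE tp0] := ge0_Re (ltW tp).
have tp1 : 0 < complex.Re (tr2 p) by rewrite -ltr0c tpE.
rewrite /op_norm; set S := (X in sup X).
have ub : ubound S k.
  move=> _ [y /= hy <-]; rewrite value sqrtrM ?sqr_ge0 // sqrtr_sqr ger0_norm //.
  rewrite -[leRHS]mulr1 ler_wpM2l // -sqrtr1 ler_wsqrtr //; apply: le_trans hy.
  have h : 0 <= tr2 (star y ∘ (one - p) ∘ y).
    have [_ h] := (posP hA _).1 (pos_proj pp'); exact: h.
  have := (ge0_Re h).2; rewrite mul2Br mul2Bl mul2_1 tr2B raddfB /=.
  by rewrite subr_ge0.
have Sk : S k.
  exists (((Num.sqrt (complex.Re (tr2 p)))^-1)%:C *: p) => /=.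
    rewrite starZ pp.1 mul2Zl mul2Zr pp.2 !tr2Z.
    have -> : ((Num.sqrt (complex.Re (tr2 p)))^-1)%:C^*%R =
       ((Num.sqrt (complex.Re (tr2 p)))^-1)%:C.
      by apply/CrealP/ger0_real; rewrite ler0c invr_ge0 sqrtr_ge0.
    rewrite -tpE -!rmorphM /= mulrA -invfM -expr2 sqr_sqrtr //.
    by rewrite mulVf // gt_eqF.
  rewrite value starZ pp.1 -mul2A mul2Zr pp.2 mul2Zl mul2Zr pp.2 !tr2Z.
  have -> : ((Num.sqrt (complex.Re (tr2 p)))^-1)%:C^*%R =
       ((Num.sqrt (complex.Re (tr2 p)))^-1)%:C.
    by apply/CrealP/ger0_real; rewrite ler0c invr_ge0 sqrtr_ge0.
  rewrite -tpE -!rmorphM /= [_^-1 * (_ * _)]mulrA -invfM -expr2 sqr_sqrtr //.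
  by rewrite mulVf ?gt_eqF // mulr1 sqrtr_sqr ger0_norm.
apply/eqP; rewrite eq_le; apply/andP; split.
  by apply: ge_sup => //; exists k.
by apply: ub_le_sup => //; exists k.
Qed.

Lemma powR_fixed (r t : R) : 1 < t -> 0 <= r -> r `^ t = r -> r = 0 \/ r = 1.
Proof.
move=> t1; rewrite le_eqVlt => /orP[/eqP <-|r0]; first by left.
rewrite /powR gt_eqF // => h.
have /eqP : t * ln r = ln r by apply: expR_inj; rewrite h lnK.
rewrite -subr_eq0 -{2}[ln r]mul1r -mulrBl mulf_eq0 subr_eq0 (gt_eqF t1) /=.
by rewrite ln_eq0 // => /eqP; right.
Qed.

Lemma powR_le_self (r t : R) : 1 < t -> 0 <= r -> r <= 1 -> r `^ t <= r.
Proof.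
move=> t1; rewrite le_eqVlt => /orP[/eqP <- _|r0 r1].
  by rewrite powR0 // gt_eqF // (lt_trans _ t1).
rewrite -[leRHS](powRr1 (ltW r0)); apply: ger_powR; last exact: ltW.
by rewrite r0 r1.
Qed.

(** As 0 <= r <= 1 on the spectrum, r^t <= r; equality of the traces forces
    r^t = r, hence r = 0 or r = 1, at each eigenvalue of nonzero
    multiplicity. *)
Lemma proj_of_powR t z : 1 < t -> is_positive z -> is_positive (one - z) ->
  forall n (r : 'I_n -> R) (e : 'I_n -> P),
  (forall i, is_proj (e i)) -> (forall i j, i != j -> e i ∘ e j = 0) ->
  (forall i, 0 <= r i) -> z = \sum_i (r i)%:C *: e i ->
  \sum_i r i `^ t * complex.Re (tr2 (e i)) = complex.Re (tr2 z) -> is_proj z.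
Proof.
move=> t1 pz pz1 n r e e1 e2 r0 ez hsum.
pose T i := complex.Re (tr2 (e i)).
have T0 i : 0 <= T i by exact: (ge0_Re (pos_tr hA (pos_proj (e1 i)))).2.
have TE i : (T i)%:C = tr2 (e i) by exact: (ge0_Re (pos_tr hA (pos_proj (e1 i)))).1.
have r1 i : e i != 0 -> r i <= 1.
  move=> ei; have := pos_tr_mul hA (pos_proj (e1 i)) pz1.
  rewrite mul2Br mul2_1 tr2B ez (mul2_eigenl (fun i => (r i)%:C)) // tr2Z -TE.
  rewrite -rmorphM -rmorphB ler0c -{1}[T i]mul1r -mulrBl pmulr_lge0 ?subr_ge0 //.
  by rewrite -ltr0c TE; exact: tr2_proj_gt0.
have trz : complex.Re (tr2 z) = \sum_i r i * T i.
  rewrite ez tr2_sum; have -> : \sum_i tr2 ((r i)%:C *: e i) = (\sum_i r i * T i)%:C.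
    by rewrite rmorph_sum; apply: eq_bigr => i _; rewrite tr2Z -TE rmorphM.
  by [].
have le i : r i `^ t * T i <= r i * T i.
  have [ei|ei] := eqVneq (e i) 0; last by rewrite ler_wpM2r // powR_le_self ?r1.
  by rewrite /T ei tr20 !mulr0.
have each i : r i `^ t * T i = r i * T i.
  have : \sum_i (r i * T i - r i `^ t * T i) = 0.
    by rewrite sumrB -trz hsum subrr.
  move/eqP; rewrite psumr_eq0 => [/allP/(_ i)|j _]; last by rewrite subr_ge0.
  by rewrite mem_index_enum subr_eq0 => /(_ isT)/eqP.
split; first exact: (pos_star hA).
rewrite ez mul2_orthogonal //; apply: eq_bigr => i _.
have [->|ei] := eqVneq (e i) 0; first by rewrite !scaler0.
have Ti : T i != 0 by rewrite gt_eqF // -ltr0c TE; exact: tr2_proj_gt0.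
have [->|->] := powR_fixed t1 (r0 i) (mulIf Ti (each i)).
  by rewrite mul0r.
by rewrite mul1r.
Qed.

End Norms.

Section NormConditions.
Variables (R : realType) (A : planar_star_algebra R).
Hypothesis hA : is_subfactor_planar_algebra A.
Hypothesis hirr : is_irreducible A.
Variable s : bool.
Local Notation C := R[i].
Local Notation P := (box A (2%N, s)).
Local Notation "x ∘ y" := (mul2 x y) (at level 40, left associativity).
Local Notation one := (one2 A s).
Local Notation δ := (delta A).
Variables p q : P.
Hypotheses (hp : is_proj p) (hq : is_proj q) (hp0 : p != 0) (hq0 : q != 0).

Let tq : 0 < tr2 q. Proof. exact: (tr2_proj_gt0 hA). Qed.
Let dgt : 0 < δ. Proof. exact: (delta_gt0 hA hirr hq0). Qed.
Let k : R := complex.Re (tr2 q / δ).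
Let kE : k%:C = tr2 q / δ.
Proof. by apply: (ge0_Re _).1; rewrite divr_ge0 ?ltW. Qed.
Let k0 : 0 < k. Proof. by rewrite -ltr0c kE divr_gt0. Qed.

Lemma lnorm1_proj : (lnorm 1%E q)%:C = tr2 q.
Proof.
have := lnorm_proj hA hq (oner_neq0 R) ler01.
rewrite scale1r mul1r invr1 => ->.
have [h1 h2] := ge0_Re (ltW tq).
by rewrite powRr1.
Qed.

Lemma lnorm_coprod_of_proj : is_proj ((δ / tr2 q) *: (p ⋆ q)) ->
  forall t : \bar R, (1 <= t)%E ->
  (lnorm t (p ⋆ q))%:C = δ^-1 * (lnorm t p)%:C * (lnorm 1%E q)%:C.
Proof.
rewrite -/(nconv q p) => pc t t1; rewrite lnorm1_proj.
rewrite (coprodE hA hirr tq) -kE.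
have c0 : nconv q p != 0.
  apply: contra_neq hp0 => c0; apply: (pos_tr_eq0 hA (pos_proj hp)).
  by rewrite -(tr2_conv hA hirr tq p) c0 tr20.
have -> : δ^-1 * (lnorm t p)%:C * tr2 q = (k * lnorm t p)%:C.
  by rewrite rmorphM /= kE; ring.
congr (_%:C); case: t t1 => [t|_|//] /=.
- rewrite lee_fin => t1.
  have t0 : t != 0 by rewrite gt_eqF // (lt_le_trans ltr01).
  rewrite -/(lnorm t%:E (k%:C *: nconv q p)) -/(lnorm t%:E p).
  rewrite (lnorm_proj hA pc t0 (ltW k0)) (tr2_conv hA hirr tq).
  have := lnorm_proj hA hp t0 ler01; rewrite scale1r mul1r => ->.
  by [].
- rewrite (op_norm_proj hA pc c0 (ltW k0)).
  have := op_norm_proj hA hp hp0 ler01; rewrite scale1r => ->.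
  by rewrite mulr1.
Qed.

(** Dividing by tr(q)/δ, the hypothesis reads tr(z^t) = tr(p) = tr(z) for the
    normalized convolution z. *)
Lemma proj_of_lnorm_coprod (t : R) : 1 < t ->
  (lnorm t%:E (p ⋆ q))%:C = δ^-1 * (lnorm t%:E p)%:C * (lnorm 1%E q)%:C ->
  is_proj ((δ / tr2 q) *: (p ⋆ q)).
Proof.
move=> t1; rewrite [X in _ = _ * X]lnorm1_proj => heq.
suff : is_proj (nconv q p) by [].
move: heq; have -> : δ^-1 * (lnorm t%:E p)%:C * tr2 q = (k * lnorm t%:E p)%:C.
  by rewrite rmorphM /= kE; ring.
have t0 : t != 0 by rewrite gt_eqF // (lt_trans ltr01).
have pz : is_positive (nconv q p).
  by apply: pos_conv => //; exact: pos_proj.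
have pz1 : is_positive (one - nconv q p).
  by apply: conv_le1 => //; [exact: pos_proj | exact: pos_sub1].
have [n [l [e [e1 e2 e3 e4 e5]]]] := pos_spectral hA pz.
pose r i := complex.Re (l i).
have rE i : (r i)%:C = l i by exact: (ge0_Re (e5 i)).1.
have r0 i : 0 <= r i by exact: (ge0_Re (e5 i)).2.
have ez : nconv q p = \sum_i (r i)%:C *: e i.
  by rewrite e4; apply: eq_bigr => i _; rewrite rE.
have eh : p ⋆ q = \sum_i (k * r i)%:C *: e i.
  rewrite (coprodE hA hirr tq) -kE ez scaler_sumr.
  by apply: eq_bigr => i _; rewrite scalerA rmorphM.
move=> heq; have : lnorm t%:E (p ⋆ q) = k * lnorm t%:E p by exact: complexI heq.
rewrite (lnorm_decomposition hA t e1 e2 e3 _ eh); last first.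
  by move=> i; rewrite mulr_ge0 // ltW.
have := lnorm_proj hA hp t0 ler01; rewrite scale1r mul1r => ->.
have -> : \sum_i (k * r i) `^ t * complex.Re (tr2 (e i)) =
    k `^ t * \sum_i r i `^ t * complex.Re (tr2 (e i)).
  rewrite mulr_sumr; apply: eq_bigr => i _.
  by rewrite powRM // ?(ltW k0) // mulrA.
have S0 : 0 <= \sum_i r i `^ t * complex.Re (tr2 (e i)).
  apply: sumr_ge0 => i _; rewrite mulr_ge0 ?powR_ge0 //.
  exact: (ge0_Re (pos_tr hA (pos_proj (e1 i)))).2.
rewrite powRM ?powR_ge0 // -powRrM mulfV // powRr1 ?ltW //.
move=> /(mulfI (lt0r_neq0 k0)) /(congr1 (fun x => x `^ t)).
rewrite -!powRrM mulVf // !powRr1 // => [h|]; last first.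
  exact: (ge0_Re (pos_tr hA (pos_proj hp))).2.
apply: (proj_of_powR hA t1 pz pz1 e1 e2 r0 ez).
by rewrite h (tr2_conv hA hirr tq).
Qed.

End NormConditions.

(** * The equivalences *)

Theorem theorem1p5 (R : realType) (A : planar_star_algebra R)
    (hA : is_subfactor_planar_algebra A) (hirr : is_irreducible A)
    (s : bool) (p q : box A (2%N, s))
    (hp : is_proj p) (hq : is_proj q) (hp0 : p != 0) (hq0 : q != 0) :
  Num.max (tr2 p) (tr2 q) <= supp_size (p ⋆ q) <= tr2 p * tr2 q /\
  [<-> supp_size (p ⋆ q) = tr2 p;
       is_proj ((delta A / tr2 q) *: (p ⋆ q));
       exists m j : nat, [/\ (j <= 1)%N, (0 < m + j)%N &
         supp_size (p ⋆ coprod_pow (q ⋆ contragredient q) m ⋆ coprod_pow q j)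
         = tr2 p];
       forall m j : nat, (j <= 1)%N -> (0 < m + j)%N ->
         supp_size (p ⋆ coprod_pow (q ⋆ contragredient q) m ⋆ coprod_pow q j)
         = tr2 p;
       exists B : box A (2%N, s),
         [/\ is_biproj B, is_right_subshift B q &
             exists x : box A (2%N, s),
               is_positive x /\ p = range_proj (x ⋆ B)];
       exists t : R, 1 < t /\
         (lnorm t%:E (p ⋆ q))%:C
         = (delta A)^-1 * (lnorm t%:E p)%:C * (lnorm 1%E q)%:C;
       forall t : \bar R, (1 <= t)%E ->
         (lnorm t (p ⋆ q))%:C
         = (delta A)^-1 * (lnorm t p)%:C * (lnorm 1%E q)%:C;
       le2 (gen_biproj (q ⋆ contragredient q))
           (spectral_proj (contragredient p ⋆ p) (tr2 p / delta A))].
Proof.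
have c12 := supp_size_eq_proj hA hirr hp hq hq0.
split.
  apply/andP; split; last exact: supp_size_le.
  rewrite /Num.max; case: ifP => _; [exact: supp_size_ge_r|exact: supp_size_ge_l].
have c27 := lnorm_coprod_of_proj hA hirr hp hq hp0 hq0.
have c62 := proj_of_lnorm_coprod hA hirr hp hq hq0.
have c14 := supp_size_iterates hA hirr hp hq hq0.
have c31 := supp_size_of_iterate hA hirr hp hq hq0.
tfae.
- by case: c12.
- by case: c12 => _ h /h h1; exists 0%N, 1%N; split=> //; exact: c14.
- by case=> m [j [hj hmj /(c31 m j hj hmj) h]]; exact: c14.
- by move=> /(_ 0%N 1%N isT isT)/(c31 0%N 1%N isT isT); exact: subshift_of_supp_size.
- move=> /(supp_size_of_subshift hA hirr hp hq hp0 hq0) h1.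
  exists 2; split; first by rewrite ltr1n.
  by apply: c27; [case: c12 => h _; exact: h | rewrite lee_fin ler1n].
- by case=> t [t1 /(c62 t t1) h2] u; exact: c27.
- move=> /(_ 2%:E); rewrite lee_fin ler1n => /(_ isT) h.
  have /c12 h1 := c62 2 (ltr1n R 2) h.
  by case: (supp_size_eq_gen_biproj hA hirr hp hq hp0 hq0) => + _; apply.
- by case: (supp_size_eq_gen_biproj hA hirr hp hq hp0 hq0).
Qed.
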